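(* Let $A$ be a Fréchet-Arens-Michael algebra and $I\subset A_+$ a closed left ideal. Set $X=A_+/I$. Suppose that there exists an Arens-Michael decomposition $A=\varprojlim(A_\lambda)_{\lambda\in\mathbb N}$, with canonical maps $\sigma_\lambda\colon A\to A_\lambda$, such that for each $\lambda\in\mathbb N$ the ideal $I_\lambda=\overline{(\sigma_\lambda)_+(I)}$ is weakly complemented in $(A_\lambda)_+$. Then the following conditions are equivalent: (i) $I$ has a right locally bounded approximate identity; (ii) $X$ is a strictly flat Fréchet $A$-module; (iii) $X$ is a flat Fréchet $A$-module.
   Context: All spaces are over $\mathbb C$. A Fréchet-Arens-Michael algebra is a Fréchet algebra whose topology is given by a family of submultiplicative seminorms. $A_+$ is the unitization of $A$ (an identity is always adjoined); a homomorphism $\varphi\colon A\to B$ extends uniquely to a unital homomorphism $\varphi_+\colon A_+\to B_+$. An Arens-Michael decomposition $A=\varprojlim A_\lambda$ is the isomorphism obtained from a directed family $\{\|\cdot\|_\lambda\}$ of submultiplicative seminorms generating the topology of $A$: $A_\lambda$ is the Banach algebra completion of $A$ with respect to $\|\cdot\|_\lambda$, $\sigma_\lambda\colon A\to A_\lambda$ is the canonical map, and the linking maps $A_\mu\to A_\lambda$ (for $\|\cdot\|_\lambda\le\|\cdot\|_\mu$) are the canonical ones. A closed left ideal $J$ of a Banach algebra $B$ is weakly complemented if its annihilator $J^\perp=\{f\in B^*: f|_J=0\}$ is a complemented subspace of the Banach space $B^*$. A (left or right) Fréchet $A$-module is a Fréchet space with a jointly continuous $A$-module structure. $\widehat\otimes$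 is the completed projective tensor product. For a right Fréchet module $Y$ and a left Fréchet module $X$, $Y\mathbin{\widehat\otimes}_A X=(Y\mathbin{\widehat\otimes}X)/N$, where $N$ is the closed linear span of all $y\cdot a\otimes x-y\otimes a\cdot x$. A left Fréchet $A$-module $X$ is strictly flat if $(\,\cdot\,)\mathbin{\widehat\otimes}_A X$ takes every algebraically exact sequence $0\to Y_1\to Y_2\to Y_3\to0$ of right Fréchet $A$-modules (with continuous module maps) to an exact sequence of vector spaces; $X$ is flat if this holds for all such sequences that split as sequences of Fréchet spaces (by continuous linear maps). A topological algebra $B$ (here $B=I$ with the subspace topology) has a right locally bounded approximate identity if for each $0$-neighborhood $U\subset B$ there exists $C>0$ such that for each finite subset $F\subset B$ there exists $b\in CU$ with $a-ab\in U$ for all $a\in F$. *)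

(* Defs.v *)
From HB Require Import structures.
From mathcomp Require Import all_boot all_order all_algebra ring_quotient.
From mathcomp Require Import complex.
From mathcomp Require Import all_classical all_reals all_analysis.

Set Implicit Arguments.
Unset Strict Implicit.
Unset Printing Implicit Defensive.

Import Order.TTheory GRing.Theory Num.Theory.
Import numFieldNormedType.Exports.

Local Open Scope classical_set_scope.
Local Open Scope ring_scope.
Local Open Scope quotient_scope.

Definition is_subspace (K : numFieldType) (E : lmodType K) (S : set E) : Prop :=
  S 0 /\ forall (k : K) (x y : E), S x -> S y -> S (k *: x + y).

Record linear_subspace (K : numFieldType) (E : lmodType K) := LinearSubspace {
  subspace_set :> set E;
  subspaceP : is_subspace subspace_set }.

Definition subspace_pred (K : numFieldType) (E : lmodType K)
    (S : linear_subspace E) : {pred E} := fun x => `[< subspace_set S x >].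

Section QuotientSpace.
Context (K : numFieldType) (E : tvsType K) (S : linear_subspace E).

Fact subspace_pred_closed : zmod_closed (subspace_pred S).
Proof.
have [S0 SD] := subspaceP S; split; first exact/asboolP.
move=> x y /asboolP Sx /asboolP Sy; apply/asboolP.
by have := SD (-1) y x Sy Sx; rewrite scaleN1r addrC.
Qed.

HB.instance Definition _ :=
  GRing.isZmodClosed.Build E (subspace_pred S) subspace_pred_closed.

Definition tvs_quot : Type := Quotient.quot (subspace_pred S).

HB.instance Definition _ := GRing.Zmodule.on tvs_quot.

Definition quot_pi (x : E) : tvs_quot :=
  \pi_(Quotient.quot (subspace_pred S)) x.

(* The topology cannot be copied from the library's [quotient_topology], which
   puts another (non-convertible) choice structure on the carrier. *)
Definition quot_open (U : set tvs_quot) : Prop := open (quot_pi @^-1` U).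

Fact quot_openT : quot_open setT.
Proof. by rewrite /quot_open preimage_setT; exact: openT. Qed.

Fact quot_openI (U V : set tvs_quot) :
  quot_open U -> quot_open V -> quot_open (U `&` V).
Proof. exact: openI. Qed.

Fact quot_open_bigU (I : Type) (f : I -> set tvs_quot) :
  (forall i, quot_open (f i)) -> quot_open (\bigcup_i f i).
Proof. by move=> fo; apply: bigcup_open => i _; exact: fo. Qed.

HB.instance Definition _ :=
  isOpenTopological.Build tvs_quot quot_openT quot_openI quot_open_bigU.

Lemma quot_piP (x y : E) : quot_pi x = quot_pi y <-> subspace_set S (x - y).
Proof.
have e := @Quotient.idealrBE E (subspace_pred S) x y.
split=> [h|/asboolP h]; first by apply/asboolP; apply: (etrans e); exact/eqP.
by apply: (@eqP (Quotient.quot (subspace_pred S))); apply: (etrans (esym e)).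
Qed.

Lemma quot_pi_repr (q : tvs_quot) : exists x, quot_pi x = q.
Proof.
by exists (repr (q : Quotient.quot (subspace_pred S))); exact: reprK.
Qed.

Lemma quot_piD (x y : E) : quot_pi (x + y) = quot_pi x + quot_pi y.
Proof. by rewrite /quot_pi Quotient.pi_add. Qed.

Definition quot_scale (k : K) (q : tvs_quot) : tvs_quot :=
  quot_pi (k *: repr (q : Quotient.quot (subspace_pred S))).

Lemma quot_scale_pi (k : K) (x : E) :
  quot_scale k (quot_pi x) = quot_pi (k *: x).
Proof.
apply/quot_piP; rewrite -scalerBr.
have [S0 SD] := subspaceP S; rewrite -[_ *: _]addr0; apply: SD => //.
by apply/quot_piP; exact: (@reprK _ (Quotient.quot (subspace_pred S))).
Qed.

Fact quot_scaleA (a b : K) (q : tvs_quot) :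
  quot_scale a (quot_scale b q) = quot_scale (a * b) q.
Proof. by have [x <-] := quot_pi_repr q; rewrite !quot_scale_pi scalerA. Qed.

Fact quot_scale1 : left_id 1 quot_scale.
Proof.
by move=> q; have [x <-] := quot_pi_repr q; rewrite quot_scale_pi scale1r.
Qed.

Fact quot_scaleDr : right_distributive quot_scale +%R.
Proof.
move=> k p q; have [x <-] := quot_pi_repr p; have [y <-] := quot_pi_repr q.
by rewrite -quot_piD !quot_scale_pi scalerDr quot_piD.
Qed.

Fact quot_scaleDl (q : tvs_quot) : {morph quot_scale^~ q : a b / a + b}.
Proof.
move=> a b; have [x <-] := quot_pi_repr q.
by rewrite !quot_scale_pi scalerDl quot_piD.
Qed.

HB.instance Definition _ := GRing.Zmodule_isLmodule.Build K tvs_quot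
  quot_scaleA quot_scale1 quot_scaleDr quot_scaleDl.

Lemma quot_piZ (k : K) (x : E) : quot_pi (k *: x) = k *: quot_pi x.
Proof. by rewrite -quot_scale_pi. Qed.

Lemma quot_pi_continuous : continuous quot_pi.
Proof. exact/continuousP. Qed.

Lemma quot_pi_open (O : set E) : open O -> open (quot_pi @` O).
Proof.
move=> oO; rewrite /open /= /quot_open openE => x [y Oy yx]; rewrite /interior.
have Sxy : subspace_set S (y - x) by exact/quot_piP.
have : nbhs (x + (y - x)) O by rewrite addrC subrK; exact: open_nbhs_nbhs.
move=> /(@add_continuous E (x, y - x)) [[A B] [/= Ax /nbhs_singleton By] AB].
apply: filterS Ax => z Az; have /= Oz := AB (z, y - x) (conj Az By).
by exists (z + (y - x)) => //; apply/quot_piP; rewrite addrAC subrr add0r.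
Qed.

Lemma quot_pi_nbhs (x : E) (U : set E) :
  nbhs x U -> nbhs (quot_pi x) (quot_pi @` U).
Proof.
rewrite nbhsE => -[V [oV Vx] VU].
apply: (@filterS _ _ _ (quot_pi @` V)); first exact: image_subset.
by apply: open_nbhs_nbhs; split; [exact: quot_pi_open|exists x].
Qed.

Fact quot_add_continuous :
  continuous (fun q : tvs_quot * tvs_quot => q.1 + q.2).
Proof.
move=> [p q]; have [x <-] := quot_pi_repr p; have [y <-] := quot_pi_repr q.
move=> U /=; rewrite -quot_piD => /quot_pi_continuous.
move=> /(@add_continuous E (x, y)) [[A B] [/= Ax By] AB].
exists (quot_pi @` A, quot_pi @` B); first by split; exact: quot_pi_nbhs.
move=> [_ _] /= [[a Aa <-] [b Bb <-]]; rewrite -quot_piD.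
exact: (AB (a, b)).
Qed.

Fact quot_scale_continuous :
  continuous (fun z : K^o * tvs_quot => z.1 *: z.2).
Proof.
move=> [k q]; have [x <-] := quot_pi_repr q.
move=> U /=; rewrite -quot_piZ => /quot_pi_continuous.
move=> /(@scale_continuous K E (k, x)) [[A B] [/= Ak Bx] AB].
exists (A, quot_pi @` B); first by split => //; exact: quot_pi_nbhs.
move=> [a _] /= [Aa [b Bb <-]]; rewrite -quot_piZ.
exact: (AB (a, b)).
Qed.

Fact quot_locally_convex : exists2 B : set_system tvs_quot,
  (forall b, b \in B -> convex_set b) & basis B.
Proof.
have [B Bc [Bo Bb]] := @locally_convex K E.
exists [set quot_pi @` b | b in B].
  move=> _ /[!inE] -[b Bb0 <-] p q l /[!inE] -[x bx <-] [y cy <-].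
  have := Bc b; rewrite inE => /(_ Bb0) /(_ x y l).
  rewrite !inE => /(_ bx cy) h; eexists; first exact: h.
  by rewrite /conv /= quot_piD !quot_piZ.
split; first by move=> _ [b /Bo ob <-]; exact: quot_pi_open.
move=> q; have [x <-] := quot_pi_repr q.
move=> U /quot_pi_continuous /Bb [b [Bb0 bx] bU].
exists (quot_pi @` b); first by split; [exists b|exists x].
by move=> _ [y /bU Uy <-].
Qed.

HB.instance Definition _ := PreTopologicalLmod_isTvs.Build K tvs_quot
  quot_add_continuous quot_scale_continuous quot_locally_convex.
HB.instance Definition _ :=
  PreTopologicalNmodule_isTopologicalNmodule.Build tvs_quot quot_add_continuous.
HB.instance Definition _ :=
  TopologicalNmodule_isTopologicalLmodule.Build K tvs_quot
    quot_scale_continuous.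
HB.instance Definition _ :=
  Uniform_isTvs.Build K tvs_quot quot_locally_convex.

End QuotientSpace.

Section FrechetSpaces.
Context (K : numFieldType).

(* The uniformity carried by a [tvsType] is only required to induce its
   topology, not to be translation invariant; Cauchy filters are therefore
   taken with respect to the neighbourhoods of 0. *)
Definition tvs_cauchy (E : tvsType K) (F : set_system E) : Prop :=
  forall U : set E, nbhs 0 U ->
    exists2 D : set E, F D & forall x y, D x -> D y -> U (x - y).

Definition tvs_complete (E : tvsType K) : Prop :=
  forall F : set_system E, ProperFilter F -> tvs_cauchy F ->
    exists x : E, F --> x.

(* A [tvsType] is locally convex, and a Hausdorff topological vector space is
   metrizable iff 0 has a countable base of neighbourhoods. *)
Definition frechet (E : tvsType K) : Prop :=
  [/\ hausdorff_space E,
      exists B : nat -> set E, (forall n, nbhs 0 (B n)) /\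
        (forall U, nbhs 0 U -> exists n, B n `<=` U)
    & tvs_complete E].

Definition bilin (E F G : lmodType K) (b : E -> F -> G) : Prop :=
  (forall x, linear (b x)) /\ (forall y, linear (b^~ y)).

Definition short_exact (E F G : lmodType K) (f : E -> F) (g : F -> G) : Prop :=
  [/\ injective f, range f = g @^-1` [set 0] & range g = setT].

(* Real-valuedness and nonnegativity of a seminorm follow from the two axioms
   for the partial order of K. *)
Definition seminorm (E : lmodType K) (p : E -> K) : Prop :=
  (forall x y, p (x + y) <= p x + p y) /\
  (forall k x, p (k *: x) = `|k| * p x).

Definition generates_topology (E : tvsType K) (P : set (E -> K)) : Prop :=
  forall U : set E, nbhs 0 U <->
    exists (F : set (E -> K)) (e : K), [/\ finite_set F, F `<=` P, 0 < e
      & [set x | forall p, F p -> p x < e] `<=` U].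

End FrechetSpaces.

(* Algebras need not be unital, so they are carried by an [lmodType] together
   with an explicit multiplication. *)
Section Algebras.
Context (K : numFieldType).

Definition is_alg (A : lmodType K) (mul : A -> A -> A) : Prop :=
  bilin mul /\ associative mul.

Definition submultiplicative (A : lmodType K) (mul : A -> A -> A)
  (p : A -> K) : Prop := forall a b, p (mul a b) <= p a * p b.

Definition frechet_arens_michael (A : tvsType K) (mul : A -> A -> A) : Prop :=
  [/\ frechet A, is_alg mul, continuous (fun z : A * A => mul z.1 z.2)
    & exists P : set (A -> K),
        (forall p, P p -> seminorm p /\ submultiplicative mul p) /\
        generates_topology P].

Record banach_alg := BanachAlg {
  ba_space :> completeNormedModType K;
  ba_mul : ba_space -> ba_space -> ba_space;
  ba_alg : is_alg ba_mul;
  ba_submul : forall a b, `|ba_mul a b| <= `|a| * `|b| }.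

(* The completion of A for the seminorm [am_norm l] is given as a Banach algebra
   with a norm-preserving homomorphism of dense range; the linking maps and the
   isomorphism of A with the inverse limit are determined by these data. *)
Record arens_michael_decomposition (A : tvsType K) (mul : A -> A -> A) :=
  ArensMichaelDecomposition {
  am_norm : nat -> A -> K;
  am_seminorm : forall l, seminorm (am_norm l);
  am_submul : forall l, submultiplicative mul (am_norm l);
  am_directed : forall l m, exists n, forall a,
    am_norm l a <= am_norm n a /\ am_norm m a <= am_norm n a;
  am_generates : generates_topology (range am_norm);
  am_alg : nat -> banach_alg;
  am_map : forall l, A -> am_alg l;
  am_map_linear : forall l, linear (am_map l);
  am_map_mul : forall l a b,
    am_map l (mul a b) = ba_mul (am_map l a) (am_map l b);
  am_map_norm : forall l a, `|am_map l a| = am_norm l a;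
  am_map_dense : forall l, dense (range (am_map l)) }.

(* The unitization of A is A * K^o with unit (0, 1), carrying the product
   topology. For a Banach algebra the product norm (a maximum) is equivalent to
   the usual submultiplicative one; only the topology matters below. *)
Definition unit_mul (A : lmodType K) (mul : A -> A -> A)
    (x y : (A * K^o)%type) : (A * K^o)%type :=
  (mul x.1 y.1 + x.2 *: y.1 + y.2 *: x.1, x.2 * y.2).

Definition unit_map (A B : lmodType K) (f : A -> B)
    (x : (A * K^o)%type) : (B * K^o)%type := (f x.1, x.2).

Definition left_ideal (A : lmodType K) (mul : A -> A -> A) (I : set A) : Prop :=
  is_subspace I /\ forall a x, I x -> I (mul a x).

Definition right_locally_bounded_approximate_identity (A : tvsType K)
    (mul : A -> A -> A) (B : set A) : Prop :=
  forall U : set A, U `<=` B -> within B (nbhs 0) U ->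
    exists2 c : K, 0 < c &
      forall F : set A, finite_set F -> F `<=` B ->
        exists b : A, [set c *: u | u in U] b /\
          forall a, F a -> U (a - mul a b).

End Algebras.

Section WeakComplement.
Context (K : numFieldType) (E : normedModType K).

Definition topological_dual : set (E -> K^o) :=
  [set f | linear f /\ continuous f].

Definition annihilator (J : set E) : set (E -> K^o) :=
  [set f | topological_dual f /\ forall x, J x -> f x = 0].

(* The dual norm of f is at most r. *)
Definition dual_norm_le (f : E -> K^o) (r : K) : Prop :=
  0 <= r /\ forall x, `|f x| <= r * `|x|.

(* V is the range of a bounded linear projection of the dual. *)
Definition complemented_in_dual (V : set (E -> K^o)) : Prop :=
  exists P : (E -> K^o) -> (E -> K^o),
    [/\ forall f, topological_dual f -> V (P f),
        forall f, V f -> P f = f,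
        forall k f g, topological_dual f -> topological_dual g ->
          P (k *: f + g) = k *: P f + P g
      & exists M : K, forall f r, topological_dual f ->
          dual_norm_le f r -> dual_norm_le (P f) (M * r)].

Definition weakly_complemented (J : set E) : Prop :=
  complemented_in_dual (annihilator J).

End WeakComplement.

Section CompletedTensor.
Context (K : numFieldType).

(* The completed projective tensor product, by its universal property; the
   realization is unique up to a unique isomorphism. *)
Record ctensor (Y X : tvsType K) := CTensor {
  ct_space :> tvsType K;
  ct_hausdorff : hausdorff_space ct_space;
  ct_complete : tvs_complete ct_space;
  ct_map : Y -> X -> ct_space;
  ct_bilin : bilin ct_map;
  ct_continuous : continuous (fun z : Y * X => ct_map z.1 z.2);
  ct_universal : forall (Z : tvsType K) (b : Y -> X -> Z),
    hausdorff_space Z -> tvs_complete Z ->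
    bilin b -> continuous (fun z : Y * X => b z.1 z.2) ->
    exists! h : ct_space -> Z,
      [/\ linear h, continuous h & forall y x, h (ct_map y x) = b y x] }.

Definition closed_subspace (E : tvsType K) (S : set E) : Prop :=
  is_subspace S /\ closed S.

Lemma closed_span_is_subspace (E : tvsType K) (G : set E) :
  is_subspace (smallest (@closed_subspace E) G).
Proof.
split; first by move=> S [[[S0 _] _] _].
move=> k x y Sx Sy S SG; have [[[_ SD] _] _] := SG.
by apply: SD; [exact: Sx|exact: Sy].
Qed.

Definition closed_span (E : tvsType K) (G : set E) : linear_subspace E :=
  LinearSubspace (closed_span_is_subspace G).

Context (A : tvsType K) (mul : A -> A -> A).

Definition left_frechet_module (X : tvsType K) (act : A -> X -> X) : Prop :=
  [/\ frechet X, bilin act, continuous (fun z : A * X => act z.1 z.2)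
    & forall a b x, act (mul a b) x = act a (act b x)].

Definition right_frechet_module (Y : tvsType K) (act : Y -> A -> Y) : Prop :=
  [/\ frechet Y, bilin act, continuous (fun z : Y * A => act z.1 z.2)
    & forall y a b, act y (mul a b) = act (act y a) b].

Definition right_module_map (Y Y' : tvsType K) (act : Y -> A -> Y)
    (act' : Y' -> A -> Y') (f : Y -> Y') : Prop :=
  [/\ linear f, continuous f & forall y a, f (act y a) = act' (f y) a].

Section TensorOver.
Context (X : tvsType K) (lact : A -> X -> X).

Definition balancing (Y : tvsType K) (ract : Y -> A -> Y) (T : ctensor Y X) :
    linear_subspace T :=
  closed_span
    [set u | exists y a x, u = ct_map T (ract y a) x - ct_map T y (lact a x)].

Definition tensor_over (Y : tvsType K) (ract : Y -> A -> Y) (T : ctensor Y X) :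
  tvsType K := tvs_quot (balancing ract T).

Definition tensor_over_map (Y : tvsType K) (ract : Y -> A -> Y)
    (T : ctensor Y X) (y : Y) (x : X) : tensor_over ract T :=
  quot_pi (balancing ract T) (ct_map T y x).

(* Phi is the map induced by the module map f on the tensor products over A. *)
Definition tensor_induced (Y Y' : tvsType K) (ract : Y -> A -> Y)
    (ract' : Y' -> A -> Y') (T : ctensor Y X) (T' : ctensor Y' X) (f : Y -> Y')
    (Phi : tensor_over ract T -> tensor_over ract' T') : Prop :=
  [/\ linear Phi, continuous Phi & forall y x,
    Phi (tensor_over_map ract T y x) = tensor_over_map ract' T' (f y) x].

Definition tensor_exact (Y1 Y2 Y3 : tvsType K) (r1 : Y1 -> A -> Y1)
    (r2 : Y2 -> A -> Y2) (r3 : Y3 -> A -> Y3) (f : Y1 -> Y2) (g : Y2 -> Y3) :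
    Prop :=
  forall (T1 : ctensor Y1 X) (T2 : ctensor Y2 X) (T3 : ctensor Y3 X)
    (Phi : tensor_over r1 T1 -> tensor_over r2 T2)
    (Psi : tensor_over r2 T2 -> tensor_over r3 T3),
  tensor_induced f Phi -> tensor_induced g Psi -> short_exact Phi Psi.

Definition strictly_flat : Prop :=
  left_frechet_module lact /\
  forall (Y1 Y2 Y3 : tvsType K) (r1 : Y1 -> A -> Y1) (r2 : Y2 -> A -> Y2)
    (r3 : Y3 -> A -> Y3) (f : Y1 -> Y2) (g : Y2 -> Y3),
  right_frechet_module r1 -> right_frechet_module r2 ->
  right_frechet_module r3 ->
  right_module_map r1 r2 f -> right_module_map r2 r3 g ->
  short_exact f g -> tensor_exact r1 r2 r3 f g.

Definition flat : Prop :=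
  left_frechet_module lact /\
  forall (Y1 Y2 Y3 : tvsType K) (r1 : Y1 -> A -> Y1) (r2 : Y2 -> A -> Y2)
    (r3 : Y3 -> A -> Y3) (f : Y1 -> Y2) (g : Y2 -> Y3),
  right_frechet_module r1 -> right_frechet_module r2 ->
  right_frechet_module r3 ->
  right_module_map r1 r2 f -> right_module_map r2 r3 g ->
  short_exact f g ->
  (exists (r : Y2 -> Y1) (s : Y3 -> Y2),
    [/\ linear r /\ continuous r, linear s /\ continuous s,
        cancel f r, cancel s g & forall y, f (r y) + s (g y) = y]) ->
  tensor_exact r1 r2 r3 f g.

End TensorOver.

(* a . [x] = [(a, 0) x], which does not depend on the representative x when I
   is a left ideal of the unitization. *)
Definition quot_act (I : linear_subspace (A * K^o)%type) (a : A)
    (q : tvs_quot I) : tvs_quot I :=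
  quot_pi I (unit_mul mul (a, 0) (repr q)).

End CompletedTensor.

(* Main.v *)
(* Let X = A_+/I. For a right Frechet module Y the map y |-> y (x) [1] induces an
   isomorphism of Y/cl(Y I) with the tensor product of Y and X over A. Hence an
   exact sequence 0 -> Y1 -> Y2 -> Y3 -> 0 stays exact iff Y1 meets cl(Y2 I) in
   cl(Y1 I) and every element of Y2 mapped into cl(Y3 I) lies in Y1 + cl(Y2 I).

   (i) => (ii). The topology of Y is generated by seminorms p such that
   p(y a) <= |a| p(y) for some seminorm |.| of the decomposition, so that y - y b
   becomes small for y in cl(Y I) and suitable b in I. With the open mapping theorem
   this gives the first condition; the second one follows by a Cohen-type series.

   (iii) => (i). Let B be the unitization of A_l and J the closure of the image of I.
   The sequence of right modules 0 -> J^perp -> B^* -> B^*/J^perp -> 0 splits, since J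
   is weakly complemented. Elements of cl(J^perp I) vanish at 1, so exactness and the
   open mapping theorem bound |g(1)| for g in cl(B^* I) by a multiple of the distance
   from g to J^perp. By Hahn-Banach this yields, with bounds depending only on l, the
   approximate identity in the seminorm |.|_l. *)

Require Import Defs.
From HB Require Import structures.
From mathcomp Require Import all_boot all_order all_algebra complex.
From mathcomp Require Import all_classical all_reals all_analysis ring lra zify.

Set Implicit Arguments.
Unset Strict Implicit.
Unset Printing Implicit Defensive.

Import Order.TTheory GRing.Theory Num.Theory.
Import numFieldNormedType.Exports.

Local Open Scope classical_set_scope.
Local Open Scope ring_scope.
Local Open Scope complex_scope.

(** * Locally convex spaces *)

(** Duals appear because [B] is a left module while the test sequences consist of right modules, and
    a splitting is required because flatness tests only split sequences. The bound in the
    approximate identity has to be uniform over finite families [a] of elements of [I]. A functional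
    on [B] times [B^n] that separates [(0, sigma a)] from the attainable pairs has components [psi]
    and [f_i]; the sum [G] of the [f_i a_i] agrees with [psi] on [I], so [G - psi] lies in J^perp,
    and its value at 1 is controlled by the norm of [psi] alone, whatever the family and the
    precision. In the opposite direction the constant [c] depends on the neighbourhood, while the
    Cohen series runs through infinitely many of them. All [c n] are therefore fixed first, and the
    vectors [w n] are then made small relative to them. Tensor products are known only by their
    universal property, so flatness says nothing until one of them is constructed; Hahn-Banach for
    disks serves both that construction and the final separation. *)

Section TvsNeighbourhoods.
Context (K : numFieldType).
Implicit Types E F : tvsType K.

Lemma nbhs_translate E (x : E) (U : set E) :
  nbhs x U <-> nbhs 0 [set v | U (x + v)].
Proof.
split=> [xU|/(@nbhsT _ _ _ x)].
  have := @nbhsB _ E U x (- x) xU; rewrite addNr; apply: filterS.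
  by move=> _ [y Uy <-] /=; rewrite addNKr.
by apply: filterS => _ [y /= Uy <-].
Qed.

Lemma nbhs0_add E (U : set E) : nbhs 0 U ->
  exists2 V : set E, nbhs 0 V & forall x y, V x -> V y -> U (x + y).
Proof.
move=> U0; have := @add_continuous E (0, 0) U.
rewrite /= addr0 => /(_ U0) [[A B] [/= A0 B0] AB].
exists (A `&` B); first exact: filterI.
by move=> x y [Ax _] [_ By]; exact: (AB (x, y)).
Qed.

Lemma nbhs0_scale E (U : set E) (k : K) : nbhs 0 U -> nbhs 0 [set x | U (k *: x)].
Proof.
move=> U0; have := @scale_continuous K E (k, 0) U.
rewrite /= scaler0 => /(_ U0) [[A B] [/= A0 B0] AB].
by apply: filterS B0 => x Bx /=; apply: (AB (k, x)); split=> //; exact: nbhs_singleton.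
Qed.

Lemma nbhs0_absorb E (U : set E) (x : E) : nbhs 0 U ->
  exists2 t : K, 0 < t & forall k, `|k| <= t -> U (k *: x).
Proof.
move=> U0; have := @scale_continuous K E (0, x) U.
rewrite /= scale0r => /(_ U0) [[A B] [/= [e /= e0 eA] B0] AB].
exists (e / 2); first by rewrite divr_gt0.
move=> k ke; apply: (AB (k, x)); split; last exact: nbhs_singleton.
apply: eA => /=; rewrite sub0r normrN (le_lt_trans ke)//.
by rewrite ltr_pdivrMr// ltr_pMr// ltr1n.
Qed.

Lemma linear0E (E F : lmodType K) (f : E -> F) : linear f -> f 0 = 0.
Proof. by move=> fl; have := fl (-1) 0 0; rewrite scaler0 addr0 scaleN1r addNr. Qed.

Lemma linear_continuousP E F (f : E -> F) : linear f ->
  (forall U, nbhs 0 U -> nbhs 0 (f @^-1` U)) <-> continuous f.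
Proof.
move=> fl; split=> [f0 x U|fc U U0]; last first.
  by have := fc 0 U; rewrite linear0E//; exact.
move=> /nbhs_translate /f0; rewrite /= => h; apply/nbhs_translate.
by apply: filterS h => v /=; have := fl 1 x v; rewrite !scale1r => ->.
Qed.

End TvsNeighbourhoods.

(** * Absolutely convex neighbourhoods *)

Section Disks.
Context (K : numFieldType).

(** Disks stand in for seminorms, as their unit balls. One condition on [a] and [b] covers both
    convexity and stability under scalars of modulus at most 1. *)
Definition disk (E : lmodType K) (D : set E) :=
  D 0 /\ forall (a b : K) x y, `|a| + `|b| <= 1 -> D x -> D y -> D (a *: x + b *: y).

Lemma disk_scale (E : lmodType K) (D : set E) a x :
  disk D -> `|a| <= 1 -> D x -> D (a *: x).
Proof.
move=> [D0 DD] a1 Dx; have := DD a 0 x 0; rewrite scaler0 addr0; apply => //.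
by rewrite normr0 addr0.
Qed.

Lemma disk_opp (E : lmodType K) (D : set E) x : disk D -> D x -> D (- x).
Proof. by move=> dD Dx; rewrite -scaleN1r; apply: disk_scale => //; rewrite normrN1. Qed.

(** This is the triangle inequality for the gauge of [D]: the combination is renormalized by
    [r + s]. *)
Lemma disk_add (E : lmodType K) (D : set E) (r s : K) x y :
  disk D -> 0 <= r -> 0 <= s -> D x -> D y ->
  exists2 z, D z & r *: x + s *: y = (r + s) *: z.
Proof.
move=> dD r0 s0 Dx Dy; have [rs0|rs0] := eqVneq (r + s) 0.
  exists 0; first by case: dD.
  move/eqP: rs0; rewrite paddr_eq0// => /andP[/eqP-> /eqP->].
  by rewrite !scale0r !addr0 scale0r.
exists ((r / (r + s)) *: x + (s / (r + s)) *: y).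
  apply: dD.2 => //; rewrite !ger0_norm ?divr_ge0 ?addr_ge0//.
  by rewrite -mulrDl divff.
by rewrite scalerDr !scalerA ![(r + s) * _]mulrC !divfK.
Qed.

(** The balanced core of a convex neighbourhood [C], that is the points whose multiples by scalars
    of modulus at most 1 all stay in [C], is again convex. Continuity of scaling at the origin makes
    it a neighbourhood. *)
Lemma nbhs0_disk (E : tvsType K) (U : set E) : nbhs 0 U ->
  exists D, [/\ nbhs 0 D, disk D & D `<=` U].
Proof.
move=> U0; have [B Bc [Bo Bb]] := @locally_convex K E.
have [C [BC C0] CU] := Bb 0 U U0.
have Cn : nbhs 0 C by apply: open_nbhs_nbhs; split => //; exact: Bo.
have cvxC (l : K) x y : 0 <= l -> l <= 1 -> C x -> C y -> C (l *: x + (1 - l) *: y).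
  move=> l0 l1 Cx Cy; have l01 : Itv.spec (@Itv.num_sem K) (Itv.Real `[0%Z, 1%Z]) l.
    by rewrite /Itv.spec/= /Itv.num_sem/= in_itv/= l0 l1 ger0_real.
  have := Bc C; rewrite inE => /(_ BC x y (Itv.mk l01)); rewrite !inE => /(_ Cx Cy).
  by rewrite /conv /=; exact.
pose D := [set x | forall k : K, `|k| <= 1 -> C (k *: x)].
have DC : D `<=` C by move=> x /(_ 1); rewrite normr1 scale1r; exact.
exists D; split; last exact: subset_trans CU.
- have := @scale_continuous K E (0, 0) C; rewrite /= scaler0 => /(_ Cn).
  move=> [[A W] [/= [e /= e0 eA] W0] AB].
  have e2 : e / 2 != 0 by rewrite mulf_neq0 ?invr_eq0 ?pnatr_eq0// gt_eqF.
  apply: filterS (nbhs0_scale (e / 2)^-1 W0) => x Wx k k1.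
  have -> : k *: x = (k * (e / 2)) *: ((e / 2)^-1 *: x).
    by rewrite scalerA mulfK.
  apply: (AB (k * (e / 2), (e / 2)^-1 *: x)); split => //=; apply: eA => /=.
  rewrite sub0r normrN normrM (@ger0_norm _ (e / 2)) ?divr_ge0 ?ltW//.
  rewrite (@le_lt_trans _ _ (e / 2))//; last by rewrite ltr_pdivrMr// ltr_pMr// ltr1n.
  by rewrite ler_piMl// divr_ge0// ltW.
- split=> [k _|a b x y ab Dx Dy k k1]; first by rewrite scaler0.
  rewrite scalerDr !scalerA.
  have [s0|s0] := eqVneq (`|k * a| + `|k * b|) 0.
    move/eqP: s0; rewrite paddr_eq0// !normr_eq0 => /andP[/eqP-> /eqP->].
    by rewrite !scale0r addr0.
  set s := _ + _ in s0; have s_ge0 : 0 <= s by rewrite addr_ge0.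
  have s_gt0 : 0 < s by rewrite lt_def s0.
  have s1 : s <= 1.
    by rewrite /s !normrM -mulrDr mulr_ile1// addr_ge0.
  (* [u c] is the phase of [c]. Once phases are absorbed into the points, the complex coefficients
     become the weights of a convex combination, up to the total mass [s]. *)
  pose u (c : K) := if c == 0 then 0 else c / `|c|.
  have uE c : c = `|c| * u c.
    by rewrite /u; case: eqVneq => [->|c0]; rewrite ?mulr0// mulrC divfK// normr_eq0.
  have u1 c : `|u c| <= 1.
    rewrite /u; case: eqVneq => [_|c0]; first by rewrite normr0.
    by rewrite normrM normrV ?unitfE ?normr_eq0// normr_id divff// normr_eq0.
  have := cvxC (`|k * a| / s) (s *: (u (k * a) *: x)) (s *: (u (k * b) *: y)).
  have DD (z : E) c : D z -> C (s *: (u c *: z)).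
    move=> Dz; rewrite scalerA; apply: Dz; rewrite normrM (ger0_norm s_ge0).
    by rewrite mulr_ile1.
  rewrite divr_ge0// ler_pdivrMr// mul1r lerDl normr_ge0.
  move=> /(_ isT isT (DD _ _ Dx) (DD _ _ Dy)).
  have -> : 1 - `|k * a| / s = `|k * b| / s.
    by rewrite -{1}(divff s0) -mulrBl /s addrAC subrr add0r.
  have cE c : `|c| / s * s * u c = c by rewrite divfK// -uE.
  by rewrite !scalerA !cE.
Qed.

End Disks.

(** * The Hahn-Banach theorem *)

Section HahnBanach.
Context (R : realType) (E : lmodType R[i]).
Local Open Scope complex_scope.
Implicit Types (x y z : E) (p q : E -> R).

(** The inequality for [t], applied also to the inverse of [t], gives equality; in this weak form
    the condition passes easily to infima. *)
Definition sublinear q := (forall x y, q (x + y) <= q x + q y) /\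
  (forall (t : R) x, 0 < t -> q (t%:C *: x) <= t * q x).

Lemma sublinear0 q : sublinear q -> q 0 = 0.
Proof.
move=> [qD qZ]; apply/eqP; rewrite eq_le; apply/andP; split.
  have := qZ 2^-1 0; rewrite scaler0 invr_gt0 ltr0n => /(_ isT).
  by rewrite -subr_ge0 -{2}[q 0]mul1r -mulrBl => h; lra.
by have := qD 0 0; rewrite addr0 -subr_ge0 addrK.
Qed.

Lemma sublinear_ge q x : sublinear q -> - q (- x) <= q x.
Proof.
by move=> ql; have := ql.1 x (- x); rewrite subrr sublinear0// => h; lra.
Qed.

Lemma sublinearZ q (t : R) x : sublinear q -> 0 <= t -> q (t%:C *: x) = t * q x.
Proof.
move=> ql; rewrite le0r => /orP[/eqP->|t0].
  by rewrite scale0r mul0r sublinear0.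
apply/eqP; rewrite eq_le ql.2//=.
have := ql.2 t^-1 (t%:C *: x); rewrite invr_gt0 => /(_ t0).
rewrite scalerA -rmorphM /= mulVf ?gt_eqF// scale1r.
by rewrite ler_pdivlMl.
Qed.

(** Serves three times: for the modification along a vector, for the infimum of a chain, and for the
    gauge of a disk. *)
Lemma inf_sublinear (S : E -> set R) :
  (forall x, S x !=set0) -> (forall x, has_lbound (S x)) ->
  (forall x y a b, S x a -> S y b -> exists2 c, S (x + y) c & c <= a + b) ->
  (forall t x a, 0 < t -> S x a -> exists2 c, S (t%:C *: x) c & c <= t * a) ->
  sublinear (fun x => inf (S x)).
Proof.
move=> S0 Slb SD SZ; have hS x : has_inf (S x) by split.
split=> [x y|t x t0].
  rewrite -lerBlDl; apply: lb_le_inf => // b Sb.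
  rewrite lerBlDl -lerBlDr; apply: lb_le_inf => // a Sa.
  rewrite lerBlDr; have [c Sc ca] := SD _ _ _ _ Sa Sb.
  by apply: le_trans ca; exact: ge_inf.
rewrite mulrC -ler_pdivrMr//; apply: lb_le_inf => // a Sa.
rewrite ler_pdivrMr// mulrC; have [c Sc ca] := SZ _ _ _ t0 Sa.
by apply: le_trans ca; exact: ge_inf.
Qed.

(* The Koenig modification of [q] in the direction [y]; it is dominated by [q]
   and takes a value at most [- q y] at [- y]. *)
Definition sublinear_along q y x : R :=
  inf [set a | exists2 t, 0 <= t & a = q (x + t%:C *: y) - t * q y].

Lemma sublinear_along_lb q x y t : sublinear q -> 0 <= t ->
  - q (- x) <= q (x + t%:C *: y) - t * q y.
Proof.
move=> ql t0; rewrite -(sublinearZ y ql t0).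
have := ql.1 (x + t%:C *: y) (- x); rewrite addrAC subrr add0r; lra.
Qed.

Lemma sublinear_along_has_lb q x y : sublinear q ->
  has_lbound [set a | exists2 t, 0 <= t & a = q (x + t%:C *: y) - t * q y].
Proof.
by move=> ql; exists (- q (- x)) => _ [t t0 ->]; exact: sublinear_along_lb.
Qed.

Lemma sublinear_alongP q y : sublinear q -> sublinear (sublinear_along q y).
Proof.
move=> ql; apply: inf_sublinear.
- by move=> x; exists (q (x + 0%:C *: y) - 0 * q y); exists 0.
- by move=> x; exact: sublinear_along_has_lb.
- move=> x x' _ _ [t t0 ->] [s s0 ->].
  exists (q (x + x' + (t + s)%:C *: y) - (t + s) * q y).
    by exists (t + s) => //; exact: addr_ge0.
  rewrite rmorphD scalerDl addrACA.
  have := ql.1 (x + t%:C *: y) (x' + s%:C *: y); lra.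
- move=> s x _ s0 [t t0 ->].
  exists (q (s%:C *: x + (s * t)%:C *: y) - (s * t) * q y).
    by exists (s * t) => //; rewrite mulr_ge0// ltW.
  rewrite rmorphM -scalerA -scalerDr.
  have := ql.2 s (x + t%:C *: y) s0; rewrite mulrBr mulrA; lra.
Qed.

Lemma sublinear_along_le q x y t : sublinear q -> 0 <= t ->
  sublinear_along q y x <= q (x + t%:C *: y) - t * q y.
Proof.
by move=> ql t0; apply: ge_inf; [exact: sublinear_along_has_lb|exists t].
Qed.

Lemma sublinear_along_dom q x y : sublinear q -> sublinear_along q y x <= q x.
Proof.
move=> ql; have := sublinear_along_le x y ql (lexx 0).
by rewrite scale0r addr0 mul0r subr0.
Qed.

(** Zorn's lemma for the reversed pointwise order. The infimum of a nonempty chain is finite because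
    [- p (- x) <= q x] for every sublinear [q] below [p], and subadditive because two members of a
    chain are comparable. *)
Lemma minimal_sublinear p : sublinear p -> exists q, [/\ sublinear q,
  forall x, q x <= p x &
  forall q', sublinear q' -> (forall x, q' x <= q x) -> q' = q].
Proof.
move=> pl; pose P q := sublinear q /\ forall x, q x <= p x; pose T := {q | P q}.
have Pp : P p by split=> // x; exact: lexx.
pose r : rel T := fun (a b : T) => `[< forall x, sval b x <= sval a x >].
have [||A tA|q qmin] := @ZL_preorder T (exist P p Pp) r.
- by move=> q; apply/asboolP => x.
- by move=> q1 q2 q3 /asboolP h1 /asboolP h2; apply/asboolP => x; exact: le_trans (h2 x) (h1 x).
- have [[q0 Aq0]|A0] := pselect (A !=set0); last first.
    exists (exist P p Pp) => q Aq.
    by exfalso; apply: A0; exists q.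
  pose S x := [set sval q x | q in A].
  have Slb x : has_lbound (S x).
    exists (- p (- x)) => _ [q Aq <-].
    have [ql qp] := svalP q.
    by apply: le_trans (sublinear_ge x ql); rewrite lerN2.
  have Sl : sublinear (fun x => inf (S x)).
    apply: inf_sublinear => //.
    + by move=> x; exists (sval q0 x); exists q0.
    + move=> x y _ _ [q1 A1 <-] [q2 A2 <-].
      have [/asboolP h|/asboolP h] := tA _ _ A1 A2.
        exists (sval q2 (x + y)); first by exists q2.
        by apply: le_trans ((svalP q2).1.1 x y) _; exact: lerD.
      exists (sval q1 (x + y)); first by exists q1.
      by apply: le_trans ((svalP q1).1.1 x y) _; exact: lerD.
    + move=> t x _ t0 [q Aq <-]; exists (sval q (t%:C *: x)); first by exists q.
      exact: (svalP q).1.2.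
  have Sp x : inf (S x) <= p x.
    apply: le_trans ((svalP q0).2 x); apply: ge_inf => //.
    by exists q0.
  exists (exist P _ (conj Sl Sp)) => q Aq; apply/asboolP => x /=.
  by apply: ge_inf => //; exists q.
- exists (sval q); have [ql qp] := svalP q; split=> // q' q'l q'q.
  have q'p x : q' x <= p x by exact: le_trans (qp x).
  have := qmin (exist P q' (conj q'l q'p)).
  move=> /(_ (introT (asboolP _) q'q)) /asboolP /= qq'.
  by apply/funext => x; apply/eqP; rewrite eq_le qq' q'q.
Qed.

(** A minimal [q] equals its own modification along every [y], whence [q x + q y <= q (x + y)] and
    additivity. Minimizing below the modification of [p] along [z], instead of below [p], forces
    [q (- z) <= - p z] and so the value at [z]. *)
Lemma real_hahn_banach p z : sublinear p -> exists f : E -> R,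
  [/\ forall x y, f (x + y) = f x + f y, forall (t : R) x, f (t%:C *: x) = t * f x,
      forall x, f x <= p x & f z = p z].
Proof.
move=> pl; have [q [ql qp qmin]] := minimal_sublinear (sublinear_alongP z pl).
have qB x y : q (x + y) = q x + q y.
  apply/eqP; rewrite eq_le ql.1/=.
  have e := qmin _ (sublinear_alongP y ql) (fun x => sublinear_along_dom x y ql).
  have := sublinear_along_le x y ql ler01; rewrite e scale1r mul1r; lra.
have qN x : q (- x) = - q x.
  by apply/eqP; rewrite -addr_eq0 -qB addNr sublinear0.
have qp' x : q x <= p x by apply: le_trans (qp x) _; exact: sublinear_along_dom.
exists q; split=> //.
- move=> t x; have [t0|t0] := leP 0 t; first exact: sublinearZ.
  have nt0 : 0 <= - t by rewrite oppr_ge0 ltW.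
  by rewrite -{1}[t]opprK rmorphN scaleNr qN (sublinearZ _ ql nt0) mulNr opprK.
- apply/eqP; rewrite eq_le qp'/=.
  have := qp (- z); have := sublinear_along_le (- z) z pl ler01.
  rewrite scale1r addNr sublinear0// mul1r qN; lra.
Qed.

(** The complex functional with real part [f] is [f x - i f (i x)]. Since [p] is invariant under
    scalars of modulus 1, [x] can be rotated until [g x] is real and nonnegative, which turns the
    bound on [f] into one on the modulus of [g]. *)
Lemma complex_hahn_banach p z : sublinear p ->
    (forall (u : R[i]) x, `|u| = 1 -> p (u *: x) = p x) ->
  exists f : E -> R[i]^o,
    [/\ linear f, forall x, `|f x| <= (p x)%:C & (p z)%:C <= `|f z|].
Proof.
move=> pl pu; have [f [fD fZ fp fz]] := real_hahn_banach z pl.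
have fN x : f (- x) = - f x.
  by rewrite -scaleN1r -(rmorphN1 (real_complex R)) fZ mulN1r.
pose g x : R[i]^o := f x +i* - f ('i *: x).
have gD x y : g (x + y) = g x + g y.
  by rewrite /g scalerDr !fD; apply/eqP; rewrite eq_complex /= opprD !eqxx.
have gR (t : R) x : g (t%:C *: x) = t%:C * g x.
  rewrite /g scalerA [_ * t%:C]mulrC -scalerA !fZ; apply/eqP.
  by rewrite eq_complex /= !mul0r subr0 addr0 mulrN !eqxx.
have gi x : g ('i *: x) = 'i * g x.
  rewrite /g scalerA -expr2 sqr_i scaleN1r fN opprK; apply/eqP.
  by rewrite eq_complex /= !mul0r !mul1r sub0r opprK add0r !eqxx.
have gZ (k : R[i]) x : g (k *: x) = k * g x.
  rewrite {1}(complexE k) scalerDl -scalerA gD gR.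
  by rewrite gi gR mulrA -mulrDl -complexE.
exists g; split.
- by move=> k x y; rewrite gD gZ.
- move=> x; have [->|gx0] := eqVneq (g x) 0.
    rewrite normr0 ler0c; have := sublinear_ge x pl.
    have := pu (-1) x; rewrite normrN1 => /(_ erefl); rewrite scaleN1r => ->.
    lra.
  set k : R[i] := `|g x| / g x.
  have nk : `|k| = 1 by rewrite normrM normr_id normfV divff// normr_eq0.
  have e : g (k *: x) = `|g x| by rewrite gZ divfK.
  have := fp (k *: x); rewrite pu//.
  have -> : f (k *: x) = complex.Re (g (k *: x)) by [].
  rewrite e => h; rewrite -(RRe_real (normr_real (g x))) lecR; exact: h.
- rewrite -fz; apply: le_trans (normc_ge_Re (g z)); rewrite lecR.
  exact: ler_norm.
Qed.

End HahnBanach.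

Section HahnBanachDisk.
Context (R : realType) (E : lmodType R[i]).
Local Open Scope complex_scope.

(** The Minkowski functional of [D]. *)
Definition gauge (D : set E) (x : E) : R :=
  inf [set t : R | 0 < t /\ exists2 d, D d & x = t%:C *: d].

(** An absorbing disk lies between the open and the closed unit ball of its gauge. The separation of
    [z] from [D] is not strict, so each application keeps a margin, namely a factor 2. *)
Lemma hahn_banach_disk (D : set E) (z : E) : disk D ->
  (forall x, exists2 t : R[i], 0 < t & D (t *: x)) ->
  ~ D z ->
  exists f : E -> R[i]^o,
    [/\ linear f, forall x, D x -> `|f x| <= 1 & 1 <= `|f z|].
Proof.
move=> dD Dabs Dz.
pose S (x : E) := [set t : R | 0 < t /\ exists2 d, D d & x = t%:C *: d].
have S0 x : S x !=set0.
  have [t t0 Dt] := Dabs x; have tE := gtr0_real t0.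
  have := RRe_real tE; set s := complex.Re t => st.
  have s0 : 0 < s by rewrite -ltcR st.
  exists s^-1; split; first by rewrite invr_gt0.
  exists (t *: x) => //; rewrite -st scalerA -rmorphM mulVf ?gt_eqF//.
  by rewrite scale1r.
have Slb x : has_lbound (S x) by exists 0 => t [/ltW].
have Sl : sublinear (gauge D).
  apply: inf_sublinear => //.
  - move=> x y t s [t0 [d Dd ->]] [s0 [d' Dd' ->]].
    have t0' : 0 <= t%:C by rewrite ler0c ltW.
    have s0' : 0 <= s%:C by rewrite ler0c ltW.
    have [w Dw we] := disk_add dD t0' s0' Dd Dd'.
    exists (t + s) => //; split; first exact: addr_gt0.
    by exists w => //; rewrite rmorphD -we.
  - move=> t x s t0 [s0 [d Dd ->]].
    exists (t * s) => //; split; first exact: mulr_gt0.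
    by exists d => //; rewrite rmorphM scalerA.
have gle x : D x -> gauge D x <= 1.
  move=> Dx; apply: (ge_inf (Slb x)); split=> //; exists x => //.
  by rewrite scale1r.
have glt x : gauge D x < 1 -> D x.
  move=> /(inf_lt (S0 x)) [t [t0 [d Dd ->]] t1].
  by apply: disk_scale => //; rewrite ger0_norm ?ler0c ?(ltW t0)// -(rmorph1 (real_complex R)) lecR ltW.
have gu (u : R[i]) x : `|u| = 1 -> gauge D (u *: x) = gauge D x.
  move=> u1; congr inf; apply/seteqP; split=> t [t0 [d Dd e]]; split=> //.
    exists (u^-1 *: d); first by apply: disk_scale => //; rewrite normfV u1 invr1.
    have u0 : u != 0 by rewrite -normr_eq0 u1 oner_neq0.
    by rewrite scalerA mulrC -scalerA -e scalerA mulVf// scale1r.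
  exists (u *: d); first by apply: disk_scale => //; rewrite u1.
  by rewrite e !scalerA mulrC.
have [f [fl fp fz]] := complex_hahn_banach z Sl gu.
exists f; split=> //.
- by move=> x /gle h; apply: le_trans (fp x) _; rewrite -(rmorph1 (real_complex R)) lecR.
- apply: le_trans fz; rewrite -(rmorph1 (real_complex R)) lecR leNgt.
  by apply/negP => /glt.
Qed.

End HahnBanachDisk.

(** * Frechet spaces *)

Section Frechet.
Context (K : numFieldType).
Implicit Types E F : tvsType K.

Lemma hausdorff_tvsP E :
  hausdorff_space E <-> forall x : E, (forall U, nbhs 0 U -> U x) -> x = 0.
Proof.
split=> [hE x h|h x y].
  apply: esym; apply: hE => A B A0 /nbhs_translate Bx; exists x; split; first exact: h.
  by have := nbhs_singleton Bx; rewrite /= addr0.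
move=> cxy; apply/eqP; rewrite -subr_eq0; apply/eqP/h => U U0.
have [V V0 VU] := nbhs0_add U0.
have [W [W0 dW WV]] := nbhs0_disk V0.
have xW : nbhs x [set z | W (x - z)].
  apply/nbhs_translate; apply: filterS W0 => v Wv /=.
  by rewrite opprD addNKr; exact: disk_opp.
have yW : nbhs y [set z | W (z - y)].
  by apply/nbhs_translate; apply: filterS W0 => v Wv /=; rewrite addrAC subrr add0r.
have [z [/= xz zy]] := cxy _ _ xW yW.
by rewrite -(subrKA z); apply: VU; exact: WV.
Qed.

Lemma closureP E (S : set E) (x : E) :
  closure S x <-> forall U, nbhs 0 U -> exists2 s, S s & U (s - x).
Proof.
split=> [xS U U0|h B /nbhs_translate /h [s Ss]].
  have /xS [s [Ss Us]] : nbhs x [set z | U (z - x)].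
    by apply/nbhs_translate; apply: filterS U0 => v Uv /=; rewrite addrAC subrr add0r.
  by exists s.
by rewrite /= addrC subrK => Bs; exists s.
Qed.

(** [B n] plays the part of a ball of radius 2^-n; [base_add] is the halving property that replaces
    a metric. *)
Record disk_base E (B : nat -> set E) : Prop := DiskBase {
  base_nbhs : forall n, nbhs 0 (B n);
  base_disk : forall n, disk (B n);
  base_add : forall n x y, B n.+1 x -> B n.+1 y -> B n (x + y);
  base_sub : forall U, nbhs 0 U -> exists n, B n `<=` U }.

Lemma base_le E (B : nat -> set E) m n :
  disk_base B -> (m <= n)%N -> B n `<=` B m.
Proof.
move=> bB; elim: n => [|n IH]; first by rewrite leqn0 => /eqP->.
rewrite leq_eqVlt => /orP[/eqP->//|mn] x Bx; apply: IH => //.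
rewrite -[x]addr0; apply: (base_add bB) => //.
by have [] := base_disk bB n.+1.
Qed.

Lemma disk_base_of E (C : nat -> set E) : (forall n, nbhs 0 (C n)) ->
  (forall U, nbhs 0 U -> exists n, C n `<=` U) ->
  exists2 B : nat -> set E, disk_base B & forall n, B n `<=` C n.
Proof.
move=> C0 CU; have step (U : set E) : exists D : set E, nbhs 0 U ->
    [/\ nbhs 0 D, disk D & forall x y, D x -> D y -> U (x + y)].
  have [U0|nU0] := pselect (nbhs 0 U); last by exists setT => /nU0.
  have [V V0 VU] := nbhs0_add U0; have [D [D0 dD DV]] := nbhs0_disk V0.
  by exists D => _; split=> // x y /DV Vx /DV Vy; exact: VU.
have [f fP] := choice step.
pose B := fix B n := if n is m.+1 then f (B m `&` C m.+1) else f (C 0%N).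
have B0 n : nbhs 0 (B n).
  elim: n => [|n IH] /=; first by have [] := fP _ (C0 0%N).
  by have [] := fP (B n `&` C n.+1) (filterI IH (C0 _)).
have dB n : disk (B n).
  case: n => [|n] /=; first by have [] := fP _ (C0 0%N).
  by have [] := fP (B n `&` C n.+1) (filterI (B0 n) (C0 _)).
have BC n : B n `<=` C n.
  move=> x Bx; rewrite -[x]addr0; case: n Bx => [|n] Bx.
    have [D0 [dD _] h] := fP _ (C0 0%N); exact: h.
  have [D0 [dD _] h] := fP (B n `&` C n.+1) (filterI (B0 n) (C0 _)).
  by have [] := h x 0 Bx dD.
exists B => //; split=> //.
- move=> n x y Bx By.
  have [_ _ h] := fP (B n `&` C n.+1) (filterI (B0 n) (C0 _)).
  by have [] := h x y Bx By.
- by move=> U /CU [n Cn]; exists n; exact: subset_trans Cn.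
Qed.

Lemma frechet_base E : frechet E -> exists B : nat -> set E, disk_base B.
Proof. by move=> [_ [C [C0 CU]] _]; have [B bB _] := disk_base_of C0 CU; exists B. Qed.

(** A geometric tail estimate: each application of [base_add] splits off one term and spends one
    index. The shift [j] covers series whose terms are smaller than their position alone tells. *)
Lemma base_partial_sum E (B : nat -> set E) (x : nat -> E) m n j : disk_base B ->
  (forall k, (n <= k)%N -> B (k + j.+1)%N (x k)) -> (n <= m)%N ->
  B (n + j)%N (\sum_(k < m) x k - \sum_(k < n) x k).
Proof.
move=> bB xB nm; rewrite -(subnKC nm); move: (m - n)%N => {m nm} d.
elim: d n xB => [|d IH] n xB.
  by rewrite addn0 subrr; have [] := base_disk bB (n + j).
have -> : \sum_(k < n + d.+1) x k - \sum_(k < n) x k =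
   x n + (\sum_(k < n.+1 + d) x k - \sum_(k < n.+1) x k).
  have e : \sum_(k < n.+1) x k = \sum_(k < n) x k + x n by rewrite big_ord_recr.
  by rewrite addnS addSn e opprD addrCA [- _ - _]addrC addNKr.
apply: (base_add bB); first by have := xB n (leqnn n); rewrite addnS.
by rewrite -addSn; apply: IH => k /ltnW; exact: xB.
Qed.

(** Terms in [B k.+2] give differences of partial sums in [B n.+1]; the index still left pays for
    the passage to the limit, since the sets [B n] may fail to be closed. *)
Lemma base_series E (B : nat -> set E) (x : nat -> E) :
  tvs_complete E -> disk_base B -> (forall k, B k.+2 (x k)) ->
  exists s, (forall n, B n (s - \sum_(k < n) x k)) /\
    (fun n => \sum_(k < n) x k) @ \oo --> s.
Proof.
move=> cE bB xB; pose S n := \sum_(k < n) x k.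
have SB n m : (n <= m)%N -> B n.+1 (S m - S n).
  move=> nm; rewrite -addn1; apply: (base_partial_sum bB) nm => k _.
  by rewrite addn2.
have cS : tvs_cauchy (S @ \oo).
  move=> U U0; have [V V0 VU] := nbhs0_add U0; have [n nV] := base_sub bB V0.
  exists [set y | B n.+1 (y - S n)]; first by exists n => // m /=; exact: SB.
  move=> y z Dy Dz; rewrite -(subrKA (S n)); apply: VU; apply: nV.
    exact: (base_le bB (leqnSn n)).
  rewrite -opprB; apply: disk_opp; first exact: base_disk.
  exact: (base_le bB (leqnSn n)).
have [s Ss] := cE _ _ cS; exists s; split=> // n.
have /Ss [N _ NB] : nbhs s [set y | B n.+1 (s - y)].
  apply/nbhs_translate; apply: filterS (base_nbhs bB n.+1) => v Wv /=.
  by rewrite opprD addNKr; apply: disk_opp => //; exact: base_disk.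
rewrite -(subrKA (S (maxn n N))); apply: (base_add bB).
  by apply: NB; rewrite /= leq_maxr.
by apply: SB; rewrite leq_maxl.
Qed.

(** A countable base reduces Cauchy filters to series: points [y n] are picked in smaller and
    smaller members of the filter, their differences form an admissible series, and the filter
    converges to [s + y 0%N]. *)
Lemma base_complete E (B : nat -> set E) : disk_base B ->
  (forall x : nat -> E, (forall k, B k.+2 (x k)) ->
     exists s, forall n, B n (s - \sum_(k < n) x k)) ->
  tvs_complete E.
Proof.
move=> bB h F pF cF.
have Dex n : exists D, F D /\ forall x y, D x -> D y -> B n.+2 (x - y).
  by have [D FD DB] := cF _ (base_nbhs bB n.+2); exists D.
have [D Dp] := choice Dex.
have D0 n : F (D n) by have [] := Dp n.
have DD n x y : D n x -> D n y -> B n.+2 (x - y) by have [_] := Dp n; exact.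
pose G n := [set x | forall i, (i <= n)%N -> D i x].
have FG n : F (G n).
  elim: n => [|n IH].
    by apply: filterS (D0 0%N) => x Dx i; rewrite leqn0 => /eqP->.
  apply: filterS (filterI IH (D0 n.+1)) => x [Gx Dx] i.
  by rewrite leq_eqVlt => /orP[/eqP->//|]; exact: Gx.
have [y yG] := choice (fun n => @filter_ex _ _ pF _ (FG n)).
have yB n : B n.+2 (y n.+1 - y n).
  by apply: DD; exact: yG.
have [s sB] := h _ yB.
have sumE n : \sum_(k < n) (y k.+1 - y k) = y n - y 0%N.
  elim: n => [|n IH]; first by rewrite big_ord0 subrr.
  by rewrite big_ord_recr /= IH addrC subrKA.
exists (s + y 0%N) => U /nbhs_translate /(base_sub bB) [m mU].
apply: filterS (D0 m.+1) => z Dz.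
have : B m (z - (s + y 0%N)).
  rewrite -(subrKA (y m.+1)); apply: (base_add bB).
    apply: (@base_le _ _ _ m.+3 bB); first by rewrite ltnS leqW// leqW.
    by apply: DD => //; apply: yG => /=.
  rewrite -opprB; apply: disk_opp; first exact: base_disk.
  by have := sB m.+1; rewrite sumE opprB addrA.
by move=> /mU /=; rewrite addrC subrK.
Qed.

Lemma nbhs0_prod E F (U : set E) (V : set F) :
  nbhs 0 U -> nbhs 0 V -> nbhs (0 : E * F) (U `*` V).
Proof. by move=> U0 V0; exists (U, V). Qed.

Lemma frechet_prod E F : frechet E -> frechet F -> frechet (E * F)%type.
Proof.
move=> [hE [B [B0 BU]] cE] [hF [C [C0 CU]] cF]; split.
- apply/hausdorff_tvsP => -[x y] h; congr (_, _).
    apply: (hausdorff_tvsP E).1 => // U U0.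
    by have [] := h (U `*` setT) (nbhs0_prod U0 filterT).
  apply: (hausdorff_tvsP F).1 => // U U0.
  by have [] := h (setT `*` U) (nbhs0_prod filterT U0).
- have [B' bB _] := disk_base_of B0 BU; have [C' bC _] := disk_base_of C0 CU.
  exists (fun n => B' n `*` C' n); split.
    by move=> n; apply: nbhs0_prod; exact: base_nbhs.
  move=> U [[V W] [/= /(base_sub bB) [m mV] /(base_sub bC) [n nW]] VW].
  exists (maxn m n) => -[x y] [/= Bx Cy]; apply: VW; split => /=.
    by apply/mV/(base_le bB _ Bx); exact: leq_maxl.
  by apply/nW/(base_le bC _ Cy); exact: leq_maxr.
- move=> G pG cG.
  have c1 : tvs_cauchy (fst @ G).
    move=> U U0; have [D GD DU] := cG (U `*` setT) (nbhs0_prod U0 filterT).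
    exists (fst @` D); first by apply: (@filterS _ G _ D) => // z Dz; exists z.
    by move=> _ _ [z Dz <-] [w Dw <-]; have [] := DU _ _ Dz Dw.
  have c2 : tvs_cauchy (snd @ G).
    move=> U U0; have [D GD DU] := cG (setT `*` U) (nbhs0_prod filterT U0).
    exists (snd @` D); first by apply: (@filterS _ G _ D) => // z Dz; exists z.
    by move=> _ _ [z Dz <-] [w Dw <-]; have [] := DU _ _ Dz Dw.
  have [x Gx] := cE _ _ c1; have [y Gy] := cF _ _ c2.
  exists (x, y) => U [[V W] [/= /Gx GV /Gy GW] VW].
  apply: (@filterS _ G _ (fst @^-1` V `&` snd @^-1` W)); last exact: filterI.
  by move=> [a b] [/= Va Wb]; apply: VW.
Qed.

Lemma quot_pi_linear E (S : linear_subspace E) : linear (quot_pi S).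
Proof. by move=> k x y; rewrite quot_piD quot_piZ. Qed.

Lemma quot_pi0P E (S : linear_subspace E) x : quot_pi S x = 0 <-> subspace_set S x.
Proof.
have -> : 0 = quot_pi S 0 by rewrite (linear0E (@quot_pi_linear E S)).
by rewrite quot_piP subr0.
Qed.

Lemma quot_piB E (S : linear_subspace E) x y : quot_pi S (x - y) = quot_pi S x - quot_pi S y.
Proof. by rewrite quot_piD -scaleN1r quot_piZ scaleN1r. Qed.

Lemma quot_nbhs0P E (S : linear_subspace E) (U : set (tvs_quot S)) :
  nbhs 0 U <-> exists2 V, nbhs 0 V & quot_pi S @` V `<=` U.
Proof.
have e : 0 = quot_pi S 0 by rewrite (linear0E (@quot_pi_linear E S)).
split=> [|[V V0 VU]]; rewrite e.
  move=> /(@quot_pi_continuous K E S) U0; exists (quot_pi S @^-1` U) => //.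
  by move=> _ [x Ux <-].
by apply: filterS VU _; exact: quot_pi_nbhs.
Qed.

Lemma quot_hausdorff E (S : linear_subspace E) : closed (subspace_set S) ->
  hausdorff_space (tvs_quot S).
Proof.
move=> cS; apply/hausdorff_tvsP => q; have [x <-] := quot_pi_repr q => h.
apply/quot_pi0P/cS/closureP => U U0.
have [D [D0 dD DU]] := nbhs0_disk U0.
have [|d Dd /quot_piP Sd] := h (quot_pi S @` D).
  by apply/quot_nbhs0P; exists D.
exists (x - d); last by apply: DU; rewrite addrAC subrr add0r; exact: disk_opp.
have [S0 SD] := subspaceP S.
by have := SD (-1) (d - x) 0 Sd S0; rewrite addr0 scaleN1r opprB.
Qed.

Lemma quot_base E (S : linear_subspace E) (B : nat -> set E) : disk_base B ->
  disk_base (fun n => quot_pi S @` B n).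
Proof.
move=> bB; split.
- by move=> n; apply/quot_nbhs0P; exists (B n) => //; exact: base_nbhs.
- move=> n; have [D0 DD] := base_disk bB n; split.
    by exists 0 => //; rewrite (linear0E (@quot_pi_linear E S)).
  move=> a b _ _ ab [x Bx <-] [y By <-]; exists (a *: x + b *: y); first exact: DD.
  by rewrite quot_piD !quot_piZ.
- move=> n _ _ [x Bx <-] [y By <-]; exists (x + y); last by rewrite quot_piD.
  exact: (base_add bB).
- move=> U /quot_nbhs0P [V /(base_sub bB) [n nV] VU]; exists n.
  by apply: subset_trans VU; exact: image_subset.
Qed.

(** For completeness, a series with terms in the images of the [B k.+2] is lifted term by term,
    summed in [E] and projected back. *)
Lemma frechet_quot E (S : linear_subspace E) : frechet E -> closed (subspace_set S) ->
  frechet (tvs_quot S).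
Proof.
move=> fE cS; have [B bB] := frechet_base fE; have bQ := quot_base S bB.
split; first exact: quot_hausdorff.
  exists (fun n => quot_pi S @` B n); split; first exact: base_nbhs.
  by move=> U; exact: base_sub.
apply: (base_complete bQ) => x xB.
have xB' k : exists d, B k.+2 d /\ quot_pi S d = x k by have [d ? ?] := xB k; exists d.
have [d dp] := choice xB'.
have dB k : B k.+2 (d k) by have [] := dp k.
have [_ _ cE] := fE; have [s [sB _]] := base_series cE bB dB.
exists (quot_pi S s) => n; exists (s - \sum_(k < n) d k) => //.
rewrite quot_piB; congr (_ - _).
elim: n => [|n IH]; first by rewrite !big_ord0 (linear0E (@quot_pi_linear E S)).
by rewrite !big_ord_recr quot_piD IH /=; have [_ ->] := dp n.
Qed.

End Frechet.

(** * The open mapping theorem *)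

Section ComplexNumbers.
Context (R : realType).

Lemma complex_arch (k : R[i]) : exists n : nat, `|k| <= n.+1%:R.
Proof.
have := RRe_real (normr_real k); set r := complex.Re _ => rk.
exists (Num.bound `|r|); rewrite -rk -(rmorph_nat (real_complex R)) lecR.
apply: le_trans (ler_norm r) _; apply/ltW/(lt_trans (archi_boundP (normr_ge0 r))).
by rewrite ltr_nat.
Qed.

Lemma normc_le_ReIm (z : R[i]) : `|z| <= (`|complex.Re z| + `|complex.Im z|)%:C.
Proof.
rewrite {1}(complexE z); apply: le_trans (ler_normD _ _) _.
rewrite normrM rmorphD; apply: lerD.
  by rewrite normc_def /= expr0n addr0 sqrtr_sqr.
rewrite !normc_def /= !expr0n expr1n !add0r !addr0 sqrtr1 sqrtr_sqr.
by rewrite mul1r.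
Qed.

Lemma complex_complete : tvs_complete (R[i]^o).
Proof.
move=> F pF cF.
have ballD (e : R) : 0 < e -> exists2 D, F D &
    forall x y : R[i], D x -> D y -> `|x - y| < e%:C.
  move=> e0; have [|D FD DU] := cF [set z | `|z| < e%:C]; last by exists D.
  by exists e%:C; [rewrite /= ltcR|move=> z /=; rewrite sub0r normrN].
have cvgp (p : R[i] -> R) : (forall x y, p (x - y) = p x - p y) ->
    (forall z, `|p z|%:C <= `|z|) -> exists l : R, (p @ F) --> l.
  move=> pB pn; suff : cauchy (p @ F) by move=> /cauchy_cvg h; exists (lim (p @ F)).
  apply: cauchy_exP => e e0; have [D FD De] := ballD e e0.
  have [x Dx] := filter_ex FD.
  exists (p x); apply: (@filterS _ F _ D) => // y Dy.
  rewrite /ball /= -pB -ltcR; apply: le_lt_trans (pn _) _; exact: De.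
have [a Fa] := cvgp (@complex.Re R) (fun x y => ltac:(by case: x y => ? ? [])) (@normc_ge_Re R).
have [b Fb] : exists l : R, (@complex.Im R @ F) --> l.
  apply: cvgp; first by case=> ? ? [].
  move=> z; have := normc_ge_Re ('i * z).
  have -> : complex.Re ('i * z) = - complex.Im z.
    by case: z => x y /=; rewrite mul0r mul1r sub0r.
  rewrite normrN normrM; have -> : `|'i : R[i]| = 1; last by rewrite mul1r.
  by rewrite normc_def /= expr0n expr1n add0r sqrtr1.
exists (a +i* b) => U [e /= e0 eU].
have e0' : 0 < complex.Re e / 2.
  by move: e0; rewrite ltcE /= => /andP[_ h]; rewrite divr_gt0.
have eE : e = (complex.Re e)%:C by rewrite RRe_real// gtr0_real.
have h1 : F (@complex.Re R @^-1` [set x | `|a - x| < complex.Re e / 2]).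
  by apply: Fa; exists (complex.Re e / 2).
have h2 : F (@complex.Im R @^-1` [set x | `|b - x| < complex.Re e / 2]).
  by apply: Fb; exists (complex.Re e / 2).
apply: (@filterS _ F _ _ _ _ (filterI h1 h2)) => -[x y] [/= ax bx].
apply: eU => /=; apply: le_lt_trans (normc_le_ReIm _) _ => /=.
by rewrite eE ltcR; lra.
Qed.

Lemma frechet_complex : frechet (R[i]^o).
Proof.
split; last exact: complex_complete.
- exact: (@norm_hausdorff _ R[i]^o).
- exists (fun n => [set z : R[i] | `|z| < n.+1%:R^-1]); split.
    move=> n; exists (n.+1%:R^-1); first by rewrite /= invr_gt0.
    by move=> z /=; rewrite sub0r normrN.
  move=> U [e /= e0 eU]; have [n en] := complex_arch e^-1.
  exists n => z /= zn; apply: eU; rewrite /= sub0r normrN.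
  apply: lt_le_trans zn _; rewrite -[leRHS]invrK lef_pV2 ?posrE ?invr_gt0//.
  by apply: le_trans en; rewrite ger0_norm// invr_ge0 ltW.
Qed.

End ComplexNumbers.

Section OpenMapping.
Context (R : realType) (E F : tvsType R[i]) (f : E -> F).
Hypotheses (fE : frechet E) (fF : frechet F) (fl : linear f) (fc : continuous f).
Hypothesis fcl : closed (range f).

Let fB x y : f (x - y) = f x - f y.
Proof. by rewrite addrC -scaleN1r fl scaleN1r addrC. Qed.

Let fZ k x : f (k *: x) = k *: f x.
Proof. by have := fl k x 0; rewrite addr0 (linear0E fl) addr0. Qed.

Let rangeD k x y : range f x -> range f y -> range f (x + k *: y).
Proof. by move=> [u _ <-] [v _ <-]; exists (k *: v + u) => //; rewrite fl addrC. Qed.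

(** Baire's argument run inside the closed range. If no [V] works, shrinking balls produce a point
    [l] of the range outside [n.+1 Q] for all [n], where [Q] is the closure of the image of [D]; but
    [l = f e], and [D] absorbs [e]. *)
Lemma almost_open (U : set E) : nbhs 0 U -> exists2 V : set F, nbhs 0 V &
  forall y, range f y -> V y -> closure (f @` U) y.
Proof.
move=> U0; apply: contrapT => nV.
have {}nV (V : set F) : nbhs 0 V -> exists y, [/\ range f y, V y & ~ closure (f @` U) y].
  move=> V0; apply: contrapT => h; apply: nV; exists V => // y ry Vy.
  by apply: contrapT => cy; apply: h; exists y.
have [B bB] := frechet_base fF.
have [W W0 WU] := nbhs0_add U0; have [D [D0 dD DW]] := nbhs0_disk W0.
pose Q := closure (f @` D).
have QB x y : Q x -> Q y -> closure (f @` U) (x - y).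
  move=> /closureP Qx /closureP Qy; apply/closureP => V V0.
  have [V1 V10 V1V] := nbhs0_add V0; have [V2 [V20 dV2 V21]] := nbhs0_disk V10.
  have [_ [u Du <-] Vu] := Qx V2 V20; have [_ [v Dv <-] Vv] := Qy V2 V20.
  exists (f (u - v)).
    by exists (u - v) => //; apply: WU; apply: DW => //; exact: disk_opp.
  have -> : f (u - v) - (x - y) = (f u - x) + - (f v - y).
    by rewrite fB !opprB addrACA [RHS]addrACA [- x - _]addrC.
  by apply: V1V; apply: V21 => //; exact: disk_opp.
(* A state is a centre and the index of a ball around it. The next centre is moved slightly so that
   a whole ball around it avoids [n.+1 Q]; off the range a default is returned. *)
have step (a : nat * (F * nat)) : exists b : F * nat, range f a.2.1 ->
    [/\ range f b.1, B a.2.2.+2 (b.1 - a.2.1), (a.2.2 < b.2)%N &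
      forall z, B b.2 (z - b.1) -> ~ Q (a.1.+1%:R^-1 *: z)].
  case: a => n [x j] /=; have [rx|nrx] := pselect (range f x); last by exists (x, j).
  have [x' [rx' Bx' Qx']] : exists x', [/\ range f x', B j.+2 (x' - x) &
      ~ Q (n.+1%:R^-1 *: x')].
    apply: contrapT => h.
    have {}h x' : range f x' -> B j.+2 (x' - x) -> Q (n.+1%:R^-1 *: x').
      by move=> r1 r2; apply: contrapT => r3; apply: h; exists x'.
    (* If all points of the range near [x] belonged to [n.+1 Q], this small [y] would be a
       difference of two points of [Q], hence in the closure of the image of [U]. *)
    have [y [ry By]] := nV _ (nbhs0_scale n.+1%:R (base_nbhs bB j.+2)).
    apply; have -> : y = n.+1%:R^-1 *: (x + n.+1%:R *: y) - n.+1%:R^-1 *: x.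
      by rewrite scalerDr scalerA mulVf ?pnatr_eq0// scale1r addrAC subrr add0r.
    apply: QB; apply: h => //.
    + exact: rangeD.
    + by rewrite addrAC subrr add0r.
    + by rewrite subrr; have [] := base_disk bB j.+2.
  have [V V0 VQ] : exists2 V : set F, nbhs 0 V & forall z, V z -> ~ Q (n.+1%:R^-1 *: x' + z).
    apply: contrapT => h; apply: Qx'; apply/closureP => V V0.
    have [V1 V10 V1V] := nbhs0_add V0.
    have : exists2 z, V1 z & Q (n.+1%:R^-1 *: x' + z).
      apply: contrapT => h'; apply: h; exists V1 => // z Vz Qz.
      by apply: h'; exists z.
    move=> [z Vz /closureP /(_ _ V10) [s Ds Vs]]; exists s => //.
    by have := V1V _ _ Vs Vz; rewrite opprD addrA subrK.
  have [m mV] := base_sub bB (nbhs0_scale n.+1%:R^-1 V0).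
  exists (x', maxn m j.+1) => _; split=> //=; first by rewrite leq_maxr.
  move=> z Bz; have := base_le bB (leq_maxl m j.+1) Bz => /mV /= /VQ.
  by rewrite -scalerDr addrC subrK.
have [g gP] := choice step.
pose s := fix s n : F * nat := if n is m.+1 then g (m, s m) else (0, 0%N).
have rs n : range f (s n).1.
  elim: n => [|n IH] /=; first by exists 0 => //; exact: linear0E.
  by have [] := gP (n, s n) IH.
have sB n : B (s n).2.+2 ((s n.+1).1 - (s n).1) by have [] := gP (n, s n) (rs n).
have sl n : ((s n).2 < (s n.+1).2)%N by have [] := gP (n, s n) (rs n).
have sQ n z : B (s n.+1).2 (z - (s n.+1).1) -> ~ Q (n.+1%:R^-1 *: z).
  by have [_ _ _] := gP (n, s n) (rs n); exact.
have sle n d : ((s n).2 + d <= (s (n + d)%N).2)%N.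
  elim: d => [|d IH]; first by rewrite !addn0.
  by rewrite !addnS; exact: leq_ltn_trans IH (sl _).
have sle0 n : (n <= (s n).2)%N by have := sle 0%N n; rewrite /= !add0n.
pose x n := (s n.+1).1 - (s n).1.
have sumx n : \sum_(k < n) x k = (s n).1.
  elim: n => [|n IH]; first by rewrite big_ord0.
  by rewrite big_ord_recr /= IH addrC subrK.
have [_ _ cF] := fF.
have xB k : B k.+2 (x k) by apply: (base_le bB _ (sB k)); rewrite !ltnS.
have [l [_ ls]] := base_series cF bB xB.
have lim m U1 : nbhs 0 U1 -> exists n, (m <= n)%N /\ U1 (l - (s n).1).
  move=> U10; have [U2 [U20 dU2 U21]] := nbhs0_disk U10.
  have /ls [N _ NB] : nbhs l [set y | U2 (l - y)].
    apply/nbhs_translate; apply: filterS U20 => v Wv /=.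
    by rewrite opprD addNKr; apply: disk_opp.
  exists (maxn m N); split; first exact: leq_maxl.
  by apply: U21; have := NB (maxn m N) (leq_maxr _ _); rewrite /= sumx.
(* Indices grow by at least one per stage, so everything after stage [n] stays in the ball of that
   stage; [base_partial_sum] is used with shift [(s n).2 - n + 1]. *)
have lB n : B (s n).2 (l - (s n).1).
  have [m [nm ml]] := lim n _ (base_nbhs bB (s n).2.+1).
  rewrite -(subrKA (s m).1); apply: (base_add bB) => //.
  rewrite -!sumx; have -> : (s n).2.+1 = (n + ((s n).2 - n).+1)%N by rewrite addnS subnKC.
  apply: (base_partial_sum bB) nm => k nk.
  apply: (base_le bB _ (sB k)); have := sle n (k - n)%N.
  by rewrite subnKC//; have := sle0 n; lia.
have [e _ fe] : range f l.
  apply: fcl; apply/closureP => V V0; have [V1 [V10 dV1 V1V]] := nbhs0_disk V0.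
  have [n [_ ln]] := lim 0%N _ V10; exists (s n).1 => //.
  by apply: V1V; rewrite -opprB; exact: disk_opp.
have [t t0 De] := nbhs0_absorb e D0; have [n tn] := complex_arch t^-1.
apply: (sQ n l) => //; rewrite -fe -fZ; apply: subset_closure; exists (n.+1%:R^-1 *: e) => //.
apply: De; rewrite ger0_norm ?invr_ge0 ?ler0n// -[leRHS]invrK lef_pV2 ?posrE ?invr_gt0//.
by move: tn; rewrite ger0_norm// invr_ge0 ltW.
Qed.

(** Successive approximation: each remainder is corrected, up to a smaller one, by the image of an
    element of a smaller base set, and completeness of [E] sums the corrections. *)
Theorem open_mapping (U : set E) : nbhs 0 U -> exists2 V : set F, nbhs 0 V &
  forall y, range f y -> V y -> (f @` U) y.
Proof.
have [B bB] := frechet_base fE; have [G bG] := frechet_base fF.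
move=> /(base_sub bB) [m mU].
have ao n : exists V : set F, nbhs 0 V /\ forall y, range f y -> V y -> closure (f @` B n) y.
  by have [V V0 VB] := almost_open (base_nbhs bB n); exists V.
have [V VP] := choice ao.
(* The first factor lets the next correction be taken in [B (k + m).+2], as [base_series] asks for
   the base shifted by [m]; the factor [G k] drives the remainders to 0. *)
pose W k := V (k + m).+2 `&` G k.
have W0 k : nbhs 0 (W k) by apply: filterI; [have [] := VP (k + m).+2|exact: base_nbhs].
exists (W 0%N) => // y ry Wy.
have step (a : nat * F) : exists e, range f a.2 -> W a.1 a.2 ->
    B (a.1 + m).+2 e /\ W a.1.+1 (a.2 - f e).
  case: a => k z /=.
  have [[rz Wz]|h] := pselect (range f z /\ W k z); last by exists 0 => r1 r2; case: h.
  have [D [D0 dD DW]] := nbhs0_disk (W0 k.+1).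
  have [V0 VB] := VP (k + m).+2; have /closureP := VB _ rz Wz.1.
  move=> /(_ _ D0) [_ [e Be <-] De]; exists e => _ _; split=> //.
  by apply: DW; rewrite -opprB; exact: disk_opp.
have [g gP] := choice step.
pose s := fix s n : F := if n is k.+1 then s k - f (g (k, s k)) else y.
have sP n : range f (s n) /\ W n (s n).
  elim: n => [|n [r1 r2]] /=; first by split.
  have [r3 r4] := gP (n, s n) r1 r2.
  by split=> //; rewrite -scaleN1r; apply: rangeD.
pose x k := g (k, s k).
have bB' : disk_base (fun n => B (n + m)%N).
  split; [by move=> n; exact: base_nbhs|by move=> n; exact: base_disk|..].
    by move=> n u v; exact: (base_add bB).
  move=> U0 /(base_sub bB) [n nU]; exists n; apply: subset_trans nU.
  exact: (base_le bB (leq_addr _ _)).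
have xB k : B (k.+2 + m)%N (x k) by have [r1 r2] := sP k; have [] := gP (k, s k) r1 r2.
have [_ _ cE] := fE; have [e [eB _]] := base_series cE bB' xB.
exists e.
  by apply: mU; have := eB 0%N; rewrite big_ord0 subr0.
have sumE n : f (\sum_(k < n) x k) = y - s n.
  elim: n => [|n IH]; first by rewrite big_ord0 (linear0E fl) subrr.
  have := fl 1 (\sum_(k < n) x k) (x n); rewrite !scale1r IH big_ord_recr /= => ->.
  by rewrite opprB addrA addrAC.
have [/hausdorff_tvsP hF _ _] := fF.
apply/eqP; rewrite -subr_eq0; apply/eqP/hF => U1 U10.
have [U2 U20 U21] := nbhs0_add U10; have [U3 [U30 dU3 U32]] := nbhs0_disk U20.
have [p pf] := base_sub bB' ((linear_continuousP fl).2 fc _ U30).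
have [q qf] := base_sub bG U30.
pose n := maxn p q.
have -> : f e - y = f (e - \sum_(k < n) x k) + - s n.
  by rewrite fB sumE opprB addrA addrAC addrK.
apply: U21; apply: U32.
  by apply: pf; apply: (base_le bB' (leq_maxl p q)); exact: eB.
apply: disk_opp => //; apply: qf; apply: (base_le bG (leq_maxr p q)).
by have [_ []] := sP n.
Qed.

End OpenMapping.

(** * Spaces of functions with uniform convergence *)

Definition unif_bounded (K : numFieldType) (Omega I : Type) (S : I -> set Omega)
    (f : Omega -> K^o) :=
  forall i, exists2 r, 0 < r & forall w, S i w -> `|f w| <= r.

(** Closedness for uniform convergence on the sets [S i], expressed by estimates before the topology
    is introduced. *)
Definition unif_closed (K : numFieldType) (Omega I : Type) (S : I -> set Omega)
    (N : set (Omega -> K^o)) :=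
  forall f, unif_bounded S f ->
    (forall i r, 0 < r -> exists2 g, N g & forall w, S i w -> `|f w - g w| <= r) ->
    N f.

(* Functions bounded on each [uc_set i], with the topology of uniform convergence
   on these sets; dual spaces and tensor products are instances. *)
Record unif_data (K : numFieldType) := UnifData {
  uc_dom : Type;
  uc_idx : Type;
  uc_set : uc_idx -> set uc_dom;
  uc_idx0 : uc_idx;
  uc_dir : forall i j, exists k, uc_set i `<=` uc_set k /\ uc_set j `<=` uc_set k;
  uc_space : linear_subspace (uc_dom -> K^o);
  uc_bounded : forall phi, subspace_set uc_space phi -> unif_bounded uc_set phi }.

Definition uc_pred (K : numFieldType) (d : unif_data K) : {pred uc_dom d -> K^o} :=
  fun phi => `[< subspace_set (uc_space d) phi >].

Arguments uc_pred {K} d _.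

Record unif_space (K : numFieldType) (d : unif_data K) := UnifSpace {
  uc_val : uc_dom d -> K^o;
  uc_valP : uc_val \in uc_pred d }.

Section UnifSpace.
Context (K : numFieldType) (d : unif_data K).

Fact uc_pred_submod : submod_closed (uc_pred d).
Proof.
have [S0 SD] := subspaceP (uc_space d); split; first exact/asboolP.
by move=> k x y /asboolP Sx /asboolP Sy; apply/asboolP; exact: SD.
Qed.

HB.instance Definition _ :=
  GRing.isSubmodClosed.Build K (uc_dom d -> K^o) (uc_pred d) uc_pred_submod.

HB.instance Definition _ := [isSub for @uc_val K d].
HB.instance Definition _ := [Choice of unif_space d by <:].
HB.instance Definition _ := [SubChoice_isSubLmodule of unif_space d by <:].

Implicit Types phi psi : unif_space d.

Lemma uc_valD phi psi w : uc_val (phi + psi) w = uc_val phi w + uc_val psi w.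
Proof. by []. Qed.

Lemma uc_val0 w : uc_val (0 : unif_space d) w = 0.
Proof. by []. Qed.

Lemma uc_valB phi psi w : uc_val (phi - psi) w = uc_val phi w - uc_val psi w.
Proof. by []. Qed.

Lemma uc_valZ k phi w : uc_val (k *: phi) w = k * uc_val phi w.
Proof. by []. Qed.

Lemma uc_ext phi psi : uc_val phi = uc_val psi -> phi = psi.
Proof. exact: val_inj. Qed.

Lemma uc_val_space phi : subspace_set (uc_space d) (uc_val phi).
Proof. by apply/asboolP; have := uc_valP phi. Qed.

Definition uc_mk f (Mf : subspace_set (uc_space d) f) : unif_space d :=
  UnifSpace (introT (asboolP _) Mf).

Definition uc_ball i (r : K) : set (unif_space d) :=
  [set phi | forall w, uc_set i w -> `|uc_val phi w| <= r].

Definition uc_open (U : set (unif_space d)) := forall phi, U phi ->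
  exists i, exists2 r, 0 < r & forall psi, uc_ball i r (psi - phi) -> U psi.

Fact uc_openT : uc_open setT.
Proof. by move=> phi _; exists (uc_idx0 d), 1. Qed.

Lemma uc_ball_le i j r s : uc_set j `<=` uc_set i -> r <= s -> uc_ball i r `<=` uc_ball j s.
Proof. by move=> ij rs phi h w /ij /h /le_trans; apply. Qed.

Lemma min_pos (r s : K) : 0 < r -> 0 < s -> exists t, [/\ 0 < t, t <= r & t <= s].
Proof.
move=> r0 s0; have [rs|sr] := real_leP (gtr0_real r0) (gtr0_real s0).
  by exists r.
by exists s; split=> //; exact: ltW.
Qed.

Fact uc_openI U V : uc_open U -> uc_open V -> uc_open (U `&` V).
Proof.
move=> oU oV phi [/oU [i [r r0 iU]] /oV [j [s s0 jV]]].
have [k [ik jk]] := uc_dir i j; have [t [t0 tr ts]] := min_pos r0 s0.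
exists k, t => // psi h; split; first by apply: iU; exact: uc_ball_le h.
by apply: jV; exact: uc_ball_le h.
Qed.

Fact uc_open_bigU (J : Type) (f : J -> set (unif_space d)) :
  (forall j, uc_open (f j)) -> uc_open (\bigcup_j f j).
Proof.
move=> fo phi [j _ /fo [i [r r0 h]]]; exists i, r => // psi /h fj.
by exists j.
Qed.

HB.instance Definition _ :=
  isOpenTopological.Build (unif_space d) uc_openT uc_openI uc_open_bigU.

Lemma uc_nbhsP phi (U : set (unif_space d)) : nbhs phi U <->
  exists i, exists2 r, 0 < r & forall psi, uc_ball i r (psi - phi) -> U psi.
Proof.
rewrite nbhsE; split.
  move=> [V [oV Vphi] VU]; have [i [r r0 h]] := oV _ Vphi.
  by exists i, r => // psi /h /VU.
move=> [i [r r0 h]].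
(* A ball defined by a weak inequality need not be open; its points that leave some room [s] form an
   open set. *)
exists [set psi | exists2 s, 0 < s & uc_ball i (r - s) (psi - phi)]; last first.
  move=> psi [s s0 H]; apply: h; apply: uc_ball_le H => //.
  by rewrite gerBl ltW.
split; last first.
  by exists r => // w _; rewrite subrr uc_val0 normr0 subrr.
move=> psi [s s0 H]; exists i, (s / 2); first exact: divr_gt0.
move=> psi' H'; exists (s / 2); first exact: divr_gt0.
move=> w iw; rewrite -(subrKA psi) uc_valD; apply: le_trans (ler_normD _ _) _.
have -> : r - s / 2 = s / 2 + (r - s) by field.
by apply: lerD; [exact: H'|exact: H].
Qed.

Lemma uc_ballD i r s phi psi :
  uc_ball i r phi -> uc_ball i s psi -> uc_ball i (r + s) (phi + psi).
Proof.
move=> h1 h2 w iw; rewrite uc_valD; apply: le_trans (ler_normD _ _) _.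
by apply: lerD; [exact: h1|exact: h2].
Qed.

Fact uc_add_continuous :
  continuous (fun z : unif_space d * unif_space d => z.1 + z.2).
Proof.
move=> [p q] U /uc_nbhsP [i [r r0 h]] /=.
exists ([set p' | uc_ball i (r / 2) (p' - p)], [set q' | uc_ball i (r / 2) (q' - q)]).
  by split; apply/uc_nbhsP; exists i, (r / 2) => //; exact: divr_gt0.
move=> [p' q'] [/= pp qq]; apply: h => /=.
by rewrite opprD addrACA [r]splitr; exact: uc_ballD.
Qed.

(** Boundedness of the functions on each [uc_set i] enters here: it makes [(l - k) *: p] uniformly
    small. *)
Fact uc_scale_continuous :
  continuous (fun z : K^o * unif_space d => z.1 *: z.2).
Proof.
move=> [k p] U /uc_nbhsP [i [r r0 h]] /=.
have [b b0 pb] := uc_bounded (uc_val_space p) i.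
have [e [e0 e1 eb]] := min_pos ltr01 (divr_gt0 (divr_gt0 r0 (ltr0n _ 2)) b0).
pose s := r / 2 / (1 + `|k|).
have k0 : 0 < 1 + `|k| by rewrite ltr_wpDr.
have s0 : 0 < s by rewrite divr_gt0// divr_gt0.
exists ([set l : K | `|k - l| < e], [set q | uc_ball i s (q - p)]).
  split; last by apply/uc_nbhsP; exists i, s.
  by exists e.
move=> [l q] [/= kl pq]; apply: h => /= w iw.
have -> : l *: q - k *: p = l *: (q - p) + (l - k) *: p.
  by rewrite scalerBr scalerBl addrA subrK.
rewrite uc_valD !uc_valZ [r]splitr; apply: le_trans (ler_normD _ _) _.
rewrite !normrM; apply: lerD.
  have lk : `|l| <= 1 + `|k|.
    rewrite -[l](subrK k); apply: le_trans (ler_normD _ _) _.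
    by rewrite lerD2r distrC ltW// (lt_le_trans kl).
  apply: (@le_trans _ _ ((1 + `|k|) * s)); first by apply: ler_pM => //; exact: pq.
  by rewrite /s mulrC divfK// gt_eqF.
apply: (@le_trans _ _ (e * b)).
  by apply: ler_pM => //; [rewrite distrC ltW|exact: pb].
by rewrite -ler_pdivlMr.
Qed.

Fact uc_locally_convex : exists2 B : set_system (unif_space d),
  (forall b, b \in B -> convex_set b) & basis B.
Proof.
exists [set O | open O /\ convex_set O]; first by move=> b; rewrite inE => -[].
split; first by move=> b [].
move=> p U /uc_nbhsP [i [r r0 h]].
pose O := [set q | exists2 s, s < r & uc_ball i s (q - p)].
exists O; last by move=> q [s sr H]; apply: h; apply: uc_ball_le H => //; exact: ltW.
split; last by exists 0 => // w _; rewrite subrr uc_val0 normr0.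
split.
  move=> q [s sr H]; exists i, ((r - s) / 2); first by rewrite divr_gt0// subr_gt0.
  move=> q' H'; exists ((r - s) / 2 + s).
    by rewrite -ltrBrDr ltr_pdivrMr// ltr_pMr ?ltr1n// subr_gt0.
  by rewrite -(subrKA q); exact: uc_ballD.
apply/convex_setW => q q'; rewrite !inE => -[s sr H] [s' sr' H'] l l0 l1.
rewrite inE; set t := l%:num in l0 l1; exists (t * s + (1 - t) * s').
  rewrite -[ltRHS]mul1r -[in ltRHS](subrK t 1) addrC [ltRHS]mulrDl.
  by rewrite ltrD// ltr_pM2l// subr_gt0.
change (uc_ball i (t * s + (1 - t) * s') (t *: q + (1 - t) *: q' - p)).
have -> : t *: q + (1 - t) *: q' - p = t *: (q - p) + (1 - t) *: (q' - p).
  by rewrite !scalerBr addrACA -opprD -scalerDl addrCA subrr addr0 scale1r.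
have t1 : 0 <= 1 - t by rewrite subr_ge0 ltW.
apply: uc_ballD => w iw; rewrite uc_valZ normrM ger0_norm ?(ltW l0)//.
  by apply: ler_wpM2l; [exact: ltW|exact: H].
by apply: ler_wpM2l => //; exact: H'.
Qed.

HB.instance Definition _ := PreTopologicalLmod_isTvs.Build K (unif_space d)
  uc_add_continuous uc_scale_continuous uc_locally_convex.
HB.instance Definition _ :=
  PreTopologicalNmodule_isTopologicalNmodule.Build (unif_space d) uc_add_continuous.
HB.instance Definition _ :=
  TopologicalNmodule_isTopologicalLmodule.Build K (unif_space d)
    uc_scale_continuous.
HB.instance Definition _ :=
  Uniform_isTvs.Build K (unif_space d) uc_locally_convex.

Lemma uc_nbhs0P (U : set (unif_space d)) : nbhs 0 U <->
  exists i, exists2 r, 0 < r & uc_ball i r `<=` U.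
Proof.
rewrite uc_nbhsP; split=> -[i [r r0 h]]; exists i, r => // psi.
  by move=> H; apply: h; rewrite subr0.
by rewrite subr0 => /h.
Qed.

Lemma uc_hausdorff : (forall w, exists i, uc_set (u := d) i w) ->
  hausdorff_space (unif_space d).
Proof.
move=> cov; apply/hausdorff_tvsP => phi h; apply: uc_ext; apply/funext => w.
have [i iw] := cov w; apply/eqP/negPn/negP => phiw.
have phiw0 : 0 < `|uc_val phi w| by rewrite normr_gt0.
have /h /(_ w iw) : nbhs 0 (uc_ball i (`|uc_val phi w| / 2)).
  by apply/uc_nbhs0P; exists i, (`|uc_val phi w| / 2) => //; exact: divr_gt0.
by rewrite ler_pdivlMr// ger_pMr// (ler_nat _ 2 1).
Qed.

(** The covering gives pointwise limits, the Cauchy condition makes the convergence uniform on each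
    set, and closedness of the space keeps the limit inside. *)
Lemma uc_complete : tvs_complete K^o ->
  (forall w, exists i, uc_set (u := d) i w) -> unif_closed (uc_set (u := d)) (uc_space d) ->
  tvs_complete (unif_space d).
Proof.
move=> cK cov cM F pF cF.
have ballF i r : 0 < r -> exists2 D, F D & forall x y, D x -> D y -> uc_ball i r (x - y).
  by move=> r0; apply: cF; apply/uc_nbhs0P; exists i, r.
have lim w : exists l : K^o, ((fun x : unif_space d => uc_val x w) @ F) --> l.
  apply: cK => U [e /= e0 eU]; have [i iw] := cov w.
  have [D FD DF] := ballF i (e / 2) (divr_gt0 e0 (ltr0n _ 2)).
  exists ((fun x : unif_space d => uc_val x w) @` D); first by apply: (@filterS _ F _ D) => // x Dx; exists x.
  move=> _ _ [x Dx <-] [y Dy <-]; apply: eU; rewrite /= sub0r normrN -uc_valB.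
  by rewrite (le_lt_trans (DF _ _ Dx Dy w iw))// ltr_pdivrMr// ltr_pMr// ltr1n.
have [f fP] := choice lim.
(* the Cauchy estimate passes to the pointwise limit *)
have fF i r : 0 < r -> exists2 D, F D & forall x, D x ->
    forall w, uc_set i w -> `|f w - uc_val x w| <= r.
  move=> r0; have [D FD DF] := ballF i (r / 2) (divr_gt0 r0 (ltr0n _ 2)).
  exists D => // x Dx w iw.
  have Fw : F ((fun x : unif_space d => uc_val x w) @^-1` [set z : K | `|f w - z| < r / 2]).
    by apply: (fP w); exists (r / 2) => //=; exact: divr_gt0.
  have [y [Dy /= fy]] := filter_ex (filterI FD Fw).
  rewrite -(subrKA (uc_val y w)) [r]splitr; apply: le_trans (ler_normD _ _) _.
  by apply: lerD; [exact: ltW|rewrite -uc_valB; exact: DF].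
have Mf : subspace_set (uc_space d) f.
  apply: cM => [i|i r r0].
    have [D FD Df] := fF i 1 ltr01; have [x Dx] := filter_ex FD.
    have [r r0 xr] := uc_bounded (uc_val_space x) i.
    exists (1 + r); first exact: addr_gt0.
    move=> w iw; rewrite -[f w](subrK (uc_val x w)); apply: le_trans (ler_normD _ _) _.
    by apply: lerD; [exact: Df|exact: xr].
  have [D FD Df] := fF i r r0; have [x Dx] := filter_ex FD.
  by exists (uc_val x); [exact: uc_val_space|exact: Df].
exists (uc_mk Mf) => U /uc_nbhsP [i [r r0 h]].
have [D FD Df] := fF i r r0; apply: filterS FD => x Dx; apply: h => w iw.
by rewrite uc_valB distrC; exact: Df.
Qed.

End UnifSpace.

(** * Completed projective tensor products *)

Section Bilinear.
Context (K : numFieldType).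

Section BilinearTheory.
Context (E F G : lmodType K) (b : E -> F -> G).
Hypothesis bl : bilin b.

Lemma bilinDl x x' y : b (x + x') y = b x y + b x' y.
Proof. by have := bl.2 y 1 x x'; rewrite !scale1r. Qed.

Lemma bilinDr x y y' : b x (y + y') = b x y + b x y'.
Proof. by have := bl.1 x 1 y y'; rewrite !scale1r. Qed.

Lemma bilin0l y : b 0 y = 0.
Proof. by have := bl.2 y (-1) 0 0; rewrite scaler0 addr0 scaleN1r addNr. Qed.

Lemma bilin0r x : b x 0 = 0.
Proof. by have := bl.1 x (-1) 0 0; rewrite scaler0 addr0 scaleN1r addNr. Qed.

Lemma bilinZl k x y : b (k *: x) y = k *: b x y.
Proof. by have := bl.2 y k x 0; rewrite addr0 bilin0l addr0. Qed.

Lemma bilinZr k x y : b x (k *: y) = k *: b x y.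
Proof. by have := bl.1 x k y 0; rewrite addr0 bilin0r addr0. Qed.

Lemma bilinBl x x' y : b (x - x') y = b x y - b x' y.
Proof. by rewrite bilinDl -scaleN1r bilinZl scaleN1r. Qed.

Lemma bilinBr x y y' : b x (y - y') = b x y - b x y'.
Proof. by rewrite bilinDr -scaleN1r bilinZr scaleN1r. Qed.

End BilinearTheory.

(** Away from the origin, [b x' y'] is expanded around [(x, y)]; the two mixed terms are small
    because the given neighbourhoods absorb [x] and [y]. *)
Lemma bilin_continuousP (E F G : tvsType K) (b : E -> F -> G) : bilin b ->
  (forall W, nbhs 0 W -> exists U V, [/\ nbhs 0 U, nbhs 0 V &
     forall x y, U x -> V y -> W (b x y)]) <->
  continuous (fun z : E * F => b z.1 z.2).
Proof.
move=> bl; split=> [h [x y] W|bc W W0]; last first.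
  have := bc (0, 0) W; rewrite /= (bilin0l bl) => /(_ W0) [[U V] [/= U0 V0] UV].
  by exists U, V; split=> // x y Ux Vy; exact: (UV (x, y)).
move=> /nbhs_translate W0; have [W1 W10 W1W] := nbhs0_add W0.
have [W2 W20 W2W] := nbhs0_add W10.
have [U [V [U0 V0 UV]]] := h _ W20; have [U' [V' [U'0 V'0 U'V']]] := h _ W10.
have [t t0 ty] := nbhs0_absorb y V0; have [s s0 sx] := nbhs0_absorb x U0.
have h1 : nbhs 0 [set v | W2 (b v y)].
  apply: filterS (nbhs0_scale t^-1 U0) => v Uv /=.
  have := UV _ _ Uv (ty t _); rewrite (bilinZl bl) (bilinZr bl) scalerA.
  by rewrite mulVf ?gt_eqF// scale1r; apply; rewrite ger0_norm// ltW.
have h2 : nbhs 0 [set v | W2 (b x v)].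
  apply: filterS (nbhs0_scale s^-1 V0) => v Vv /=.
  have := UV _ _ (sx s _) Vv; rewrite (bilinZl bl) (bilinZr bl) scalerA.
  by rewrite mulfV ?gt_eqF// scale1r; apply; rewrite ger0_norm// ltW.
exists ([set v | (U' `&` [set v | W2 (b v y)]) (v - x)],
        [set v | (V' `&` [set v | W2 (b x v)]) (v - y)]).
  split=> /=; apply/nbhs_translate.
    by apply: filterS (filterI U'0 h1) => v /=; rewrite addrAC subrr add0r.
  by apply: filterS (filterI V'0 h2) => v /=; rewrite addrAC subrr add0r.
move=> [x' y'] [/= [Ux Wx] [Vy Wy]].
have -> : b x' y' = b x y + (b (x' - x) (y' - y) + (b (x' - x) y + b x (y' - y))).
  rewrite -{1}(subrK x x') -{1}(subrK y y'); set u := x' - x; set v := y' - y; move: u v => u v.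
  rewrite (bilinDl bl) !(bilinDr bl).
  by rewrite addrA addrC -[_ + _ + b x _]addrA.
apply: W1W; first exact: U'V'.
exact: W2W.
Qed.

Lemma closed_spanP (E : tvsType K) (G : set E) : closed (closed_span G).
Proof.
move=> x xS S SG; apply: SG.1.2 => U /xS [y [yS Uy]].
by exists y; split=> //; exact: yS.
Qed.

Lemma closed_span_gen (E : tvsType K) (G : set E) : G `<=` closed_span G.
Proof. by move=> x Gx S [_]; exact. Qed.

Lemma closed_span_min (E : tvsType K) (G : set E) (S : set E) :
  is_subspace S -> closed S -> G `<=` S -> closed_span G `<=` S.
Proof. by move=> Ss cS GS x; apply. Qed.

Lemma eq_on_closed_span (E F : tvsType K) (G : set E) (f g : E -> F) :
  hausdorff_space F -> linear f -> continuous f -> linear g -> continuous g ->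
  (forall x, G x -> f x = g x) -> forall x, subspace_set (closed_span G) x -> f x = g x.
Proof.
move=> hF fl fc gl gc fg; apply: closed_span_min => //.
  split; first by rewrite /= !linear0E.
  by move=> k x y /= fgx fgy; rewrite fl gl fgx fgy.
move=> x /closureP cx; apply/eqP; rewrite -subr_eq0; apply/eqP.
apply: (hausdorff_tvsP F).1 => // U U0.
have [V V0 VU] := nbhs0_add U0; have [D [D0 dD DV]] := nbhs0_disk V0.
have fD := (linear_continuousP fl).2 fc _ D0.
have gD := (linear_continuousP gl).2 gc _ D0.
have [y /= fgy [/= Dfy Dgy]] := cx _ (filterI fD gD).
have fB u v (h : E -> F) : linear h -> h (u - v) = h u - h v.
  by move=> hl; rewrite addrC -scaleN1r hl scaleN1r addrC.
have -> : f x - g x = - f (y - x) + g (y - x).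
  by rewrite !fB// fgy opprB addrA subrK.
by apply: VU; apply: DV => //; exact: disk_opp.
Qed.

End Bilinear.

(** * Existence of the completed projective tensor product *)

Section TensorExists.
Context (R : realType) (Y X : tvsType R[i]).
Local Notation C := (R[i]).

(* The completed projective tensor product is realized as the closed span of the
   evaluations [b |-> b y x] in the space of functions on the continuous bilinear
   forms, with uniform convergence on equicontinuous sets. *)
Definition bounded_form := {b : Y -> X -> C^o | bilin b /\
  exists U V, [/\ nbhs 0 U, nbhs 0 V & forall y x, U y -> V x -> `|b y x| <= 1]}.

Definition nbhs0_pair := {UV : set Y * set X | nbhs 0 UV.1 /\ nbhs 0 UV.2}.

Definition mk_pair U V (U0 : nbhs 0 U) (V0 : nbhs 0 V) : nbhs0_pair :=
  exist (fun UV : set Y * set X => nbhs 0 UV.1 /\ nbhs 0 UV.2) (U, V) (conj U0 V0).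

(** The polar of a pair of neighbourhoods; every equicontinuous set of bilinear forms is contained
    in one of these. *)
Definition equi_forms (i : nbhs0_pair) : set bounded_form :=
  [set b | forall y x, (sval i).1 y -> (sval i).2 x -> `|sval b y x| <= 1].

Definition eval_form y x : bounded_form -> C^o := fun b => sval b y x.

(** The closed span is written as an intersection because the topology becomes available only after
    [uc_bounded]; boundedness is included for the same reason. *)
Definition tensor_space : set (bounded_form -> C^o) :=
  [set f | unif_bounded equi_forms f /\ forall N : set (bounded_form -> C^o),
     is_subspace N -> unif_closed equi_forms N -> (forall y x, N (eval_form y x)) ->
     N f].

Lemma nbhs0_pair_inh : nbhs0_pair.
Proof. by exists (setT, setT); split; exact: filterT. Qed.

Lemma nbhs0_pair_dir (i j : nbhs0_pair) :
  exists k, equi_forms i `<=` equi_forms k /\ equi_forms j `<=` equi_forms k.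
Proof.
case: i j => -[U V] [U0 V0] [[U' V'] [U'0 V'0]].
exists (mk_pair (filterI U0 U'0) (filterI V0 V'0)).
split=> b h y x [/= ? ?] [? ?]; exact: h.
Qed.

Lemma eval_form_bounded y x : unif_bounded equi_forms (eval_form y x).
Proof.
case=> -[U V] [/= U0 V0].
have [t t0 ty] := nbhs0_absorb y U0; have [s s0 sx] := nbhs0_absorb x V0.
exists ((t * s)^-1); first by rewrite invr_gt0 mulr_gt0.
have nt : `|t| <= t by rewrite ger0_norm// ltW.
have ns : `|s| <= s by rewrite ger0_norm// ltW.
move=> [b [bl bb]] h; have := h _ _ (ty _ nt) (sx _ ns).
rewrite /= (bilinZl bl) (bilinZr bl) scalerA.
have ts0 : 0 < t * s by rewrite mulr_gt0.
change (`|t * s * b y x| <= 1 -> `|b y x| <= (t * s)^-1).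
by rewrite normrM (gtr0_norm ts0) -[_^-1]mulr1 ler_pdivlMl.
Qed.

Lemma tensor_spaceP : is_subspace tensor_space.
Proof.
split.
  split=> [i|N [N0 _] _ _]; last exact: N0.
  by exists 1 => // w _; rewrite normr0.
move=> k f g [fb fN] [gb gN]; split=> [i|N Ns Nc Nt].
  have [r r0 fr] := fb i; have [s s0 gs] := gb i.
  exists (`|k| * r + s); first by rewrite ltr_wpDl// mulr_ge0// ltW.
  move=> w iw; apply: le_trans (ler_normD _ _) _; rewrite normrM.
  by apply: lerD; [apply: ler_wpM2l => //; exact: fr|exact: gs].
by apply: Ns.2; [exact: fN|exact: gN].
Qed.

Definition tensor_data : unif_data C :=
  @UnifData C bounded_form nbhs0_pair equi_forms nbhs0_pair_inh nbhs0_pair_dir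
    (LinearSubspace tensor_spaceP) (fun phi h => h.1).

Definition ptensor := unif_space tensor_data.

Lemma tensor_space_closed : unif_closed equi_forms tensor_space.
Proof.
move=> f fb h; split=> // N Ns Nc Nt; apply: (Nc) => // i r r0.
by have [g [_ gN] fg] := h i r r0; exists g => //; exact: gN.
Qed.

Lemma eval_form_in y x : tensor_space (eval_form y x).
Proof. by split; [exact: eval_form_bounded|move=> N _ _]. Qed.

Definition ptensor_map y x : ptensor := uc_mk (d := tensor_data) (eval_form_in y x).

Lemma bounded_form_cover (b : bounded_form) : exists i, equi_forms i b.
Proof.
case: (b) => b' [bl [U [V [U0 V0 UV]]]].
by exists (mk_pair U0 V0).
Qed.

Lemma ptensor_hausdorff : hausdorff_space ptensor.
Proof. exact: (uc_hausdorff (d := tensor_data) bounded_form_cover). Qed.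

Lemma ptensor_complete : tvs_complete ptensor.
Proof.
apply: (uc_complete (d := tensor_data)).
- exact: complex_complete.
- exact: bounded_form_cover.
- exact: tensor_space_closed.
Qed.

Lemma ptensor_bilin : bilin ptensor_map.
Proof.
split=> [y k x x'|x k y y']; apply: uc_ext; apply/funext => -[b [bl bb]].
  exact: (bl.1 y k x x').
exact: (bl.2 x k y y').
Qed.

Lemma ptensor_continuous : continuous (fun z : Y * X => ptensor_map z.1 z.2).
Proof.
apply/(bilin_continuousP ptensor_bilin) => W /uc_nbhs0P [[[U V] [/= U0 V0]] [r r0 rW]].
exists [set y | U (r^-1 *: y)], V; split=> //; first exact: nbhs0_scale.
move=> y x Uy Vx; apply: rW => -[b [bl bb]] /= h.
have := h _ _ Uy Vx; rewrite /= (bilinZl bl).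
change (`|r^-1 * b y x| <= 1 -> `|b y x| <= r).
by rewrite normrM gtr0_norm ?invr_gt0// ler_pdivrMl// mulr1.
Qed.

(** A closed subspace [S] of [ptensor], seen as a set of functions, is uniformly closed, so the
    minimality built into [tensor_space] applies to it. *)
Lemma ptensor_dense (t : ptensor) :
  subspace_set (closed_span [set u | exists y x, u = ptensor_map y x]) t.
Proof.
move=> S [[Ss Sc] Sg].
have [_ tN] := uc_val_space t.
have [| |y x|u Su ut] := tN [set uc_val u | u in S].
- split; first by exists 0 => //; exact: Ss.1.
  move=> k _ _ [u Su <-] [v Sv <-]; exists (k *: u + v) => //; exact: Ss.2.
- move=> f fb h; have Mf : tensor_space f.
    apply: tensor_space_closed => // i r r0; have [_ [u Su <-] fu] := h i r r0.
    by exists (uc_val u) => //; exact: (uc_val_space u).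
  exists (uc_mk (d := tensor_data) Mf) => //; apply: Sc; apply/closureP => U.
  move=> /uc_nbhs0P [i [r r0 rU]]; have [_ [u Su <-] fu] := h i r r0.
  by exists u => //; apply: rU => w iw; rewrite uc_valB distrC; exact: fu.
- by exists (ptensor_map y x) => //; apply: Sg; exists y, x.
- by move: Su; rewrite (uc_ext ut).
Qed.

Section Universal.
Context (Z : tvsType C) (b : Y -> X -> Z).
Hypotheses (hZ : hausdorff_space Z) (cZ : tvs_complete Z) (bl : bilin b)
  (bc : continuous (fun z : Y * X => b z.1 z.2)).

Definition bounded_functional (f : Z -> C^o) := linear f /\
  exists2 O, nbhs 0 O & forall z, O z -> `|f z| <= 1.

Lemma comp_form_bounded f : bounded_functional f ->
  bilin (fun y x => f (b y x)) /\ exists U V, [/\ nbhs 0 U, nbhs 0 V &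
     forall y x, U y -> V x -> `|f (b y x)| <= 1].
Proof.
move=> [fl [ O O0 fO]]; split.
  split; first by move=> y k x x'; rewrite (bl.1 y) fl.
  by move=> x k y y'; rewrite (bl.2 x) fl.
have [U [V [U0 V0 UV]]] := (bilin_continuousP bl).2 bc _ O0.
by exists U, V; split=> // y x Uy Vx; apply: fO; exact: UV.
Qed.

Definition comp_form f (hf : bounded_functional f) : bounded_form :=
  exist _ _ (comp_form_bounded hf).

(* [z] is the image of [phi] under the linear map induced by [b]: functionals
   separate the points of [Z], so this determines [z]. *)
Definition represents (phi : bounded_form -> C^o) (z : Z) :=
  forall f (hf : bounded_functional f), f z = phi (comp_form hf).

Lemma represents_lin k phi psi z z' : represents phi z -> represents psi z' ->
  represents (k *: phi + psi) (k *: z + z').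
Proof. by move=> h h' f hf; rewrite hf.1 (h _ hf) (h' _ hf). Qed.

(** If [z] missed a disk [D] inside [O], a functional bounded by 1 on [D] and of modulus at least 1
    at [z] would compose with [b] to a form in [equi_forms i], where [phi] is at most 1/2.
    Uniqueness of [z], continuity of the induced map and the Cauchy property below all rest on
    this. *)
Lemma represents_small (O : set Z) : nbhs 0 O -> exists i, forall phi z,
  represents phi z -> (forall w, equi_forms i w -> `|phi w| <= 2^-1) -> O z.
Proof.
move=> O0; have [D [D0 dD DO]] := nbhs0_disk O0.
have [U [V [U0 V0 UV]]] := (bilin_continuousP bl).2 bc _ D0.
exists (mk_pair U0 V0) => phi z pz ps; apply: DO; apply: contrapT => nDz.
have Dabs x : exists2 t : C, 0 < t & D (t *: x).
  have [t t0 tx] := nbhs0_absorb x D0; exists t => //; apply: tx.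
  by rewrite ger0_norm// ltW.
have [f [fl fD fz]] := hahn_banach_disk dD Dabs nDz.
have hf : bounded_functional f by split=> //; exists D.
have : equi_forms (mk_pair U0 V0) (comp_form hf).
  by move=> y x /= Uy Vx; apply: fD; exact: UV.
move=> /ps; rewrite -(pz _ hf) => /(le_trans fz).
by rewrite -[2^-1]mul1r ler_pdivlMr// mul1r (ler_nat _ 2 1).
Qed.

Lemma representsB phi psi z z' : represents phi z -> represents psi z' ->
  represents (phi - psi) (z - z').
Proof.
move=> h h'; have := represents_lin (-1) h' h.
by rewrite !scaleN1r ![- _ + _]addrC.
Qed.

Lemma represents_uniq phi z z' : represents phi z -> represents phi z' -> z = z'.
Proof.
move=> h h'; apply/eqP; rewrite -subr_eq0; apply/eqP.
apply: (hausdorff_tvsP Z).1 => // O O0; have [i iO] := represents_small O0.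
apply: (iO _ _ (representsB h h')) => w _.
by rewrite subrr [X in `|X|]/(0 : C) normr0 invr_ge0 ler0n.
Qed.

Lemma functional_nbhs f (e : C) : bounded_functional f -> 0 < e ->
  nbhs 0 [set z | `|f z| <= e].
Proof.
move=> [fl [ O O0 fO]] e0; apply: filterS (nbhs0_scale e^-1 O0) => z /= /fO.
have -> : f (e^-1 *: z) = e^-1 *: f z.
  by have := fl e^-1 z 0; rewrite addr0 (linear0E fl) addr0.
change (`|e^-1 * f z| <= 1 -> `|f z| <= e).
by rewrite normrM gtr0_norm ?invr_gt0// ler_pdivrMl// mulr1.
Qed.

Definition representable : set (bounded_form -> C^o) := [set phi | exists z, represents phi z].

(** The points that represent approximations of [f] generate a Cauchy filter, and its limit in the
    complete space [Z] represents [f]. *)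
Lemma representable_closed : unif_closed equi_forms representable.
Proof.
move=> f fb h.
pose G i r := [set z | exists2 phi, represents phi z &
  forall w, equi_forms i w -> `|f w - phi w| <= r].
pose F := [set D : set Z | exists i, exists2 r, 0 < r & G i r `<=` D].
have Gex i r : 0 < r -> exists z, G i r z.
  by move=> r0; have [g [z gz] fg] := h i r r0; exists z, g.
have FF : ProperFilter F.
  split=> [|]; first by move=> [i [r r0 /(_ _)]] H; have [z Gz] := Gex i r r0; exact: (H z).
  split.
  - by exists nbhs0_pair_inh, 1.
  - move=> P Q [i [r r0 rP]] [j [s s0 sQ]].
    have [k [ik jk]] := nbhs0_pair_dir i j; have [t [t0 tr ts]] := min_pos r0 s0.
    exists k, t => // z [phi pz fp]; split.
      by apply: rP; exists phi => // w /ik /fp /le_trans; apply.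
    by apply: sQ; exists phi => // w /jk /fp /le_trans; apply.
  - by move=> P Q PQ [i [r r0 rP]]; exists i, r => //; exact: subset_trans PQ.
have cF : tvs_cauchy F.
  move=> O O0; have [i iO] := represents_small O0.
  (* Two errors of 1/4 add up to the tolerance 1/2 of [represents_small]. *)
  have q0 : 0 < 4^-1 :> C by rewrite invr_gt0.
  exists (G i 4^-1); first by exists i, 4^-1.
  move=> z z' [phi pz fp] [psi pz' fp'].
  apply: (iO _ _ (representsB pz pz')) => w iw.
  change (`|phi w - psi w| <= 2^-1); rewrite -(subrKA (f w)).
  apply: le_trans (ler_normD _ _) _.
  have -> : 2^-1 = 4^-1 + 4^-1 :> C by field.
  by apply: lerD; [rewrite distrC; exact: fp|exact: fp'].
have [z Fz] := cZ FF cF; exists z => g hg.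
apply/eqP; rewrite -subr_eq0; apply/negPn/negP => ne.
set e := `|g z - f (comp_form hg)|; have e0 : 0 < e by rewrite normr_gt0.
have e3 : 0 < e / 3 by rewrite divr_gt0.
have [i ig] := bounded_form_cover (comp_form hg).
have F1 : F (G i (e / 3)) by exists i, (e / 3).
have F2 : F [set z' | `|g (z' - z)| <= e / 3].
  apply: Fz; apply/nbhs_translate; apply: filterS (functional_nbhs hg e3) => v /=.
  by rewrite addrAC subrr add0r.
have [z' [[phi pz' /(_ _ ig) fp] /= gz]] := filter_ex (filterI F1 F2).
have gB : g (z' - z) = g z' - g z.
  by rewrite addrC -scaleN1r hg.1 scaleN1r addrC.
have : e <= e / 3 + e / 3.
  rewrite {1}/e -(subrKA (g z')); apply: le_trans (ler_normD _ _) _.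
  by apply: lerD; rewrite distrC; [rewrite -gB|rewrite (pz' _ hg)].
have -> : e / 3 + e / 3 = e * (2 / 3) by field.
by rewrite ler_pMr// ler_pdivlMr// mul1r (ler_nat _ 3 2).
Qed.

Lemma represents_eval y x : represents (eval_form y x) (b y x).
Proof. by []. Qed.

Lemma tensor_representable (t : ptensor) : exists z, represents (uc_val t) z.
Proof.
have [_ /(_ representable)] := uc_val_space t; apply.
- split.
    by exists 0 => f hf; rewrite (linear0E hf.1).
  by move=> k p q [z pz] [z' qz']; exists (k *: z + z'); exact: represents_lin.
- exact: representable_closed.
- by move=> y x; exists (b y x); exact: represents_eval.
Qed.

Lemma ptensor_universal : exists! h : ptensor -> Z,
  [/\ linear h, continuous h & forall y x, h (ptensor_map y x) = b y x].
Proof.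
have [h hP] := choice tensor_representable.
have hl : linear h.
  move=> k t u; exact: (represents_uniq (hP (k *: t + u)) (represents_lin k (hP t) (hP u))).
have hc : continuous h.
  apply/(linear_continuousP hl) => O /represents_small [i iO].
  apply/uc_nbhs0P; exists i, 2^-1; first by rewrite invr_gt0.
  by move=> t ts; apply: (iO _ _ (hP t)).
have ht y x : h (ptensor_map y x) = b y x.
  exact: (represents_uniq (hP _)).
exists h; split=> // h' [h'l h'c h't]; apply/funext => t.
apply: (eq_on_closed_span hZ hl hc h'l h'c _ (ptensor_dense t)).
by move=> _ [y [x ->]]; rewrite ht h't.
Qed.

End Universal.

Definition ptensor_ct : ctensor Y X :=
  @CTensor C Y X ptensor ptensor_hausdorff ptensor_complete ptensor_map
    ptensor_bilin ptensor_continuous ptensor_universal.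

(** Density is not a field of [ctensor]. The comparison maps [h] and [k] with [ptensor] satisfy
    [k \o h = id] by the uniqueness clause, so density is carried over from [ptensor]. *)
Lemma ctensor_dense (T : ctensor Y X) (t : T) :
  subspace_set (closed_span [set u | exists y x, u = ct_map T y x]) t.
Proof.
have [h [[hl hc ht] _]] := ct_universal T ptensor_hausdorff ptensor_complete
  ptensor_bilin ptensor_continuous.
have [k [[kl kc kt] _]] := ptensor_universal (@ct_hausdorff _ _ _ T) (@ct_complete _ _ _ T)
  (@ct_bilin _ _ _ T) (@ct_continuous _ _ _ T).
have [u [_ uu]] := ct_universal T (@ct_hausdorff _ _ _ T) (@ct_complete _ _ _ T)
  (@ct_bilin _ _ _ T) (@ct_continuous _ _ _ T).
have kh : k \o h = id.
  transitivity u; [apply/esym/uu|apply/uu]; split=> //.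
  - by move=> a x y /=; rewrite hl kl.
  - by move=> x; apply: continuous_comp; [exact: hc|exact: kc].
  - by move=> y x /=; rewrite ht kt.
  - by move=> x; exact: cvg_id.
have -> : t = k (h t) by rewrite -[LHS]/(id t) -kh.
suff : closed_span [set u | exists y x, u = ptensor_map y x] `<=`
    [set s | subspace_set (closed_span [set u | exists y x, u = ct_map T y x]) (k s)].
  by apply; exact: ptensor_dense.
have [S0 SD] := subspaceP (closed_span [set u | exists y x, u = ct_map T y x]).
apply: closed_span_min.
- split; first by rewrite /= (linear0E kl).
  by move=> a x y /= h1 h2; rewrite kl; exact: SD.
- by apply: closed_comp; [move=> x _; exact: kc|exact: closed_spanP].
- by move=> _ [y [x ->]] /=; rewrite kt; apply: closed_span_gen; exists y, x.
Qed.

End TensorExists.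

(** * Tensor products with a cyclic module *)

Section QuotientLift.
Context (K : numFieldType) (E F : tvsType K) (S : linear_subspace E) (f : E -> F).
Hypotheses (fl : linear f) (fc : continuous f) (fS : forall x, subspace_set S x -> f x = 0).

Lemma quot_lift : exists g : tvs_quot S -> F,
  [/\ linear g, continuous g & forall x, g (quot_pi S x) = f x].
Proof.
have [s sP] := choice (@quot_pi_repr K E S).
have e x : f (s (quot_pi S x)) = f x.
  apply/eqP; rewrite -subr_eq0; apply/eqP.
  rewrite addrC -[- f x]scaleN1r -fl scaleN1r addrC; apply: fS.
  exact/quot_piP/sP.
exists (f \o s); split=> //.
  move=> k p q; have [x <-] := quot_pi_repr p; have [y <-] := quot_pi_repr q.
  by rewrite -quot_piZ -quot_piD /= !e fl.
move=> q U; have [x <-] := quot_pi_repr q; rewrite /= e => /fc fU.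
apply: filterS (quot_pi_nbhs S fU) => _ [y Uy <-] /=.
by rewrite e.
Qed.

End QuotientLift.

(** * Modules over the unitization *)

Section UnitizationAction.
Context (K : numFieldType) (A : tvsType K) (mul : A -> A -> A).
Hypotheses (mul_alg : is_alg mul) (mul_cont : continuous (fun z : A * A => mul z.1 z.2)).
Local Notation A1 := (A * K^o)%type.
Local Notation mul1 := (unit_mul mul).
Implicit Types a b x : A1.

(** The unital extension of the action to A_+; products of [Y] with [I] make sense only through it,
    since [I] lies in A_+. *)
Definition unit_act (Y : lmodType K) (act : Y -> A -> Y) (y : Y) a : Y :=
  act y a.1 + a.2 *: y.

Lemma unit_mul_bilin : bilin mul1.
Proof.
have bl := mul_alg.1; split=> [a k x x'|x k a a']; congr (_, _) => /=.
- rewrite (bilinDr bl) (bilinZr bl) !scalerDr scalerDl !scalerA [a.2 * k]mulrC.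
  by rewrite !addrA [LHS](ACl (1*3*5*2*4*6))%AC.
- by rewrite mulrDr mulrCA.
- rewrite (bilinDl bl) (bilinZl bl) !scalerDr scalerDl !scalerA [x.2 * k]mulrC.
  by rewrite !addrA [LHS](ACl (1*3*5*2*4*6))%AC.
- by rewrite mulrDl -scalerAl.
Qed.

Lemma unit_mulA : associative mul1.
Proof.
have [bl mA] := mul_alg.
move=> a b c; congr (_, _) => /=; last exact: mulrA.
rewrite !(bilinDl bl) !(bilinDr bl) !(bilinZl bl) !(bilinZr bl) mA.
rewrite !scalerDr !scalerA [c.2 * a.2]mulrC [c.2 * b.2]mulrC !addrA.
by rewrite [LHS](ACl (1*4*2*5*3*6*7))%AC.
Qed.

Lemma unit_mul_continuous : continuous (fun z : A1 * A1 => mul1 z.1 z.2).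
Proof.
apply/(bilin_continuousP unit_mul_bilin) => W [[V V'] [/= V0 V'0] VW].
have [V1 V10 V1V] := nbhs0_add V0; have [V2 V20 V21] := nbhs0_add V10.
have [U [U' [U0 U'0 UU']]] := (bilin_continuousP mul_alg.1).2 mul_cont _ V20.
have [D [D0 dD DV]] := nbhs0_disk V20; have D1 : D `<=` V1.
  by move=> x /DV Vx; rewrite -[x]addr0; apply: V21 => //; apply/DV; case: dD.
have ball1 : nbhs (0 : K^o) [set k : K | `|k| < 1].
  by exists 1 => //= k /=; rewrite sub0r normrN.
have [D' [D'0 dD' D'V']] := nbhs0_disk V'0.
exists ((U `&` D) `*` ([set k : K | `|k| < 1] `&` D')),
       ((U' `&` D) `*` [set k : K | `|k| < 1]); split.
- by apply: nbhs0_prod; apply: filterI.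
- by apply: nbhs0_prod => //; apply: filterI.
move=> a b [[/= Ua Da] [a1 a2]] [[/= Ub Db] b1]; apply: VW; split => /=.
  apply: V1V.
    by apply: V21; [exact: UU'|apply: DV; apply: disk_scale => //; exact: ltW].
  by apply: D1; apply: disk_scale => //; exact: ltW.
apply: D'V'; rewrite mulrC; apply: (disk_scale (E := K^o)) => //; exact: ltW.
Qed.

Section RightModule.
Context (Y : tvsType K) (act : Y -> A -> Y).
Hypothesis hY : right_frechet_module mul act.

Lemma unit_act_bilin : bilin (unit_act act).
Proof.
have [_ bl _ _] := hY; split=> [y k a b|a k y z]; rewrite /unit_act /=.
  rewrite (bilinDr bl) (bilinZr bl) scalerDl scalerDr scalerA.
  by rewrite addrACA.
rewrite (bilinDl bl) (bilinZl bl) !scalerDr !scalerA addrACA.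
by rewrite [a.2 * k]mulrC.
Qed.

Lemma unit_act_mul y a b : unit_act act (unit_act act y a) b = unit_act act y (mul1 a b).
Proof.
have [_ bl _ mA] := hY; rewrite /unit_act /= !(bilinDr bl) !(bilinZr bl) (bilinDl bl) (bilinZl bl).
rewrite mA scalerDr scalerA [b.2 * a.2]mulrC -!addrA; congr (_ + _).
Qed.

Lemma unit_act_pure y c : unit_act act y (c, 0) = act y c.
Proof. by rewrite /unit_act /= scale0r addr0. Qed.

Lemma unit_act1 y : unit_act act y (0, 1) = y.
Proof. by have [_ bl _ _] := hY; rewrite /unit_act /= (bilin0r bl) add0r scale1r. Qed.

Lemma unit_act_continuous : continuous (fun z : Y * A1 => unit_act act z.1 z.2).
Proof.
have [_ bl cact _] := hY.
apply/(bilin_continuousP unit_act_bilin) => W W0; have [V V0 VW] := nbhs0_add W0.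
have [U [U' [U0 U'0 UU']]] := (bilin_continuousP bl).2 cact _ V0.
have [D [D0 dD DV]] := nbhs0_disk V0.
exists (U `&` D), (U' `*` [set k : K | `|k| < 1]); split; first exact: filterI.
  apply: nbhs0_prod => //; exists 1 => //= k /=; by rewrite sub0r normrN.
move=> y a [Uy Dy] [/= U'a a1]; apply: VW; first exact: UU'.
by apply: DV; apply: disk_scale => //; exact: ltW.
Qed.

End RightModule.

End UnitizationAction.

Section CyclicModule.
Context (R : realType).
Local Notation C := (R[i]).
Context (A : tvsType C) (mul : A -> A -> A).
Local Notation A1 := (A * C^o)%type.
Context (I : linear_subspace A1).
Hypotheses (mul_alg : is_alg mul) (mul_cont : continuous (fun z : A * A => mul z.1 z.2)).
Hypotheses (I_ideal : left_ideal (unit_mul mul) (subspace_set I)).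

Local Notation X := (tvs_quot I).
Local Notation lact := (quot_act mul (I := I)).

Lemma quot_actE c (x : A1) : lact c (quot_pi I x) = quot_pi I (unit_mul mul (c, 0) x).
Proof.
apply/quot_piP; rewrite -(bilinBr (unit_mul_bilin mul_alg)); apply: I_ideal.2.
by apply/quot_piP; exact: (@reprK _ (Quotient.quot (subspace_pred I))).
Qed.

Lemma quot_act_bilin : bilin lact.
Proof.
have bl := unit_mul_bilin mul_alg.
split=> [c k p q|q k c c'].
  have [x <-] := quot_pi_repr p; have [y <-] := quot_pi_repr q.
  by rewrite -quot_piZ -quot_piD !quot_actE bl.1 quot_piD quot_piZ.
have [x <-] := quot_pi_repr q; rewrite !quot_actE -quot_piZ -quot_piD -bl.2.
by congr (quot_pi I (unit_mul mul _ x)); congr (_, _) => /=; rewrite scaler0 addr0.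
Qed.

Lemma quot_act_frechet_module : frechet A -> closed (subspace_set I) ->
  left_frechet_module mul lact.
Proof.
move=> fA cI; split.
- by apply: frechet_quot => //; apply: frechet_prod => //; exact: frechet_complex.
- exact: quot_act_bilin.
- apply/(bilin_continuousP quot_act_bilin) => W /quot_nbhs0P [V V0 VW].
  have [U [U' [[[U1 U2] [/= U10 U20] U12] U'0 UU']]] :=
    (bilin_continuousP (unit_mul_bilin mul_alg)).2 (unit_mul_continuous mul_alg mul_cont) _ V0.
  exists U1, (quot_pi I @` U'); split=> //; first by apply/quot_nbhs0P; exists U'.
  move=> c _ U1c [x U'x <-]; rewrite quot_actE; apply: VW.
  exists (unit_mul mul (c, 0) x) => //; apply: UU' => //; apply: U12; split=> //=.
  exact: nbhs_singleton.
- move=> c c' q; have [x <-] := quot_pi_repr q; rewrite !quot_actE unit_mulA//.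
  congr (quot_pi I (unit_mul mul _ x)).
  by congr (_, _) => /=; rewrite ?mulr0 ?scale0r ?addr0.
Qed.

Definition unit_class : X := quot_pi I (0, 1).

Lemma quot_pi_unit (x : A1) : quot_pi I x = lact x.1 unit_class + x.2 *: unit_class.
Proof.
rewrite quot_actE -quot_piZ -quot_piD; congr (quot_pi I _).
have bl := mul_alg.1; case: x => c k; congr (_, _) => /=.
  by rewrite (bilin0r bl) !scaler0 !add0r scale1r addr0.
by rewrite mul0r add0r; apply: esym; exact: mulr1.
Qed.

Section Tensor.
Context (Y : tvsType C) (ract : Y -> A -> Y).
Hypothesis hY : right_frechet_module mul ract.
Let bY := unit_act_bilin hY.

Definition ideal_span : linear_subspace Y :=
  closed_span [set u | exists y i, subspace_set I i /\ u = unit_act ract y i].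

Local Notation Q := (tvs_quot ideal_span).

Lemma quot_ideal_frechet : frechet Q.
Proof. by apply: frechet_quot; [have [] := hY|exact: closed_spanP]. Qed.

Definition quot_ideal_map (y : Y) (q : X) : Q := quot_pi ideal_span (unit_act ract y (repr q)).

Lemma quot_ideal_mapE y x : quot_ideal_map y (quot_pi I x) = quot_pi ideal_span (unit_act ract y x).
Proof.
apply/quot_piP; rewrite -(bilinBr bY); apply: closed_span_gen.
exists y, (repr (quot_pi I x) - x); split=> //.
by apply/quot_piP; exact: (@reprK _ (Quotient.quot (subspace_pred I))).
Qed.

Lemma quot_ideal_map_bilin : bilin quot_ideal_map.
Proof.
split=> [y k p q|q k y y'].
  have [x <-] := quot_pi_repr p; have [x' <-] := quot_pi_repr q.
  by rewrite -quot_piZ -quot_piD !quot_ideal_mapE bY.1 quot_piD quot_piZ.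
have [x <-] := quot_pi_repr q; rewrite !quot_ideal_mapE -quot_piZ -quot_piD.
by rewrite bY.2.
Qed.

Lemma quot_ideal_map_continuous : continuous (fun z : Y * X => quot_ideal_map z.1 z.2).
Proof.
apply/(bilin_continuousP quot_ideal_map_bilin) => W /quot_nbhs0P [V V0 VW].
have [U [U' [U0 U'0 UU']]] :=
  (bilin_continuousP bY).2 (unit_act_continuous hY) _ V0.
exists U, (quot_pi I @` U'); split=> //; first by apply/quot_nbhs0P; exists U'.
move=> y _ Uy [x U'x <-]; rewrite quot_ideal_mapE; apply: VW.
by exists (unit_act ract y x) => //; exact: UU'.
Qed.

Context (T : ctensor Y X).
Local Notation N := (balancing lact ract T).
Local Notation TA := (tensor_over lact ract T).

Definition tensor_unit (y : Y) : TA := tensor_over_map lact ract T y unit_class.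

Lemma tensor_over_map_bilin : bilin (tensor_over_map lact ract T).
Proof.
have bl := @ct_bilin _ _ _ T.
split=> [y k p q|q k y y']; rewrite /tensor_over_map -quot_piZ -quot_piD.
  by rewrite bl.1.
by rewrite bl.2.
Qed.

Lemma tensor_over_map_balanced y c q :
  tensor_over_map lact ract T (ract y c) q = tensor_over_map lact ract T y (lact c q).
Proof. by apply/quot_piP; apply: closed_span_gen; exists y, c, q. Qed.

Lemma tensor_over_mapE y x :
  tensor_over_map lact ract T y (quot_pi I x) = tensor_unit (unit_act ract y x).
Proof.
have bl := tensor_over_map_bilin.
rewrite quot_pi_unit (bilinDr bl) (bilinZr bl) -tensor_over_map_balanced.
by rewrite /tensor_unit /unit_act (bilinDl bl) (bilinZl bl).
Qed.

Lemma tensor_unit_linear : linear tensor_unit.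
Proof. exact: (tensor_over_map_bilin.2 unit_class). Qed.

Lemma tensor_unit_continuous : continuous tensor_unit.
Proof.
apply/(linear_continuousP tensor_unit_linear) => W /quot_nbhs0P [V V0 VW].
have [U [U' [U0 U'0 UU']]] :=
  (bilin_continuousP (@ct_bilin _ _ _ T)).2 (@ct_continuous _ _ _ T) _ V0.
have [t t0 te] := nbhs0_absorb unit_class U'0.
apply: filterS (nbhs0_scale t^-1 U0) => y Uy; apply: VW.
exists (ct_map T y unit_class) => //.
have := UU' _ _ Uy (te t _); rewrite (bilinZl (@ct_bilin _ _ _ T)).
rewrite (bilinZr (@ct_bilin _ _ _ T)) scalerA mulVf ?gt_eqF// scale1r; apply.
by rewrite ger0_norm// ltW.
Qed.

Lemma tensor_over_hausdorff : hausdorff_space TA.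
Proof. by apply: quot_hausdorff; exact: closed_spanP. Qed.

Lemma tensor_unit_ideal y : subspace_set ideal_span y -> tensor_unit y = 0.
Proof.
have z0 : linear (fun _ : Y => 0 : TA) by move=> k u v /=; rewrite scaler0 addr0.
apply: (eq_on_closed_span tensor_over_hausdorff tensor_unit_linear tensor_unit_continuous z0).
  by move=> x; exact: cvg_cst.
move=> _ [{}y [i [Ii ->]]]; rewrite -tensor_over_mapE.
have -> : quot_pi I i = 0 by apply/quot_pi0P.
exact: (bilin0r tensor_over_map_bilin).
Qed.

(* [T -> Y / cl(Y I)] and [Y / cl(Y I) -> T / N] factor the quotient map of [T]. *)
Lemma tensor_unitP :
  (forall y, tensor_unit y = 0 -> subspace_set ideal_span y) /\
  (forall t : TA, exists y, tensor_unit y = t).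
Proof.
have [hQ _ cQ] := quot_ideal_frechet.
have [h [[hl hc ht] _]] := ct_universal T hQ cQ quot_ideal_map_bilin quot_ideal_map_continuous.
have hN t : subspace_set N t -> h t = 0.
  have z0 : linear (fun _ : T => 0 : Q) by move=> k u v /=; rewrite scaler0 addr0.
  apply: (eq_on_closed_span hQ hl hc z0); first by move=> x; exact: cvg_cst.
  move=> _ [y [c [q ->]]]; rewrite addrC -scaleN1r hl !ht.
  have [x <-] := quot_pi_repr q; rewrite quot_actE !quot_ideal_mapE.
  by rewrite -(unit_act_mul hY) unit_act_pure scaleN1r addNr.
split=> [y|t].
  move=> /quot_pi0P /hN; rewrite ht quot_ideal_mapE (unit_act1 hY).
  by move=> /quot_pi0P.
have [k [kl kc kE]] := quot_lift tensor_unit_linear tensor_unit_continuous tensor_unit_ideal.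
have [s <-] := quot_pi_repr t; have [y hy] := quot_pi_repr (h s).
exists y; rewrite -kE hy.
apply: (eq_on_closed_span (f := k \o h) tensor_over_hausdorff _ _ _ _ _ (ctensor_dense s)).
- by move=> a u v /=; rewrite hl kl.
- by move=> u; apply: continuous_comp; [exact: hc|exact: kc].
- exact: quot_pi_linear.
- exact: quot_pi_continuous.
- move=> _ [z [q ->]]; rewrite /= ht; have [x <-] := quot_pi_repr q.
  by rewrite quot_ideal_mapE kE -tensor_over_mapE.
Qed.

End Tensor.

End CyclicModule.

(** * Exactness of tensored sequences in terms of cl(Y I) *)

Section Exactness.
Context (R : realType).
Local Notation C := (R[i]).
Context (A : tvsType C) (mul : A -> A -> A).
Local Notation A1 := (A * C^o)%type.
Context (I : linear_subspace A1).
Hypothesis mul_alg : is_alg mul.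
Hypotheses (I_ideal : left_ideal (unit_mul mul) (subspace_set I)).
Local Notation lact := (quot_act mul (I := I)).
Local Notation X := (tvs_quot I).

Lemma module_map_unit_act (Y Y' : lmodType C) (act : Y -> A -> Y) (act' : Y' -> A -> Y')
    (f : Y -> Y') : linear f -> (forall y a, f (act y a) = act' (f y) a) ->
  forall y a, f (unit_act act y a) = unit_act act' (f y) a.
Proof. by move=> fl fa y a; rewrite /unit_act addrC fl fa addrC. Qed.

Section InducedMap.
Context (Y Y' : tvsType C) (r : Y -> A -> Y) (r' : Y' -> A -> Y') (f : Y -> Y').
Hypotheses (hY : right_frechet_module mul r) (hY' : right_frechet_module mul r').
Hypothesis (hf : right_module_map r r' f).

(** Exactness is formulated for given induced maps, so flatness can be applied only after producing
    them; the map between tensor products respects the balancing relations because [f] is a module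
    map. *)
Lemma tensor_induced_exists (T : ctensor Y X) (T' : ctensor Y' X) :
  exists Phi, tensor_induced (lact := lact) (ract := r) (ract' := r') (T := T) (T' := T') f Phi.
Proof.
have [fl fc fr] := hf; have bl := @ct_bilin _ _ _ T'.
have fbl : bilin (fun y x => ct_map T' (f y) x).
  by split=> [y k x x'|x k y y']; [rewrite bl.1|rewrite fl bl.2].
have fbc : continuous (fun z : Y * X => ct_map T' (f z.1) z.2).
  apply/(bilin_continuousP fbl) => W W0.
  have [U [V [U0 V0 UV]]] := (bilin_continuousP bl).2 (@ct_continuous _ _ _ T') _ W0.
  exists (f @^-1` U), V; split=> //; first exact: (linear_continuousP fl).2.
  by move=> y x; exact: UV.
have [h [[hl hc ht] _]] := ct_universal T (@ct_hausdorff _ _ _ T') (@ct_complete _ _ _ T') fbl fbc.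
pose N' := balancing lact r' T'.
have phl : linear (quot_pi N' \o h) by move=> k u v /=; rewrite hl quot_pi_linear.
have phc : continuous (quot_pi N' \o h).
  by move=> u; apply: continuous_comp; [exact: hc|exact: quot_pi_continuous].
have hd : hausdorff_space (tvs_quot N') by apply: quot_hausdorff; exact: closed_spanP.
have phN t : subspace_set (balancing lact r T) t -> (quot_pi N' \o h) t = 0.
  have z0 : linear (fun _ : T => 0 : tvs_quot N') by move=> k u v /=; rewrite scaler0 addr0.
  apply: (eq_on_closed_span hd phl phc z0); first by move=> x; exact: cvg_cst.
  move=> _ [y [c [q ->]]]; apply/quot_pi0P; apply: closed_span_gen.
  exists (f y), c, q; rewrite addrC -scaleN1r hl !ht scaleN1r fr addrC; reflexivity.
have [Phi [Pl Pc PE]] := quot_lift phl phc phN.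
exists Phi; split=> // y x; rewrite /tensor_over_map PE /= ht; reflexivity.
Qed.

End InducedMap.

Context (Y1 Y2 Y3 : tvsType C) (r1 : Y1 -> A -> Y1) (r2 : Y2 -> A -> Y2)
  (r3 : Y3 -> A -> Y3) (f : Y1 -> Y2) (g : Y2 -> Y3).
Hypotheses (h1 : right_frechet_module mul r1) (h2 : right_frechet_module mul r2)
  (h3 : right_frechet_module mul r3).
Hypotheses (hf : right_module_map r1 r2 f) (hg : right_module_map r2 r3 g).
Hypothesis (fg : short_exact f g).
Local Notation J1 := (subspace_set (ideal_span I r1)).
Local Notation J2 := (subspace_set (ideal_span I r2)).
Local Notation J3 := (subspace_set (ideal_span I r3)).

(** In every realization [tensor_unit] is onto with kernel [ideal_span], so the direction towards
    exactness is a diagram chase. The other direction needs actual realizations, which [ptensor_ct]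
    supplies. *)
Lemma ideal_span_exactP : tensor_exact lact r1 r2 r3 f g <->
  (forall y, J2 (f y) -> J1 y) /\ (forall y, J3 (g y) -> exists x, J2 (y - f x)).
Proof.
have [fl fc fr] := hf; have [gl gc gr] := hg; have [fi fgE gs] := fg.
have indE T1 T2 Phi y : tensor_induced (lact := lact) (ract := r1) (ract' := r2) (T := T1) (T' := T2) f Phi ->
  Phi (tensor_unit mul r1 T1 y) = tensor_unit mul r2 T2 (f y) by case=> _ _; exact.
have indE' T2 T3 Psi y : tensor_induced (lact := lact) (ract := r2) (ract' := r3) (T := T2) (T' := T3) g Psi ->
  Psi (tensor_unit mul r2 T2 y) = tensor_unit mul r3 T3 (g y) by case=> _ _; exact.
split.
  move=> ex; pose T1 := ptensor_ct Y1 X; pose T2 := ptensor_ct Y2 X; pose T3 := ptensor_ct Y3 X.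
  have [Phi hPhi] := tensor_induced_exists hf T1 T2.
  have [Psi hPsi] := tensor_induced_exists hg T2 T3.
  have [Pi PE _] := ex T1 T2 T3 Phi Psi hPhi hPsi.
  split=> y.
    move=> /(tensor_unit_ideal mul_alg I_ideal T2); rewrite -(indE T1 _ Phi)// => e.
    apply: (tensor_unitP mul_alg I_ideal h1 T1).1; apply: Pi; rewrite e.
    by have [Pl _ _] := hPhi; rewrite (linear0E Pl).
  move=> /(tensor_unit_ideal mul_alg I_ideal T3); rewrite -(indE' T2 _ Psi)// => e.
  have : (Psi @^-1` [set 0]) (tensor_unit mul r2 T2 y) by [].
  rewrite -PE => -[t _]; have [x <-] := (tensor_unitP mul_alg I_ideal h1 T1).2 t.
  rewrite (indE T1 T2 Phi)// => e'; exists x.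
  apply: (tensor_unitP mul_alg I_ideal h2 T2).1.
  have tl := tensor_unit_linear mul r2 T2.
  by rewrite addrC -scaleN1r tl e' scaleN1r addNr.
move=> [H1 H2] T1 T2 T3 Phi Psi hPhi hPsi.
have [Pl _ _] := hPhi; have [Sl _ _] := hPsi.
split.
- move=> s t; have [y <-] := (tensor_unitP mul_alg I_ideal h1 T1).2 s.
  have [y' <-] := (tensor_unitP mul_alg I_ideal h1 T1).2 t.
  have tl := tensor_unit_linear mul r1 T1.
  have tl2 := tensor_unit_linear mul r2 T2.
  rewrite !(indE T1 T2)// => e; apply/eqP; rewrite -subr_eq0 addrC -scaleN1r -tl; apply/eqP.
  apply: (tensor_unit_ideal mul_alg I_ideal); apply: H1.
  apply: (tensor_unitP mul_alg I_ideal h2 T2).1.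
  by rewrite fl tl2 e scaleN1r addNr.
- apply/seteqP; split.
    move=> _ [s _ <-]; have [y <-] := (tensor_unitP mul_alg I_ideal h1 T1).2 s.
    rewrite /= (indE T1 T2)// (indE' T2 T3)//.
    have : range f (f y) by exists y.
    rewrite fgE /= => ->; apply: linear0E; exact: (tensor_unit_linear mul r3).
  move=> t; have [y <-] := (tensor_unitP mul_alg I_ideal h2 T2).2 t.
  rewrite /= (indE' T2 T3)// => /(tensor_unitP mul_alg I_ideal h3 T3).1 /H2 [x xy].
  exists (tensor_unit mul r1 T1 x) => //; rewrite (indE T1 T2)//.
  have tl2 := tensor_unit_linear mul r2 T2.
  have := tensor_unit_ideal mul_alg I_ideal T2 xy.
  by rewrite addrC -scaleN1r tl2 scaleN1r addrC => /eqP; rewrite subr_eq0 => /eqP ->.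
- apply/seteqP; split=> // t _; have [z <-] := (tensor_unitP mul_alg I_ideal h3 T3).2 t.
  have : range g z by rewrite gs.
  move=> [y _ <-]; exists (tensor_unit mul r2 T2 y) => //.
  exact: indE'.
Qed.

End Exactness.

(** * Approximate identities and strict flatness *)

Section Seminorms.
Context (K : numFieldType) (A : tvsType K) (mul : A -> A -> A).
Context (D : arens_michael_decomposition mul).
Local Notation A1 := (A * K^o)%type.

Lemma am_norm_ge0 l a : 0 <= am_norm D l a.
Proof.
have [pD pZ] := am_seminorm D l.
have p0 : am_norm D l 0 = 0 by have := pZ 0 0; rewrite scaler0 normr0 mul0r.
have := pD a (- a); rewrite subrr p0 -scaleN1r pZ normrN1 mul1r.
by rewrite -mulr2n pmulrn_lge0.
Qed.

Lemma am_nbhs l (e : K) : 0 < e -> nbhs 0 [set a | am_norm D l a < e].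
Proof.
move=> e0; apply/(am_generates D); exists [set am_norm D l], e; split=> //.
- by move=> _ ->; exists l.
- by move=> a /= h; apply: h.
Qed.

Lemma am_nbhs_sub (W : set A) : nbhs 0 W ->
  exists l, exists2 e : K, 0 < e & [set a | am_norm D l a < e] `<=` W.
Proof.
move=> /(am_generates D) [F [e [/finite_seqP [s ->] Fr e0 FW]]].
suff [l hl] : exists l, forall p, p \in s -> forall a, p a <= am_norm D l a.
  exists l, e => // a /= al; apply: FW => p /= ps.
  by apply: le_lt_trans al; exact: hl.
elim: s Fr {FW} => [|p s IH] Fr; first by exists 0%N.
have [|l hl] := IH; first by move=> q qs; apply: Fr; rewrite /= in_cons qs orbT.
have [m _ mp] : range (am_norm D) p by apply: Fr; rewrite /= mem_head.
have [n hn] := am_directed D l m; exists n => q; rewrite in_cons => /orP[/eqP->|qs] a.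
  by rewrite -mp; exact: (hn a).2.
exact: le_trans (hl _ qs a) (hn a).1.
Qed.

(** With the sum of the two norms, the action of a pair [(c, k)] of this ball is an absolutely
    convex combination with weights [1 - |k|] and [|k|]; this is what makes disks stable. *)
Definition unit_ball l : set A1 := [set a | am_norm D l a.1 + `|a.2| < 1].

Lemma unit_ball_nbhs l : nbhs (0 : A1) (unit_ball l).
Proof.
apply: (@filterS _ _ _ ([set a | am_norm D l a < 2^-1] `*` [set k : K | `|k| < 2^-1])).
  move=> a [/= h1 h2]; rewrite /unit_ball /=.
  have -> : 1 = 2^-1 + 2^-1 :> K by field.
  exact: ltrD.
apply: nbhs0_prod; first by apply: am_nbhs; rewrite invr_gt0.
by exists 2^-1 => /= [|k /=]; rewrite ?invr_gt0// sub0r normrN.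
Qed.

Definition stable_disk (Y : lmodType K) (act : Y -> A -> Y) l (V : set Y) :=
  disk V /\ forall y a, V y -> unit_ball l a -> V (unit_act act y a).

(* [W] is the unit ball of [max (p y) (sup {p (y a) : |a|_l <= 1})]; it is stable
   because the seminorms of [A] are submultiplicative. *)
Lemma stable_disk_sub (Y : tvsType K) (act : Y -> A -> Y) (V : set Y) :
  right_frechet_module mul act -> nbhs 0 V ->
  exists l, exists W, [/\ nbhs 0 W, stable_disk act l W & W `<=` V].
Proof.
move=> [_ bl cact mA] V0; have [V1 [V10 dV1 V1V]] := nbhs0_disk V0.
have [U [U' [U0 U'0 UU']]] := (bilin_continuousP bl).2 cact _ V10.
have [l [e e0 eU']] := am_nbhs_sub U'0.
pose W := [set y | V1 y /\ forall c, am_norm D l c <= 1 -> V1 (act y c)].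
exists l, W; split; last by move=> y [/V1V].
  have e2 : 0 < e / 2 by rewrite divr_gt0.
  apply: filterS (filterI V10 (nbhs0_scale (e / 2)^-1 U0)) => y [V1y Uy]; split=> // c c1.
  have -> : act y c = act ((e / 2)^-1 *: y) ((e / 2) *: c).
    by rewrite (bilinZl bl) (bilinZr bl) scalerA mulVf ?gt_eqF// scale1r.
  apply: UU' => //; apply: eU' => /=; have [_ ->] := am_seminorm D l.
  rewrite gtr0_norm//; apply: (@le_lt_trans _ _ (e / 2)).
    by rewrite ger_pMr.
  by rewrite ltr_pdivrMr// ltr_pMr// ltr1n.
have dW : disk W.
  split; first split; first by case: dV1.
    by move=> c _; rewrite (bilin0l bl); case: dV1.
  move=> a b y z ab [V1y hy] [V1z hz]; split; first exact: dV1.2.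
  move=> c c1; rewrite (bilinDl bl) !(bilinZl bl).
  by apply: dV1.2 => //; [exact: hy|exact: hz].
split=> // y [c k] Wy; rewrite /unit_ball /unit_act /= => ck.
have Wc d : am_norm D l d <= 1 -> W (act y d).
  move=> d1; split=> [|d' d'1]; first exact: Wy.2.
  rewrite -mA; apply: Wy.2; apply: le_trans (am_submul D l d d') _.
  by rewrite mulr_ile1// am_norm_ge0.
have s0 : 0 < 1 - `|k| by rewrite subr_gt0 (le_lt_trans _ ck)// lerDr am_norm_ge0.
have -> : act y c = (1 - `|k|) *: act y ((1 - `|k|)^-1 *: c).
  by rewrite (bilinZr bl) scalerA mulfV ?gt_eqF// scale1r.
apply: dW.2 => //; first by rewrite gtr0_norm// subrK.
apply: Wc; have [_ ->] := am_seminorm D l; rewrite gtr0_norm ?invr_gt0//.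
by rewrite ler_pdivrMl// mulr1 lerBrDr ltW.
Qed.

End Seminorms.

Section ApproximateIdentity.
Context (R : realType).
Local Notation C := (R[i]).
Context (A : tvsType C) (mul : A -> A -> A).
Local Notation A1 := (A * C^o)%type.
Context (I : linear_subspace A1) (D : arens_michael_decomposition mul).
Hypothesis mul_alg : is_alg mul.
Hypothesis lbai :
  right_locally_bounded_approximate_identity (unit_mul mul) (subspace_set I).

(** Carries the approximate identity from [I] to cl(Y I). The constant [c] belongs to [U] and does
    not change with [t], so [e - e b] can be made arbitrarily small while [b] stays in the same
    multiple of [U]. *)
Lemma approximate_unit (Y : tvsType C) (act : Y -> A -> Y) (l : nat) (G : set Y)
    (U : set A1) (c : C) (e : Y) :
  right_frechet_module mul act -> nbhs 0 G -> stable_disk D act l G ->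
  U `<=` unit_ball D l -> U `<=` subspace_set I -> 0 < c ->
  (forall F : set A1, finite_set F -> F `<=` subspace_set I ->
     exists b, [set c *: u | u in U] b /\ forall a, F a -> U (a - unit_mul mul a b)) ->
  subspace_set (ideal_span I act) e ->
  forall t : C, 0 < t -> exists b, [/\ subspace_set I b, [set c *: u | u in U] b &
    G (t *: (e - unit_act act e b))].
Proof.
move=> hY G0 [dG sG] Ul UI c0 hF.
have bl := unit_act_bilin hY; have half2 : 2^-1 + 2^-1 = 1 :> C by field.
(* Asking for a finite set [F] that works for all admissible [b], rather than for one [b], makes [Q]
   a subspace: for a sum, the union of two finite sets serves. *)
pose Q := [set e : Y | forall t : C, 0 < t -> exists F, [/\ finite_set F, F `<=` subspace_set I &
  forall b, [set c *: u | u in U] b -> (forall a, F a -> U (a - unit_mul mul a b)) ->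
    G (t *: (e - unit_act act e b))]].
suff hQ : subspace_set (ideal_span I act) `<=` Q.
  move=> eS t t0; have [F [fF FI FG]] := hQ _ eS t t0.
  have [b [bU Fb]] := hF F fF FI; exists b; split=> //; last exact: FG.
  by have [u Uu <-] := bU; have [S0 SD] := subspaceP I; rewrite -[_ *: _]addr0; apply: SD => //; exact: UI.
apply: closed_span_min.
- split.
    move=> t t0; exists set0; split=> // b _ _.
    by rewrite (bilin0l bl) subrr scaler0; case: dG.
  move=> k x y Qx Qy t t0.
  have k1 : 0 < `|k| + 1 by rewrite ltr_wpDl.
  have [F [fF FI FG]] := Qx (2 * (`|k| + 1) * t) (mulr_gt0 (mulr_gt0 (ltr0n _ 2) k1) t0).
  have [F' [fF' FI' FG']] := Qy (2 * t) (mulr_gt0 (ltr0n _ 2) t0).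
  exists (F `|` F'); split; first by rewrite finite_setU.
    by move=> a [/FI|/FI'].
  move=> b bU FFb.
  have g1 := FG b bU (fun a Fa => FFb a (or_introl Fa)).
  have g2 := FG' b bU (fun a Fa => FFb a (or_intror Fa)).
  have -> : t *: (k *: x + y - unit_act act (k *: x + y) b) =
     (k / (2 * (`|k| + 1))) *: ((2 * (`|k| + 1) * t) *: (x - unit_act act x b)) +
     2^-1 *: ((2 * t) *: (y - unit_act act y b)).
    rewrite !scalerA mulrA divfK; last by rewrite gt_eqF// mulr_gt0.
    rewrite mulKf ?pnatr_eq0// (bilinDl bl) (bilinZl bl) opprD addrACA -scalerBr.
    by rewrite scalerDr scalerA mulrC.
  apply: dG.2 => //.
  rewrite normrM normfV (gtr0_norm (mulr_gt0 (ltr0n _ 2) k1)) [`|2^-1|]gtr0_norm ?invr_gt0//.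
  rewrite -[leRHS]half2. rewrite lerD2r invfM mulrCA ger_pMr ?invr_gt0// ler_pdivrMr// mul1r.
  by rewrite lerDl.
- move=> x /closureP cx t t0.
  have c1 : 0 < 1 + c by rewrite addr_gt0.
  (* The error [v = s - x] contributes [v - v b], which costs a factor [1 + c] because [b] lies in
     [c] times the unit ball; the 2 shares the disk with the term of [s]. *)
  pose M := 2 * (1 + c) * t; have M0 : 0 < M by rewrite !mulr_gt0.
  have [s Qs /= Gs] := cx _ (nbhs0_scale M G0).
  have [F [fF FI FG]] := Qs (2 * t) (mulr_gt0 (ltr0n _ 2) t0).
  exists F; split=> // b bU Fb; have g1 := FG b bU Fb.
  have [u Uu be] := bU; set v := s - x in Gs.
  have g3 := sG _ _ Gs (Ul _ Uu).
  have vb : unit_act act v b = c *: unit_act act v u by rewrite -be (bilinZr bl).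
  have xE : x = s - v by rewrite /v opprB addrC subrK.
  clearbody v.
  have -> : t *: (x - unit_act act x b) = 2^-1 *: ((2 * t) *: (s - unit_act act s b)) +
     (- 2^-1) *: ((1 + c)^-1 *: (M *: v) + (- (c / (1 + c))) *: unit_act act (M *: v) u).
    have e1 : (1 + c)^-1 * M = 2 * t by rewrite /M; field; rewrite gt_eqF.
    have e2 : - (c / (1 + c)) * M = 2 * t * - c by rewrite /M; field; rewrite gt_eqF.
    rewrite (bilinZl bl) scalerA mulKf ?pnatr_eq0// [_ *: (M *: v)]scalerA e1.
    rewrite [_ *: (M *: _)]scalerA e2 -[(2 * t * - c) *: _]scalerA -scalerDr [- c *: _]scaleNr -vb scalerA.
    rewrite mulNr mulKf ?pnatr_eq0// scaleNr -scalerBr; congr (_ *: _).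
    rewrite [in LHS]xE (bilinBl bl).
    by rewrite !opprB addrACA [RHS]addrACA [- v - _]addrC.
  apply: dG.2 => //.
    rewrite normrN gtr0_norm ?invr_gt0//.
    by rewrite half2.
  apply: dG.2 => //.
  rewrite normrN !gtr0_norm ?divr_gt0 ?invr_gt0//.
  have -> // : (1 + c)^-1 + c / (1 + c) = 1 by field; rewrite gt_eqF.
- move=> _ [y [i [Ii ->]]] t t0.
  have [s s0 sG'] := nbhs0_absorb y G0.
  (* Smallness is gained by enlarging the element to be approximated: [t *: (y i - y i b)] is
     [s *: y], a vector of [G], acted on by [(t / s) *: (i - i b)], an element of [U]. *)
  exists [set (t / s) *: i]; split=> //.
    by move=> _ ->; have [S0 SD] := subspaceP I; rewrite -[_ *: _]addr0; exact: SD.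
  move=> b bU /(_ _ erefl) h.
  have blm := unit_mul_bilin mul_alg.
  have Gy : G (s *: y) by apply: sG'; rewrite gtr0_norm.
  have := sG _ _ Gy (Ul _ h).
  rewrite (bilinZl blm) -scalerBr (bilinZl bl) (bilinZr bl) scalerA mulrC divfK ?gt_eqF//.
  by rewrite (bilinBr bl) (unit_act_mul hY).
Qed.

Lemma within_unit_ball (U : set A1) : nbhs (0 : A1) U ->
  within (subspace_set I) (nbhs (0 : A1)) (U `&` subspace_set I).
Proof. by move=> U0; apply: filterS U0 => a Ua Ia; split. Qed.

Lemma ideal_span_unit_act (Y : tvsType C) (act : Y -> A -> Y) (y : Y) i :
  subspace_set I i -> subspace_set (ideal_span I act) (unit_act act y i).
Proof. by move=> Ii; apply: closed_span_gen; exists y, i. Qed.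

Context (Y1 Y2 Y3 : tvsType C) (r1 : Y1 -> A -> Y1) (r2 : Y2 -> A -> Y2)
  (r3 : Y3 -> A -> Y3) (f : Y1 -> Y2) (g : Y2 -> Y3).
Hypotheses (h1 : right_frechet_module mul r1) (h2 : right_frechet_module mul r2)
  (h3 : right_frechet_module mul r3).
Hypotheses (hf : right_module_map r1 r2 f) (hg : right_module_map r2 r3 g).
Hypothesis (fg : short_exact f g).
Local Notation J1 := (subspace_set (ideal_span I r1)).
Local Notation J2 := (subspace_set (ideal_span I r2)).
Local Notation J3 := (subspace_set (ideal_span I r3)).

(** For [b] in [I] the vector [y b] already belongs to Y1 I, so it suffices that [y - y b] is small
    in [Y1]. Its image is small in [Y2], and [f] is open onto its closed range. *)
Lemma lbai_ideal_span_inj y : J2 (f y) -> J1 y.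
Proof.
have [fl fc fr] := hf; have [gl gc gr] := hg; have [fi fgE gs] := fg.
have [F1 _ _ _] := h1; have [F2 _ _ _] := h2; have [[hd3 _ _] _ _ _] := h3.
have fcl : closed (range f).
  rewrite fgE; apply: closed_comp; first by move=> x _; exact: gc.
  exact: (accessible_closed_set1 (hausdorff_accessible hd3)).
move=> J2y; apply: closed_spanP; apply/closureP => W W0.
have [W' [W'0 dW' W'W]] := nbhs0_disk W0.
have [V V0 VW] := open_mapping F1 F2 fl fc fcl W'0.
have [l [G [G0 sG GV]]] := stable_disk_sub D h2 V0.
have UI : unit_ball D l `&` subspace_set I `<=` subspace_set I by move=> ? [].
have Ul : unit_ball D l `&` subspace_set I `<=` unit_ball D l by move=> ? [].
have [c c0 hc] := lbai UI (within_unit_ball (unit_ball_nbhs D l)).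
have [b [Ib _ Gb]] := approximate_unit h2 G0 sG Ul UI c0 hc J2y ltr01.
exists (unit_act r1 y b); first exact: ideal_span_unit_act.
move: Gb; rewrite scale1r -(module_map_unit_act fl fr) => /GV Vb.
have fB u v : f (u - v) = f u - f v by rewrite addrC -scaleN1r fl scaleN1r addrC.
have [w W'w /fi we] : (f @` W') (f (y - unit_act r1 y b)).
  by apply: VW; [exists (y - unit_act r1 y b)|rewrite fB].
by apply: W'W; rewrite -opprB -we; exact: disk_opp.
Qed.

(** It suffices to find an element of cl(Y2 I) with the same image under [g] as [y]: the difference
    then comes from [Y1]. *)
Lemma lbai_ideal_span_lift y : J3 (g y) -> exists x, J2 (y - f x).
Proof.
have [fl fc fr] := hf; have [gl gc gr] := hg; have [fi fgE gs] := fg.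
have [F1 _ _ _] := h1; have [F2 _ _ _] := h2; have [F3 _ _ _] := h3.
have [hd3 _ _] := F3; have [_ _ c2] := F2.
suff hs : forall z, J3 (g z) -> exists2 s, J2 s & g (z - s) = 0.
  move=> /hs [s J2s gys].
  have : (g @^-1` [set 0]) (y - s) by [].
  rewrite -fgE => -[x _ fx]; exists x; rewrite fx opprB addrC subrK.
  exact: J2s.
have gcl : closed (range g) by rewrite gs; exact: closedT.
have [B bB] := frechet_base F2.
have stab n : exists lG : nat * set Y2, [/\ nbhs 0 lG.2, stable_disk D r2 lG.1 lG.2 & lG.2 `<=` B n.+2].
  by have [l [G [G0 sG GB]]] := stable_disk_sub D h2 (base_nbhs bB n.+2); exists (l, G).
have [lV VP] := choice stab; pose V n := (lV n).2; pose l n := (lV n).1.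
have V0 n : nbhs 0 (V n) by have [] := VP n.
have sV n : stable_disk D r2 (l n) (V n) by have [] := VP n.
have VB n : V n `<=` B n.+2 by have [] := VP n.
(* Two seminorms matter at stage [n]: that of [V n] controls the term [w_n b_n], and that of
   [V n.+1] controls the next remainder. *)
pose U n := (unit_ball D (l n) `&` unit_ball D (l n.+1)) `&` subspace_set I.
have UI n : U n `<=` subspace_set I by move=> ? [].
have U1 n : U n `<=` unit_ball D (l n) by move=> ? [[]].
have U2 n : U n `<=` unit_ball D (l n.+1) by move=> ? [[]].
have lb n : exists c : C, 0 < c /\ forall F : set A1, finite_set F -> F `<=` subspace_set I ->
    exists b, [set c *: u | u in U n] b /\ forall a, F a -> U n (a - unit_mul mul a b).
  have [c c0 hc] := lbai (UI n) (within_unit_ball (filterI (unit_ball_nbhs D (l n)) (unit_ball_nbhs D (l n.+1)))).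
  by exists c.
have [c cP] := choice lb.
have c0 n : 0 < c n by have [] := cP n.
have gV n : nbhs 0 (g @` V n) /\ stable_disk D r3 (l n) (g @` V n).
  split.
    have [W W0 WV] := open_mapping F2 F3 gl gc gcl (V0 n).
    by apply: filterS W0 => v Wv; apply: WV => //; rewrite gs.
  have [dV ssV] := sV n; split; first split.
  - by exists 0; [case: dV|exact: linear0E].
  - move=> a b _ _ ab [u Vu <-] [v Vv <-]; exists (a *: u + b *: v); first exact: dV.2.
    have := gl b v 0; rewrite addr0 (linear0E gl) addr0 => gb.
    by rewrite gl gb.
  - move=> _ a [u Vu <-] al; exists (unit_act r2 u a); first exact: ssV.
    exact: module_map_unit_act.
have gB u v : g (u - v) = g u - g v by rewrite addrC -scaleN1r gl scaleN1r addrC.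
have gZ k u : g (k *: u) = k *: g u by have := gl k u 0; rewrite addr0 (linear0E gl) addr0.
have step (a : nat * Y2) : exists bw : A1 * Y2, J3 (g a.2) ->
   [/\ subspace_set I bw.1, [set c a.1 *: u | u in U a.1] bw.1,
     g bw.2 = g a.2 - unit_act r3 (g a.2) bw.1 & V a.1.+1 ((c a.1.+1 + 1) *: bw.2)].
  case: a => n w /=; have [Jw|nJw] := pselect (J3 (g w)); last by exists (0, 0).
  have [g0 sg] := gV n.+1.
  (* The next vector must lie in [V n.+1] and stay there when multiplied by scalars up to [c n.+1],
     the size of the next [b]; [c n.+1 + 1] covers both. *)
  have t0 : 0 < c n.+1 + 1 by rewrite addr_gt0.
  have [b [Ib cb [v Vv ve]]] :=
    approximate_unit h3 g0 sg (@U2 n) (@UI n) (c0 n) (cP n).2 Jw t0.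
  exists (b, (c n.+1 + 1)^-1 *: v) => _; split=> //=.
    by rewrite gZ ve scalerA mulVf ?scale1r// gt_eqF.
  by rewrite scalerA mulfV ?scale1r// gt_eqF.
have [h hP] := choice step.
have J3D u v : J3 u -> J3 v -> J3 (u - v).
  have [_ SD] := subspaceP (ideal_span I r3).
  by move=> Ju Jv; rewrite addrC -scaleN1r; exact: SD.
(* Cohen factorization: with [e_n = g w_n] and [e_(n+1) = e_n - e_n b_n], the
   series of the [w_n b_n] converges and lifts [e_0]; the bound on [b_n] does not
   depend on how small [w_n] is chosen. *)
have small z : J3 (g z) -> V 0%N ((c 0%N + 1) *: z) -> exists2 s, J2 s & g (z - s) = 0.
  move=> Jz Vz.
  pose w := fix w n : Y2 := if n is m.+1 then (h (m, w m)).2 else z.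
  pose b n := (h (n, w n)).1.
  have Jw n : J3 (g (w n)).
    elim: n => [//|n IH] /=; have [Ib _ -> _] := hP (n, w n) IH.
    by apply: J3D => //; exact: ideal_span_unit_act.
  have Vw n : V n ((c n + 1) *: w n).
    by case: n => [//|n]; have [_ _ _] := hP (n, w n) (Jw n).
  have ge n : g (w n.+1) = g (w n) - unit_act r3 (g (w n)) (b n).
    by have [_ _ ->] := hP (n, w n) (Jw n).
  have Vw' n (k : C) : 0 <= k -> k <= c n + 1 -> V n (k *: w n).
    move=> k0 kc; have c1 : 0 < c n + 1 by rewrite addr_gt0.
    have -> : k *: w n = (k / (c n + 1)) *: ((c n + 1) *: w n).
      by rewrite scalerA divfK// gt_eqF.
    apply: disk_scale => //; first by have [] := sV n.
    by rewrite ger0_norm ?divr_ge0 ?(ltW c1)// ler_pdivrMr// mul1r.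
  pose x n := unit_act r2 (w n) (b n).
  have xB n : B n.+2 (x n).
    have [_ [u Uu bu] _ _] := hP (n, w n) (Jw n); apply: VB.
    rewrite /x /b -bu (bilinZr (unit_act_bilin h2)) -(bilinZl (unit_act_bilin h2)).
    apply: (sV n).2; last exact: U1.
    by apply: Vw'; rewrite ?lerDl ?ltW.
  have [s [sB ss]] := base_series c2 bB xB.
  have J2sum n : J2 (\sum_(k < n) x k).
    have [S0 SD] := subspaceP (ideal_span I r2).
    elim: n => [|n IH]; first by rewrite big_ord0.
    rewrite big_ord_recr /= addrC -[x n]scale1r; apply: SD => //.
    by apply: ideal_span_unit_act; have [] := hP (n, w n) (Jw n).
  have gsum n : g (z - \sum_(k < n) x k) = g (w n).
    elim: n => [|n IH]; first by rewrite big_ord0 subr0.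
    rewrite big_ord_recr /= opprD addrA gB IH ge; congr (_ - _).
    exact: module_map_unit_act.
  exists s.
    apply: closed_spanP => W /ss [N _ NW].
    by exists (\sum_(k < N) x k); split=> //; apply: NW => /=.
  apply: (hausdorff_tvsP Y3).1 => // W W0.
  have [n nW] := base_sub bB ((linear_continuousP gl).2 gc _ W0).
  have -> : z - s = (z - \sum_(k < n.+1) x k) - (s - \sum_(k < n.+1) x k).
    by rewrite opprB addrA subrK.
  rewrite gB gsum -gB; apply: nW; apply: (base_add bB).
    apply: (@base_le _ _ _ _ n.+3 bB); first by rewrite ltnS leqW// leqW.
    by apply: VB; rewrite -[w n.+1]scale1r; apply: Vw' => //; rewrite lerDr ltW.
  by apply: disk_opp; [exact: base_disk|exact: sB].
(* The claim is homogeneous in [z], so a general [z] is scaled down to the size that [small]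
   requires. *)
move=> z Jz; have [t t0 tV] := nbhs0_absorb z (V0 0%N).
have c1 : 0 < c 0%N + 1 by rewrite addr_gt0.
pose k := t / (c 0%N + 1); have k0 : 0 < k by rewrite divr_gt0.
have [|| s Js gs0] := small (k *: z).
- rewrite gZ; have [S0 SD] := subspaceP (ideal_span I r3).
  by rewrite -[_ *: _]addr0; exact: SD.
- rewrite scalerA mulrC divfK ?gt_eqF//; apply: tV.
  by rewrite gtr0_norm.
exists (k^-1 *: s).
  have [S0 SD] := subspaceP (ideal_span I r2).
  by rewrite -[_ *: _]addr0; exact: SD.
apply: (scalerI (lt0r_neq0 k0)); rewrite scaler0 -gZ scalerBr scalerA.
by rewrite mulfV ?scale1r// gt_eqF.
Qed.

End ApproximateIdentity.

(** * Duals of Banach modules *)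

Section Dual.
Context (R : realType).
Local Notation C := (R[i]).
Context (B : normedModType C).

(** Index 0 is the unit ball, so uniform convergence on these sets is the norm topology of the
    dual. *)
Definition norm_ball (n : nat) : set B := [set x | `|x| <= n.+1%:R].

Lemma norm_ball_dir i j : exists k, norm_ball i `<=` norm_ball k /\ norm_ball j `<=` norm_ball k.
Proof.
by exists (maxn i j); split=> x /le_trans; apply; rewrite ler_nat ltnS ?leq_maxl ?leq_maxr.
Qed.

Lemma dual_norm_unit_ball (f : B -> C^o) (r : C) : linear f -> 0 <= r ->
  (forall x, norm_ball 0 x -> `|f x| <= r) -> dual_norm_le f r.
Proof.
move=> fl r0 h; split=> // x; have [->|x0] := eqVneq x 0.
  by rewrite (linear0E fl) !normr0 mulr0.
have nx : 0 < `|x| by rewrite normr_gt0.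
have := h (`|x|^-1 *: x); rewrite /norm_ball /= normrZ normfV normr_id mulVf ?gt_eqF//.
move=> /(_ (lexx _)); have := fl `|x|^-1 x 0; rewrite !addr0 (linear0E fl) addr0 => ->.
by rewrite normrZ normfV normr_id ler_pdivrMl// mulrC.
Qed.

Lemma topological_dualP (f : B -> C^o) :
  topological_dual f <-> linear f /\ exists r, dual_norm_le f r.
Proof.
split=> [[fl fc]|[fl [r [r0 fr]]]]; split=> //.
  have : nbhs 0 [set x | `|f x| < 1].
    apply: ((linear_continuousP fl).2 fc [set z : C | `|z| < 1]).
    by exists 1 => //= z /=; rewrite sub0r normrN.
  rewrite -nbhs_ballE => -[e /= e0 eb].
  have e2 : 0 < e / 2 by rewrite divr_gt0.
  exists (e / 2)^-1; apply: dual_norm_unit_ball => //.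
    by rewrite invr_ge0 ltW.
  move=> x; rewrite /norm_ball /= => x1.
  have := eb ((e / 2) *: x); rewrite -ball_normE /= sub0r normrN normrZ gtr0_norm//.
  have -> : e / 2 * `|x| < e.
    apply: (@le_lt_trans _ _ (e / 2)); first by rewrite ger_pMr.
    by rewrite ltr_pdivrMr// ltr_pMr// ltr1n.
  have := fl (e / 2) x 0; rewrite !addr0 (linear0E fl) addr0 => -> /(_ isT).
  by rewrite normrZ gtr0_norm// -ltr_pdivlMl// mulr1 => /ltW.
apply/(linear_continuousP fl) => U [e /= e0 eU].
rewrite -nbhs_ballE; have r1 : 0 < r + 1 by rewrite ltr_wpDl.
exists (e / (r + 1)) => /=; first by rewrite divr_gt0.
move=> x; rewrite -ball_normE /= sub0r normrN => xe; apply: eU.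
rewrite /= sub0r normrN; apply: le_lt_trans (fr x) _.
apply: (@le_lt_trans _ _ ((r + 1) * `|x|)); first by rewrite ler_wpM2r// lerDl.
by rewrite mulrC -ltr_pdivlMr.
Qed.

Lemma dual_ball_bound (f : B -> C^o) r i x :
  dual_norm_le f r -> norm_ball i x -> `|f x| <= r * i.+1%:R.
Proof. by move=> [r0 fr] ix; apply: le_trans (fr x) _; rewrite ler_wpM2l. Qed.

Lemma dual_bounded (f : B -> C^o) : topological_dual f -> unif_bounded norm_ball f.
Proof.
move=> /topological_dualP [fl [r fr]] i; exists (r * i.+1%:R + 1).
  by rewrite ltr_wpDl// mulr_ge0//; case: fr.
move=> x ix; apply: le_trans (dual_ball_bound fr ix) _.
by rewrite lerDl.
Qed.

Lemma norm_ball_cover x : exists i, norm_ball i x.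
Proof.
have [n xn] := complex_arch `|x|; exists n.
by rewrite /norm_ball /= -normr_id.
Qed.

Lemma eps_eq0 (z : C) : (forall e : C, 0 < e -> `|z| <= e) -> z = 0.
Proof.
move=> h; apply/eqP/negPn/negP => z0; have nz : 0 < `|z| by rewrite normr_gt0.
have := h (`|z| / 2) (divr_gt0 nz (ltr0n _ 2)).
by rewrite ler_pdivlMr// ger_pMr// (ler_nat _ 2 1).
Qed.

(** Linearity survives because one ball contains all three points involved; boundedness on the unit
    ball then gives continuity. *)
Lemma dual_unif_closed (Z : set B) : unif_closed norm_ball
  [set f : B -> C^o | topological_dual f /\ forall x, Z x -> f x = 0].
Proof.
move=> f fb h.
have fx x (e : C) : 0 < e -> exists g : B -> C^o,
    [/\ topological_dual g, forall x, Z x -> g x = 0 & `|f x - g x| <= e].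
  move=> e0; have [i ix] := norm_ball_cover x.
  by have [g [gd gZ] fg] := h i e e0; exists g; split=> //; exact: fg.
have fl : linear f.
  move=> k x y; apply/eqP; rewrite -subr_eq0; apply/eqP/eps_eq0 => e e0.
  have [i ix] := norm_ball_cover x; have [j jy] := norm_ball_cover y.
  have [m mxy] := norm_ball_cover (k *: x + y).
  have [n1 [in1 jn1]] := norm_ball_dir i j; have [n [n1n mn]] := norm_ball_dir n1 m.
  have k1 : 0 < `|k| + 2 by rewrite ltr_wpDl.
  (* The three approximation errors enter with weights 1, [|k|] and 1. *)
  have [g [[gl _] _] fg] := h n (e / (`|k| + 2)) (divr_gt0 e0 k1).
  have g1 := fg _ (mn _ mxy); have g2 := fg _ (n1n _ (in1 _ ix)); have g3 := fg _ (n1n _ (jn1 _ jy)).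
  have -> : f (k *: x + y) - (k *: f x + f y) =
      (f (k *: x + y) - g (k *: x + y)) - (k * (f x - g x) + (f y - g y)).
    rewrite gl; change (k *: f x) with (k * f x); change (k *: g x) with (k * g x).
    by ring.
  apply: le_trans (ler_normB _ _) _.
  apply: (@le_trans _ _ (e / (`|k| + 2) + (`|k| * (e / (`|k| + 2)) + e / (`|k| + 2)))).
    apply: lerD => //; apply: le_trans (ler_normD _ _) _; rewrite normrM.
    by apply: lerD => //; rewrite ler_wpM2l.
  have -> // : e / (`|k| + 2) + (`|k| * (e / (`|k| + 2)) + e / (`|k| + 2)) = e.
  by field; rewrite gt_eqF.
split.
  apply/topological_dualP; split=> //; have [r r0 fr] := fb 0%N.
  by exists r; apply: dual_norm_unit_ball => //; exact: ltW.
move=> x Zx; apply: eps_eq0 => e e0; have [g [gd gZ]] := fx x e e0.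
by rewrite gZ// subr0.
Qed.

Lemma annihilatorP (Z : set B) : is_subspace (annihilator Z).
Proof.
split.
  split; last by [].
  apply/topological_dualP; split; first by move=> k x y; rewrite /= scaler0 addr0.
  by exists 0; split=> // x; rewrite mul0r normr0.
move=> k f g [/topological_dualP [fl [r [r0 fr]]] fZ] [/topological_dualP [gl [s [s0 gs]]] gZ].
split; last first.
  move=> x Zx; change (k * f x + g x = 0); by rewrite fZ// gZ// mulr0 addr0.
apply/topological_dualP; split.
  move=> c x y; change (k * f (c *: x + y) + g (c *: x + y) = c * (k * f x + g x) + (k * f y + g y)).
  rewrite fl gl; change (c *: f x) with (c * f x); change (c *: g x) with (c * g x).
  by ring.
exists (`|k| * r + s); split; first by rewrite addr_ge0// mulr_ge0.
move=> x; change (`|k * f x + g x| <= (`|k| * r + s) * `|x|).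
apply: le_trans (ler_normD _ _) _; rewrite mulrDl normrM -mulrA.
by apply: lerD => //; rewrite ler_wpM2l.
Qed.

Definition annihilator_data (Z : set B) : unif_data C :=
  @UnifData C B nat norm_ball 0%N norm_ball_dir (LinearSubspace (annihilatorP Z))
    (fun f h => dual_bounded h.1).

(** One construction for two modules: the ideal closure gives J^perp, and the empty set gives the
    whole dual of [B]. *)
Definition annihilator_space (Z : set B) := unif_space (annihilator_data Z).

Section Annihilator.
Context (Z : set B).
Local Notation Y := (annihilator_space Z).

Lemma annihilator_val (f : Y) : annihilator Z (uc_val f).
Proof. exact: (uc_val_space f). Qed.

Lemma annihilator_linear (f : Y) : linear (uc_val f).
Proof. by have [[]] := annihilator_val f. Qed.

Lemma annihilator_nbhs0 (U : set Y) : nbhs 0 U <->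
  exists2 r : C, 0 < r & forall f : Y, dual_norm_le (uc_val f) r -> U f.
Proof.
split=> [/uc_nbhs0P [i [r r0 rU]]|[r r0 rU]].
  exists (r / i.+1%:R); first by rewrite divr_gt0.
  move=> f fr; apply: rU => x ix; have := dual_ball_bound fr ix.
  by rewrite divfK.
apply/uc_nbhs0P; exists 0%N, r => // f fr; apply: rU.
by apply: dual_norm_unit_ball => //; [exact: annihilator_linear|exact: ltW].
Qed.

Lemma annihilator_frechet : frechet Y.
Proof.
split.
- exact: (uc_hausdorff (d := annihilator_data Z) norm_ball_cover).
- exists (fun n => [set f : Y | dual_norm_le (uc_val f) n.+1%:R^-1]); split.
    by move=> n; apply/annihilator_nbhs0; exists (n.+1%:R^-1); rewrite ?invr_gt0.
  move=> U /annihilator_nbhs0 [r r0 rU]; have [n rn] := complex_arch r^-1.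
  exists n => f [_ fn]; apply: rU; split=> [|x]; first exact: ltW.
  apply: le_trans (fn x) _; apply: ler_wpM2r => //.
  have -> : r = r^-1^-1 by rewrite invrK.
  rewrite lef_pV2 ?posrE ?invr_gt0//; apply: le_trans rn.
  by rewrite ger0_norm// invr_ge0 ltW.
- apply: (uc_complete (d := annihilator_data Z)).
  + exact: complex_complete.
  + exact: norm_ball_cover.
  + exact: dual_unif_closed.
Qed.

Lemma annihilator_eval_continuous (x : B) : continuous (fun f : Y => uc_val f x).
Proof.
have l : linear (fun f : Y => uc_val f x) by [].
apply/(linear_continuousP l) => U [e /= e0 eU].
have x1 : 0 < `|x| + 1 by rewrite ltr_wpDl.
apply/annihilator_nbhs0; exists (e / 2 / (`|x| + 1)); first by rewrite !divr_gt0.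
move=> f [_ fx]; apply: eU; rewrite /= sub0r normrN; apply: le_lt_trans (fx x) _.
apply: (@le_lt_trans _ _ (e / 2 / (`|x| + 1) * (`|x| + 1))).
  by rewrite ler_wpM2l ?lerDl// ltW// !divr_gt0.
by rewrite divfK ?gt_eqF// ltr_pdivrMr// ltr_pMr// ltr1n.
Qed.

Context (A : tvsType C) (mul : A -> A -> A) (T : A -> B -> B) (p : A -> C) (M : C).
Hypotheses (Tbl : bilin T) (TM : forall a x, `|T a x| <= M * p a * `|x|)
  (Tmul : forall a b x, T (mul a b) x = T a (T b x))
  (TZ : forall a x, Z x -> Z (T a x)) (M0 : 0 < M) (p0 : forall a, 0 <= p a)
  (p_nbhs : forall e : C, 0 < e -> nbhs 0 [set a | p a < e]).

Lemma transpose_annihilator (f : Y) a : annihilator Z (uc_val f \o T a).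
Proof.
have [/topological_dualP [fl [r [r0 fr]]] fZ] := annihilator_val f.
split; last by move=> x Zx /=; apply: fZ; exact: TZ.
apply/topological_dualP; split; first by move=> k x y /=; rewrite Tbl.1 fl.
exists (r * (M * p a)); split; first by rewrite !mulr_ge0// ltW.
move=> x /=; apply: le_trans (fr _) _; rewrite -mulrA.
by apply: ler_wpM2l => //; exact: TM.
Qed.

(** Transposition reverses the order of products, so the left action [T] becomes a right action on
    functionals. *)
Definition transpose_act (f : Y) a : Y :=
  uc_mk (d := annihilator_data Z) (transpose_annihilator f a).

Lemma transpose_module : right_frechet_module mul transpose_act.
Proof.
have bl : bilin transpose_act.
  split=> [f k a b|a k f g]; apply: uc_ext; apply/funext => x //=.
  by rewrite Tbl.2 annihilator_linear.
split=> //; first exact: annihilator_frechet.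
- apply/(bilin_continuousP bl) => W /annihilator_nbhs0 [r r0 rW].
  exists [set f : Y | dual_norm_le (uc_val f) r], [set a | p a < M^-1]; split.
  + by apply/annihilator_nbhs0; exists r.
  + by apply: p_nbhs; rewrite invr_gt0.
  move=> f a [_ fr] pa; apply: rW; split; first exact: ltW.
  move=> x /=; apply: le_trans (fr _) _; apply: ler_wpM2l; first exact: ltW.
  apply: le_trans (TM a x) _; apply: ler_piMl => //.
  by rewrite mulrC -ler_pdivlMr// mul1r ltW.
- move=> f a b; apply: uc_ext; apply/funext => x /=.
  by rewrite Tmul.
Qed.

End Annihilator.

End Dual.

(** * Flatness and approximate identities *)

Section QuotientModule.
Context (K : numFieldType) (A : tvsType K) (mul : A -> A -> A).
Context (Y : tvsType K) (act : Y -> A -> Y) (S : linear_subspace Y).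
Hypotheses (hY : right_frechet_module mul act) (cS : closed (subspace_set S)).
Hypothesis actS : forall y a, subspace_set S y -> subspace_set S (act y a).

Definition quot_ract (q : tvs_quot S) (a : A) : tvs_quot S := quot_pi S (act (repr q) a).

Lemma quot_ractE y a : quot_ract (quot_pi S y) a = quot_pi S (act y a).
Proof.
have [_ bl _ _] := hY; apply/quot_piP; rewrite -(bilinBl bl); apply: actS.
by apply/quot_piP; exact: (@reprK _ (Quotient.quot (subspace_pred S))).
Qed.

Lemma quot_right_module : right_frechet_module mul quot_ract.
Proof.
have [fY bl cact mA] := hY.
have qbl : bilin quot_ract.
  split=> [q k a b|a k p q].
    have [y <-] := quot_pi_repr q.
    by rewrite !quot_ractE bl.1 quot_piD quot_piZ.
  have [x <-] := quot_pi_repr p; have [y <-] := quot_pi_repr q.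
  by rewrite -quot_piZ -quot_piD !quot_ractE bl.2 quot_piD quot_piZ.
split=> //; first exact: frechet_quot.
- apply/(bilin_continuousP qbl) => W /quot_nbhs0P [V V0 VW].
  have [U [U' [U0 U'0 UU']]] := (bilin_continuousP bl).2 cact _ V0.
  exists (quot_pi S @` U), U'; split=> //; first by apply/quot_nbhs0P; exists U.
  move=> _ a [y Uy <-] U'a; rewrite quot_ractE; apply: VW.
  by exists (act y a) => //; exact: UU'.
- move=> q a b; have [y <-] := quot_pi_repr q.
  by rewrite !quot_ractE mA.
Qed.

Lemma quot_pi_module_map : right_module_map act quot_ract (quot_pi S).
Proof.
split; first exact: quot_pi_linear.
  exact: quot_pi_continuous.
by move=> y a; rewrite quot_ractE.
Qed.

End QuotientModule.

Lemma module_map_ideal_span (R : realType) (A : tvsType R[i])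
    (I : linear_subspace (A * R[i]^o)%type) (Y Y' : tvsType R[i])
    (r : Y -> A -> Y) (r' : Y' -> A -> Y') (f : Y -> Y') y :
  right_module_map r r' f -> subspace_set (ideal_span I r) y ->
  subspace_set (ideal_span I r') (f y).
Proof.
move=> [fl fc fr]; have [S0 SD] := subspaceP (ideal_span I r').
move: y; apply: closed_span_min.
- split; first by rewrite /= (linear0E fl).
  by move=> k x y /= h1 h2; rewrite fl; exact: SD.
- by apply: closed_comp; [move=> x _; exact: fc|exact: closed_spanP].
- move=> _ [y [i [Ii ->]]] /=; rewrite (module_map_unit_act fl fr).
  exact: ideal_span_unit_act.
Qed.

(** * The unitization of A_l as a left module over A *)

Section BanachUnitization.
Context (R : realType).
Local Notation C := (R[i]).
Context (A : tvsType C) (mul : A -> A -> A) (I : linear_subspace (A * C^o)%type).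
Context (D : arens_michael_decomposition mul) (l : nat).
Local Notation A1 := (A * C^o)%type.
Local Notation B := (am_alg D l * C^o)%type.
Local Notation bmul := (unit_mul (@ba_mul C (am_alg D l))).
Local Notation sigma := (unit_map (am_map D l)).
Hypothesis mul_alg : is_alg mul.
Hypotheses (I_ideal : left_ideal (unit_mul mul) (subspace_set I)).

Lemma bmul_bilin : bilin bmul.
Proof. exact: (unit_mul_bilin (ba_alg (am_alg D l))). Qed.

Lemma sigma_linear (k : C) (x y : A1) : sigma (k *: x + y) = k *: sigma x + sigma y.
Proof. by congr (_, _) => /=; rewrite am_map_linear. Qed.

Lemma sigma0 : sigma 0 = 0.
Proof. by congr (_, _); exact: (linear0E (@am_map_linear _ _ _ D l)). Qed.

Lemma sigmaZ (k : C) (x : A1) : sigma (k *: x) = k *: sigma x.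
Proof. by have := sigma_linear k x 0; rewrite !addr0 sigma0 addr0. Qed.

Lemma sigma_mul (x y : A1) : sigma (unit_mul mul x y) = bmul (sigma x) (sigma y).
Proof.
have fl := am_map_linear D l; congr (_, _) => /=.
by rewrite addrC fl addrC; congr (_ + _); rewrite addrC fl am_map_mul addrC.
Qed.

Definition left_mult (a : A) (x : B) : B := bmul (am_map D l a, 0) x.

Lemma left_mult_bilin : bilin left_mult.
Proof.
split=> [a k x y|x k a b]; rewrite /left_mult; first exact: bmul_bilin.1.
rewrite -bmul_bilin.2; congr (bmul _ x); congr (_, _) => /=.
  exact: am_map_linear.
by rewrite scaler0 addr0.
Qed.

Lemma prod_norm_le (x : B) (r : C) : `|x.1| <= r -> `|x.2| <= r -> `|x| <= r.
Proof. by rewrite prod_normE /Num.max; case: ifP. Qed.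

Lemma fst_norm_le (x : B) : `|x.1| <= `|x|.
Proof. by rewrite prod_normE /Num.max; case: ifP => [/ltW//|_]; exact: lexx. Qed.

Lemma snd_norm_le (x : B) : `|x.2| <= `|x|.
Proof.
rewrite prod_normE /Num.max; case: ifP => // /negbT.
by rewrite -real_leNgt ?normr_real.
Qed.

(** The factor 2 is due to the maximum norm on [B]: both components of [x] contribute to the first
    component of the product. *)
Lemma left_mult_norm a (x : B) : `|left_mult a x| <= 2 * am_norm D l a * `|x|.
Proof.
rewrite -(am_map_norm D l a); apply: prod_norm_le => /=; last first.
  by rewrite mul0r normr0 !mulr_ge0.
rewrite scale0r addr0; apply: le_trans (ler_normD _ _) _.
have -> : 2 * `|am_map D l a| * `|x| = `|am_map D l a| * `|x| + `|x| * `|am_map D l a| by ring.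
apply: lerD.
  apply: le_trans (ba_submul _ _) _; apply: ler_wpM2l => //; exact: fst_norm_le.
rewrite normrZ; apply: ler_wpM2r => //; exact: snd_norm_le.
Qed.

Lemma left_mult_mul a b (x : B) : left_mult (mul a b) x = left_mult a (left_mult b x).
Proof.
rewrite /left_mult (unit_mulA (ba_alg (am_alg D l))); congr (bmul _ x).
by congr (_, _) => /=; rewrite ?mulr0// am_map_mul !scale0r !addr0.
Qed.

Lemma left_mult_sigma a (x : A1) : left_mult a (sigma x) = sigma (unit_mul mul (a, 0) x).
Proof. by rewrite sigma_mul. Qed.

Lemma left_mult_continuous a : continuous (left_mult a).
Proof.
have ll : linear (left_mult a) by exact: left_mult_bilin.1.
apply/(linear_continuousP ll) => U; rewrite -!nbhs_ballE => -[e /= e0 eU].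
have m0 : 0 < 2 * am_norm D l a + 1 by rewrite ltr_wpDl// mulr_ge0// am_norm_ge0.
exists (e / (2 * am_norm D l a + 1)) => /=; first by rewrite divr_gt0.
move=> x; rewrite -ball_normE /= sub0r normrN => xe; apply: eU.
rewrite -ball_normE /= sub0r normrN; apply: le_lt_trans (left_mult_norm a x) _.
apply: (@le_lt_trans _ _ ((2 * am_norm D l a + 1) * `|x|)).
  by rewrite ler_wpM2r// lerDl.
by rewrite mulrC -ltr_pdivlMr.
Qed.

Definition ideal_closure : set B := closure (sigma @` subspace_set I).

Lemma sigma_ideal_closure i : subspace_set I i -> ideal_closure (sigma i).
Proof. by move=> Ii; apply: subset_closure; exists i. Qed.

Lemma left_mult_ideal_closure a x : ideal_closure x -> ideal_closure (left_mult a x).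
Proof.
move=> hx V /left_mult_continuous /hx [_ [[i Ii <-] Vy]].
exists (left_mult a (sigma i)); split=> //; exists (unit_mul mul (a, 0) i).
  exact: I_ideal.2.
by rewrite left_mult_sigma.
Qed.

Lemma annihilator_ideal_closure (f : B -> C^o) : topological_dual f ->
  (forall i, subspace_set I i -> f (sigma i) = 0) -> annihilator ideal_closure f.
Proof.
move=> fd fI; split=> // x hx; apply: eps_eq0 => e e0.
have [fl fc] := fd.
have /hx [_ [[i Ii <-] /=]] : nbhs x [set y | `|f x - f y| <= e].
  apply: (fc x [set z | `|f x - z| <= e]); exists e => // z /= /ltW.
  exact.
by rewrite fI// subr0.
Qed.

End BanachUnitization.

Arguments left_mult {R A mul} D l.
Arguments left_mult_bilin {R A mul} D l.
Arguments left_mult_norm {R A mul} D l.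
Arguments bmul_bilin {R A mul} D l.

(** * The test sequence of J^perp in the dual, and separation *)

Section FlatImpliesIdentity.
Context (R : realType).
Local Notation C := (R[i]).
Context (A : tvsType C) (mul : A -> A -> A) (I : linear_subspace (A * C^o)%type).
Context (D : arens_michael_decomposition mul) (l : nat).
Local Notation A1 := (A * C^o)%type.
Local Notation B := (am_alg D l * C^o)%type.
Local Notation bmul := (unit_mul (@ba_mul C (am_alg D l))).
Local Notation sigma := (unit_map (am_map D l)).
Local Notation J := (@ideal_closure R A mul I D l).
Hypothesis mul_alg : is_alg mul.
Hypotheses (I_ideal : left_ideal (unit_mul mul) (subspace_set I)).
Hypothesis J_compl : @weakly_complemented C B J.
Hypothesis X_flat : flat mul (quot_act mul (I := I)).

Let T := left_mult D l.

Local Notation Y1 := (annihilator_space J).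
Local Notation Y2 := (annihilator_space (@set0 B)).

Let two0 : 0 < 2 :> C. Proof. by []. Qed.
Let TZ0 a x : (@set0 B) x -> (@set0 B) (T a x). Proof. by []. Qed.
Let TZ1 a x : J x -> J (T a x). Proof. exact: left_mult_ideal_closure. Qed.

Definition dual_act : Y2 -> A -> Y2 :=
  transpose_act (left_mult_bilin D l) (left_mult_norm D l) TZ0 two0 (am_norm_ge0 D l).
Definition ann_act : Y1 -> A -> Y1 :=
  transpose_act (left_mult_bilin D l) (left_mult_norm D l) TZ1 two0 (am_norm_ge0 D l).

Lemma dual_module : right_frechet_module mul dual_act.
Proof.
apply: transpose_module; [exact: left_mult_mul|exact: am_nbhs].
Qed.

Lemma ann_module : right_frechet_module mul ann_act.
Proof.
apply: transpose_module; [exact: left_mult_mul|exact: am_nbhs].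
Qed.

Lemma dual_mem (f : B -> C^o) : topological_dual f -> annihilator (@set0 B) f.
Proof. by move=> fd; split. Qed.

Definition dual_mk f (fd : topological_dual f) : Y2 :=
  uc_mk (d := annihilator_data (@set0 B)) (dual_mem fd).

Lemma dual_val (f : Y2) : topological_dual (uc_val f).
Proof. by have [] := annihilator_val f. Qed.

Definition ann_incl (f : Y1) : Y2 := dual_mk (annihilator_val f).1.

Definition ann_mk (f : B -> C^o) (fJ : annihilator J f) : Y1 :=
  uc_mk (d := annihilator_data J) fJ.

Lemma ann_incl_linear : linear ann_incl.
Proof. by move=> k f g; apply: uc_ext. Qed.

Lemma ann_incl_module_map : right_module_map ann_act dual_act ann_incl.
Proof.
split.
- exact: ann_incl_linear.
- apply/(linear_continuousP ann_incl_linear) => U /annihilator_nbhs0 [r r0 rU].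
  by apply/annihilator_nbhs0; exists r => // f fr; exact: rU.
- by move=> f a; apply: uc_ext.
Qed.

Lemma ann_subspaceP : is_subspace [set f : Y2 | annihilator J (uc_val f)].
Proof.
have [A0 AD] := annihilatorP J; split; first exact: A0.
by move=> k f g; exact: AD.
Qed.

Definition ann_subspace : linear_subspace Y2 := LinearSubspace ann_subspaceP.

Lemma ann_subspace_closed : closed (subspace_set ann_subspace).
Proof.
move=> f /closureP cf; split; first exact: dual_val.
move=> x Jx; apply: eps_eq0 => e e0.
have l1 : linear (fun f : Y2 => uc_val f x) by [].
have h : nbhs (0 : Y2) [set h : Y2 | `|uc_val h x| <= e].
  apply: ((linear_continuousP l1).2 (@annihilator_eval_continuous _ _ _ x) [set z | `|z| <= e]).
  by exists e => // z /=; rewrite sub0r normrN => /ltW.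
have [s [_ sJ] sf] := cf _ h.
have : `|uc_val s x - uc_val f x| <= e by exact: sf.
by rewrite sJ// sub0r normrN.
Qed.

Lemma ann_subspace_act (f : Y2) a :
  subspace_set ann_subspace f -> subspace_set ann_subspace (dual_act f a).
Proof.
move=> [fd fJ]; split; first exact: (dual_val (dual_act f a)).
by move=> x Jx; apply: fJ; exact: TZ1.
Qed.

Local Notation Y3 := (tvs_quot ann_subspace).
Definition coann_act : Y3 -> A -> Y3 := quot_ract dual_act (S := ann_subspace).

Lemma coann_module : right_frechet_module mul coann_act.
Proof.
apply: quot_right_module; [exact: dual_module|exact: ann_subspace_closed|].
exact: ann_subspace_act.
Qed.

Lemma coann_module_map : right_module_map dual_act coann_act (quot_pi ann_subspace).
Proof. by apply: (quot_pi_module_map dual_module); exact: ann_subspace_act. Qed.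

Lemma ann_exact : short_exact ann_incl (quot_pi ann_subspace).
Proof.
split.
- by move=> f g e; apply: uc_ext; have := congr1 (@uc_val _ _) e.
- apply/seteqP; split=> [_ [f _ <-]|f /quot_pi0P fJ].
    by apply/quot_pi0P; exact: annihilator_val.
  by exists (ann_mk fJ) => //; apply: uc_ext.
- by apply/seteqP; split=> // q _; have [f <-] := quot_pi_repr q; exists f.
Qed.

(** The projection [P] is the retraction [r]; the map [f - P f] vanishes on J^perp and so descends
    to the quotient as the section [s]. *)
Lemma ann_split : exists (r : Y2 -> Y1) (s : Y3 -> Y2),
  [/\ linear r /\ continuous r, linear s /\ continuous s, cancel ann_incl r,
      cancel s (quot_pi ann_subspace) & forall y, ann_incl (r y) + s (quot_pi ann_subspace y) = y].
Proof.
have [P [PJ Pid Plin [M PM]]] := J_compl.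
pose r (f : Y2) : Y1 := ann_mk (PJ _ (dual_val f)).
have rl : linear r.
  by move=> k f g; apply: uc_ext; rewrite /= -Plin; [|exact: dual_val|exact: dual_val].
have rc : continuous r.
  apply/(linear_continuousP rl) => U /annihilator_nbhs0 [e e0 eU].
  (* [M] is given only as a scalar, so [|M| + 1] serves as a positive bound. *)
  have M1 : 0 < `|M| + 1 by rewrite ltr_wpDl.
  apply/annihilator_nbhs0; exists (e / (`|M| + 1)); first by rewrite divr_gt0.
  move=> f fe; apply: eU; have [m0 h] := PM _ _ (dual_val f) fe.
  split; first exact: ltW.
  move=> x; apply: le_trans (h x) _; apply: ler_wpM2r => //.
  rewrite -(ger0_norm m0) normrM (gtr0_norm (divr_gt0 e0 M1)).
  by rewrite mulrCA ger_pMr// ler_pdivrMr// mul1r lerDl.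
have rK : cancel ann_incl r.
  by move=> f; apply: uc_ext => /=; apply: Pid; exact: annihilator_val.
pose q (f : Y2) : Y2 := f - ann_incl (r f).
have ql : linear q.
  move=> k f g; rewrite /q rl ann_incl_linear scalerBr opprD.
  by rewrite addrACA.
have qc : continuous q.
  have [il ic _] := ann_incl_module_map.
  apply/(linear_continuousP ql) => U U0; have [V V0 VU] := nbhs0_add U0.
  have [W [W0 dW WV]] := nbhs0_disk V0.
  have rW := (linear_continuousP rl).2 rc _ ((linear_continuousP il).2 ic _ W0).
  apply: filterS (filterI W0 rW) => f [Wf Wr]; apply: VU; apply: WV => //.
  exact: disk_opp.
have qS f : subspace_set ann_subspace f -> q f = 0.
  move=> fJ; have -> : f = ann_incl (ann_mk fJ) by apply: uc_ext.
  by rewrite /q rK subrr.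
have [s [sl sc sE]] := quot_lift ql qc qS.
exists r, s; split=> //.
- move=> t; have [f <-] := quot_pi_repr t; rewrite sE /q quot_piB.
  have -> : quot_pi ann_subspace (ann_incl (r f)) = 0 by apply/quot_pi0P; exact: annihilator_val.
  by rewrite subr0.
- by move=> f; rewrite sE /q addrC subrK.
Qed.

Local Notation J1 := (subspace_set (ideal_span I ann_act)).
Local Notation J2 := (subspace_set (ideal_span I dual_act)).

Lemma flat_exact : (forall f, J2 (ann_incl f) -> J1 f) /\
  (forall f, subspace_set (ideal_span I coann_act) (quot_pi ann_subspace f) ->
     exists g, J2 (f - ann_incl g)).
Proof.
have [_ fl] := X_flat.
apply/(ideal_span_exactP mul_alg I_ideal ann_module dual_module coann_module
  ann_incl_module_map coann_module_map ann_exact).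
exact: (fl _ _ _ _ _ _ _ _ ann_module dual_module coann_module ann_incl_module_map
  coann_module_map ann_exact ann_split).
Qed.

Local Notation one := ((0, 1) : B).

Lemma bmul1 (x : B) : bmul x one = x.
Proof.
have [bl _] := ba_alg (am_alg D l); case: x => a k; congr (_, _) => /=.
  by rewrite (bilin0r bl) scaler0 !add0r scale1r.
exact: mulr1.
Qed.

Lemma unit_dual_act (f : Y2) (i : A1) (x : B) :
  uc_val (unit_act dual_act f i) x = uc_val f (bmul (sigma i) x).
Proof.
have fl := annihilator_linear f; case: i => a k; rewrite /unit_act /=.
have -> : bmul (am_map D l a, k) x = k *: x + T a x.
  rewrite /T /left_mult; have b1 := bmul_bilin D l; case: x => y m.
  congr (_, _) => /=; first by rewrite scale0r addr0 addrAC addrC.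
  by rewrite mul0r addr0.
by rewrite fl addrC.
Qed.

Lemma unit_ann_act (f : Y1) (i : A1) (x : B) :
  uc_val (unit_act ann_act f i) x = uc_val f (bmul (sigma i) x).
Proof.
have [il _ ia] := ann_incl_module_map.
rewrite -[RHS]/(uc_val (ann_incl f) (bmul (sigma i) x)) -unit_dual_act.
by rewrite -(module_map_unit_act il ia).
Qed.

(** On a generator, the value of [g i] at 1 is [g (sigma i)], which is 0 because [g] annihilates
    [J]; evaluation at 1 is continuous. *)
Lemma ann_ideal_span_one (f : Y1) : J1 f -> uc_val f one = 0.
Proof.
have z0 : linear (fun _ : Y1 => 0 : C^o) by move=> k u v /=; rewrite scaler0 addr0.
have hC : hausdorff_space C^o by have [] := frechet_complex R.
have el : linear (fun f : Y1 => uc_val f one) by [].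
apply: (eq_on_closed_span hC el (annihilator_eval_continuous (x := one)) z0).
  by move=> x U U0; apply: (@filterE _ (nbhs x)) => y; exact: nbhs_singleton U0.
move=> _ [g [i [Ii ->]]]; rewrite unit_ann_act bmul1.
by have [_ gJ] := annihilator_val g; apply: gJ; exact: sigma_ideal_closure.
Qed.

(* Open mapping for the injection [Y1 / cl(Y1 I) -> Y2 / cl(Y2 I)], which has closed
   range by exactness. *)
Lemma ann_eval_bound : exists2 d : C, 0 < d & forall (f : Y1) (g : Y2),
  dual_norm_le (uc_val g) d -> J2 (ann_incl f + g) -> `|uc_val f one| <= 1.
Proof.
have [H1 H2] := flat_exact.
pose S1 := ideal_span I ann_act; pose S2 := ideal_span I dual_act.
pose S3 := ideal_span I coann_act; pose q := quot_pi ann_subspace.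
have [il ic ia] := ann_incl_module_map; have [ql qc qa] := coann_module_map.
have [fY1 _ _ _] := ann_module; have [fY2 _ _ _] := dual_module.
have [fY3 _ _ _] := coann_module.
have fQ1 : frechet (tvs_quot S1) by apply: frechet_quot => //; exact: closed_spanP.
have fQ2 : frechet (tvs_quot S2) by apply: frechet_quot => //; exact: closed_spanP.
have hQ3 : hausdorff_space (tvs_quot S3) by apply: quot_hausdorff; exact: closed_spanP.
have [F [Fl Fc FE]] : exists F : tvs_quot S1 -> tvs_quot S2,
    [/\ linear F, continuous F & forall f, F (quot_pi S1 f) = quot_pi S2 (ann_incl f)].
  apply: quot_lift.
  - by move=> k f g; rewrite il quot_pi_linear.
  - by move=> f; apply: continuous_comp; [exact: ic|exact: quot_pi_continuous].
  - by move=> f Sf; apply/quot_pi0P; exact: (module_map_ideal_span ann_incl_module_map).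
have [G [Gl Gc GE]] : exists G : tvs_quot S2 -> tvs_quot S3,
    [/\ linear G, continuous G & forall f, G (quot_pi S2 f) = quot_pi S3 (q f)].
  apply: quot_lift.
  - by move=> k f g; rewrite /q ql quot_pi_linear.
  - by move=> f; apply: continuous_comp; [exact: qc|exact: quot_pi_continuous].
  - by move=> f Sf; apply/quot_pi0P; exact: (module_map_ideal_span coann_module_map).
have Frange : range F = G @^-1` [set 0].
  apply/seteqP; split.
    move=> _ [t _ <-]; have [f <-] := quot_pi_repr t; rewrite /= FE GE.
    have -> : q (ann_incl f) = 0 by apply/quot_pi0P; exact: annihilator_val.
    exact: (linear0E (@quot_pi_linear _ _ S3)).
  move=> t; have [f <-] := quot_pi_repr t; rewrite /= GE => /quot_pi0P /H2 [g fg].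
  by exists (quot_pi S1 g) => //; rewrite FE; apply/esym/quot_piP.
have Fcl : closed (range F).
  rewrite Frange; apply: closed_comp; first by move=> x _; exact: Gc.
  exact: (accessible_closed_set1 (hausdorff_accessible hQ3)).
have U0 : nbhs 0 (quot_pi S1 @` [set f : Y1 | dual_norm_le (uc_val f) 1]).
  apply/quot_nbhs0P; exists [set f : Y1 | dual_norm_le (uc_val f) 1] => //.
  by apply/annihilator_nbhs0; exists 1.
have [V /quot_nbhs0P [W W0 WV] VU] := open_mapping fQ1 fQ2 Fl Fc Fcl U0.
have [d d0 dW] := (annihilator_nbhs0 W).1 W0; exists d => // f g gd fg.
have ng : dual_norm_le (uc_val (- g)) d.
  have [d0' gd'] := gd; split=> // x.
  by change (`|- uc_val g x| <= d * `|x|); rewrite normrN.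
have e : quot_pi S2 (- g) = F (quot_pi S1 f).
  rewrite FE; apply/quot_piP; have [_ SD] := subspaceP S2.
  have := SD (-1) _ 0 fg (subspaceP S2).1.
  by rewrite addr0 scaleN1r opprD addrC.
have [||_ [f' f'1 <-] e'] := VU (quot_pi S2 (- g)).
- by rewrite e; exists (quot_pi S1 f).
- by apply: WV; exists (- g) => //; exact: dW.
move: e'; rewrite e !FE => /quot_piP ff'.
(* By exactness [f'], of norm at most 1, differs from [f] by an element of cl(J^perp I), so the two
   agree at 1. *)
have /H1 /ann_ideal_span_one h : J2 (ann_incl (f' - f)).
  by have -> : ann_incl (f' - f) = ann_incl f' - ann_incl f by apply: uc_ext.
have -> : uc_val f one = uc_val f' one.
  by apply/eqP; rewrite eq_sym -subr_eq0; apply/eqP.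
have [_ /(_ one)] := f'1; rewrite mul1r => /le_trans; apply.
by apply: prod_norm_le => /=; rewrite ?normr0 ?normr1.
Qed.

(** If no [b] works, the point [(0, sigma a)] of [B] times [B^n] lies outside the disk [O] of
    attainable pairs. A separating functional [f] has modulus at least 1 there, while
    [ann_eval_bound] bounds it by 1/2. *)
Lemma flat_approximate_identity : exists2 c : C, 0 < c & forall (n : nat) (a : 'I_n -> A1) (e : C),
  (forall i, subspace_set I (a i)) -> 0 < e -> exists b, [/\ subspace_set I b,
    `|sigma b : B| <= c & forall i, `|sigma (a i) - sigma (unit_mul mul (a i) b) : B| <= e].
Proof.
have [d d0 hd] := ann_eval_bound.
have d1 : 0 < 1 + d by rewrite addr_gt0.
(* Chosen so that [1 / (c * d) + 1 / c] equals 1/2, strictly below the value 1 of the separation. *)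
pose c := 2 * (1 + d) / d; have c0 : 0 < c by rewrite divr_gt0// mulr_gt0.
exists c => // n a e aI e0.
pose E : lmodType C := (B * ('I_n -> B))%type.
(* [O] is a box of radii [c] and [e], enlarged by the linear subspace of all pairs formed by
   [- sigma b] and the family of the [sigma (a i b)], for [b] in [I]. *)
pose O : set E := [set v | exists b, [/\ subspace_set I b, `|v.1 + sigma b| <= c &
   forall i, `|v.2 i - sigma (unit_mul mul (a i) b)| <= e]].
suff : O (0, fun i => sigma (a i)).
  by move=> [b [Ib /= bc ba]]; exists b; split=> //; move: bc; rewrite add0r.
have [I0 ID] := subspaceP I.
have s0 : sigma 0 = 0 by exact: sigma0.
have sZ := sigmaZ D l.
have blm := unit_mul_bilin mul_alg.
have dO : disk O.
  split.
    exists 0; split=> //=; first by rewrite s0 addr0 normr0 ltW.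
    by move=> i; rewrite (bilin0r blm) s0 subr0 normr0 ltW.
  move=> k m v w km [b [Ib vb vi]] [b' [Ib' wb' wi]]; exists (k *: b + m *: b').
  have mb' : subspace_set I (m *: b') by rewrite -[_ *: _]addr0; exact: ID.
  split; first exact: ID.
    rewrite sigma_linear sZ /= addrACA -!scalerDr; apply: le_trans (ler_normD _ _) _.
    rewrite !normrZ; apply: (@le_trans _ _ (`|k| * c + `|m| * c)).
      by apply: lerD; apply: ler_wpM2l.
    by rewrite -mulrDl ler_piMl// ltW.
  move=> i; rewrite blm.1 (bilinZr blm) sigma_linear sZ.
  have -> : (k *: v + m *: w).2 i - (k *: sigma (unit_mul mul (a i) b) + m *: sigma (unit_mul mul (a i) b')) =
    k *: (v.2 i - sigma (unit_mul mul (a i) b)) + m *: (w.2 i - sigma (unit_mul mul (a i) b')).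
    by rewrite !scalerBr addrACA -opprD.
  apply: le_trans (ler_normD _ _) _.
  rewrite !normrZ; apply: (@le_trans _ _ (`|k| * e + `|m| * e)).
    by apply: lerD; apply: ler_wpM2l.
  by rewrite -mulrDl ler_piMl// ltW.
have O0 (v : E) : `|v.1| <= c -> (forall i, `|v.2 i| <= e) -> O v.
  move=> v1 v2; exists 0; split=> //; first by rewrite s0 addr0.
  by move=> i; rewrite (bilin0r blm) s0 subr0.
have absO (v : E) : exists2 t : C, 0 < t & O (t *: v).
  have [m [m0 mc me]] := min_pos c0 e0.
  have sum_ge0 : 0 <= \sum_i `|v.2 i| by apply: sumr_ge0.
  pose S := `|v.1| + \sum_i `|v.2 i| + 1.
  have S0 : 0 < S by rewrite ltr_wpDl// addr_ge0.
  have mS0 : 0 < m / S by rewrite divr_gt0.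
  have mS x : x <= S -> m / S * x <= m.
    by move=> xS; rewrite mulrAC ler_pdivrMr// ler_pM2l.
  exists (m / S) => //; apply: O0 => [|i] /=; rewrite normrZ (gtr0_norm mS0).
    by apply: le_trans mc; apply: mS; rewrite /S -addrA lerDl addr_ge0.
  apply: le_trans me; apply: mS; rewrite /S (bigD1 i)//= addrCA -addrA lerDl.
  by rewrite !addr_ge0// sumr_ge0.
apply: contrapT => nO; have [f [fl fO fz]] := hahn_banach_disk dO absO nO.
have fZ k v : f (k *: v) = k * f v by have := fl k v 0; rewrite addr0 (linear0E fl) addr0.
(* The components of [f]; the box inside [O] bounds [psi] by [1 / c] and each [fi i] by [1 / e]. *)
pose psi (x : B) : C^o := f (x, 0).
pose fi i (x : B) : C^o := f (0, fun j => if j == i then x else 0).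
have functional (h : B -> E) (r : C) : 0 < r -> linear h ->
    (forall x, `|x| <= r -> O (h x)) ->
    linear (f \o h) /\ dual_norm_le (f \o h : B -> C^o) r^-1.
  move=> r0 hl hO; have fhl : linear (f \o h : B -> C^o) by move=> k x y /=; rewrite hl fl.
  split=> //; apply: dual_norm_unit_ball => //; first by rewrite invr_ge0 ltW.
  move=> x x1; have /fO : O (h (r *: x)).
    by apply: hO; rewrite normrZ (gtr0_norm r0) ger_pMr.
  have := fhl r x 0; rewrite /= addr0 => ->; have -> : f (h 0) = 0 by exact: (linear0E fhl).
  by rewrite addr0 normrZ (gtr0_norm r0) -ler_pdivlMl// mulr1.
have [psil psic] : linear psi /\ dual_norm_le psi c^-1.
  apply: (functional (fun x => (x, 0))) => //.
    by move=> k x y; congr (_, _); rewrite /= ?scaler0 ?addr0.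
  by move=> x xc; apply: O0 => //= i; rewrite normr0 ltW.
have psid : topological_dual psi by apply/topological_dualP; split=> //; exists c^-1.
have fid i : topological_dual (fi i).
  apply/topological_dualP; have [h1 h2] : linear (fi i) /\ dual_norm_le (fi i) e^-1.
    apply: (functional (fun x => (0, fun j => if j == i then x else 0))) => //.
      move=> k x y; congr (_, _); first by rewrite /= ?scaler0 ?addr0.
      apply/funext => j; change ((if j == i then k *: x + y else 0) =
        k *: (if j == i then x else 0) + (if j == i then y else 0)).
      by case: ifP; rewrite // scaler0 addr0.
    move=> x xe; apply: O0 => /= [|j]; first by rewrite normr0 ltW.
    by case: ifP => // _; rewrite normr0 ltW.
  by split=> //; exists e^-1.
have LD : {morph (fun v : 'I_n -> B => f (0, v)) : u v / u + v >-> (u + v : C^o)}.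
  move=> u v; have := fl 1 (0, u) (0, v); rewrite !scale1r => <-.
  by congr f; congr (_, _); rewrite addr0.
have fsum (v : 'I_n -> B) : f (0, v) = \sum_i fi i (v i).
  have -> : v = \sum_i (fun j => if j == i then v i else 0).
    apply/funext => j; rewrite fct_sumE (bigD1 j)//= eqxx big1 ?addr0//.
    by move=> i; rewrite eq_sym => /negbTE ->.
  rewrite (big_morph _ LD (linear0E fl)); apply: eq_bigr => i _; congr f.
  congr (_, _); apply/funext => j; case: eqP => // _.
  rewrite fct_sumE (bigD1 i)//= eqxx big1 ?addr0//.
  by move=> m; rewrite eq_sym => /negbTE ->.
(* [G] lies in cl(B^* I), and its value at 1 is [f (0, sigma a)], the number to be bounded. *)
pose G : Y2 := \sum_i unit_act dual_act (dual_mk (fid i)) (a i).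
have GE x : uc_val G x = f (0, fun i => bmul (sigma (a i)) x).
  have ev : {morph (fun g : Y2 => uc_val g x) : u v / u + v >-> (u + v : C^o)} by [].
  rewrite fsum /G (big_morph _ ev (erefl _)); apply: eq_bigr => i _.
  exact: unit_dual_act.
have GJ : J2 G.
  have [S0 SD] := subspaceP (ideal_span I dual_act).
  rewrite /G; apply: (big_ind (fun g : Y2 => J2 g)) => //.
    by move=> u v Su Sv; rewrite -[u]scale1r; exact: SD.
  by move=> i _; apply: ideal_span_unit_act; exact: aI.
have Gpsi b : subspace_set I b -> uc_val G (sigma b) = psi (sigma b).
  move=> Ib; rewrite GE.
  set v := (fun i => _ : B).
  (* These vectors fill a line inside [O], with witness [k *: b]; since [f] is bounded on [O], it
     vanishes on the line. *)
  have h k : O (k *: (- sigma b, v)).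
    exists (k *: b); split; first by rewrite -[_ *: _]addr0; exact: ID.
      by rewrite sZ /= -scalerDr addNr scaler0 normr0 ltW.
    move=> i; rewrite (bilinZr blm) sZ sigma_mul.
    by change (`|k *: v i - k *: v i| <= e); rewrite subrr normr0 ltW.
  have : f (- sigma b, v) = 0.
    apply/eqP/negPn/negP => ne; have nf : 0 < `|f (- sigma b, v)| by rewrite normr_gt0.
    have := fO _ (h (2 / `|f (- sigma b, v)|)); rewrite fZ normrM gtr0_norm ?divr_gt0//.
    by rewrite divfK ?gt_eqF// (ler_nat _ 2 1).
  have -> : (- sigma b, v) = (-1) *: ((sigma b, 0) : E) + (0, v).
    by congr (_, _) => /=; rewrite ?scaler0 ?add0r// addr0 scaleN1r.
  by rewrite fl scaleN1r addrC => /eqP; rewrite subr_eq0 => /eqP.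
have phiJ : annihilator J (uc_val (G - dual_mk psid)).
  apply: annihilator_ideal_closure; first exact: dual_val.
  by move=> i Ii; rewrite uc_valB Gpsi//; exact: subrr.
(* Scaling by [c * d] raises the bound [1 / c] of [psi] to [d], the threshold of [ann_eval_bound];
   the sum of the scaled [phi] and [psi] is [k *: G]. *)
pose phi := ann_mk phiJ; pose k := c * d.
have k0 : 0 < k by rewrite mulr_gt0.
have kc : k / c = d by rewrite /k mulrC mulKf ?gt_eqF.
have psik : dual_norm_le (uc_val (k *: dual_mk psid)) d.
  split=> [|x]; first exact: ltW.
  change (`|k * psi x| <= d * `|x|); rewrite normrM (gtr0_norm k0).
  have [_ /(_ x) h] := psic; apply: (@le_trans _ _ (k * (c^-1 * `|x|))).
    by rewrite ler_wpM2l// ltW.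
  by rewrite mulrA kc.
have phik : J2 (ann_incl (k *: phi) + k *: dual_mk psid).
  have -> : ann_incl (k *: phi) + k *: dual_mk psid = k *: G + 0.
    have -> : ann_incl (k *: phi) = k *: (G - dual_mk psid) by apply: uc_ext.
    by rewrite -scalerDr subrK addr0.
  have [S0 SD] := subspaceP (ideal_span I dual_act).
  exact: SD.
have := hd _ _ psik phik.
change (`|k * (uc_val G one - psi one)| <= 1 -> False).
rewrite GE; under [X in f (0, X)]eq_fun do rewrite bmul1.
rewrite normrM (gtr0_norm k0) -ler_pdivlMl// mulr1 => h1.
have h2 : `|psi one| <= c^-1.
  have [_ /(_ one) h] := psic; apply: le_trans h _; apply: ler_piMr.
    by rewrite invr_ge0 ltW.
  by apply: prod_norm_le => /=; rewrite ?normr0 ?normr1.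
set z := f _ in fz h1.
have : `|z| <= k^-1 + c^-1.
  by rewrite -[z](subrK (psi one)); apply: le_trans (ler_normD _ _) _; exact: lerD.
have -> : k^-1 + c^-1 = 2^-1.
  by rewrite /k /c; field; rewrite !gt_eqF.
move=> /(le_trans fz); rewrite -[2^-1]mul1r ler_pdivlMr// mul1r.
by rewrite (ler_nat _ 2 1).
Qed.

End FlatImpliesIdentity.

Lemma lbai_strictly_flat (R : realType) (A : tvsType R[i]) (mul : A -> A -> A)
    (I : linear_subspace (A * R[i]^o)%type) (D : arens_michael_decomposition mul) :
  frechet_arens_michael mul -> closed (subspace_set I) ->
  left_ideal (unit_mul mul) (subspace_set I) ->
  right_locally_bounded_approximate_identity (unit_mul mul) (subspace_set I) ->
  strictly_flat mul (quot_act mul (I := I)).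
Proof.
move=> [fA mul_alg mul_cont _] cI I_ideal lbai; split.
  exact: quot_act_frechet_module.
move=> Y1 Y2 Y3 r1 r2 r3 f g h1 h2 h3 hf hg fg.
apply/(ideal_span_exactP mul_alg I_ideal h1 h2 h3 hf hg fg); split=> y.
  exact: (lbai_ideal_span_inj D mul_alg lbai h1 h2 h3 hf hg fg).
exact: (lbai_ideal_span_lift D mul_alg lbai h1 h2 h3 hf hg fg).
Qed.

(** A neighbourhood of 0 in [I] contains all elements with small image in one algebra [(A_l)_+], so
    the norm estimate for that single [l] suffices; its bound [c] is uniform over finite sets and
    precisions. *)
Lemma flat_lbai (R : realType) (A : tvsType R[i]) (mul : A -> A -> A)
    (I : linear_subspace (A * R[i]^o)%type) (D : arens_michael_decomposition mul) :
  is_alg mul -> left_ideal (unit_mul mul) (subspace_set I) ->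
  (forall l, weakly_complemented (closure (unit_map (am_map D l) @` subspace_set I))) ->
  flat mul (quot_act mul (I := I)) ->
  right_locally_bounded_approximate_identity (unit_mul mul) (subspace_set I).
Proof.
move=> mul_alg I_ideal Ic Xflat U UI [[U1 U2] [/= U10 [e2 /= e20 eU2]] UU].
have [l [e1 e10 eU1]] := am_nbhs_sub D U10.
have [e [e0 ee1 ee2]] := min_pos e10 e20.
have small (x : A * R[i]^o) : subspace_set I x ->
    `|unit_map (am_map D l) x : (am_alg D l * R[i]^o)%type| < e -> U x.
  move=> Ix xe; apply: UU => //; split=> /=.
    apply: eU1 => /=; rewrite -am_map_norm; apply: lt_le_trans ee1.
    exact: le_lt_trans (fst_norm_le _) xe.
  apply: eU2 => /=; rewrite sub0r normrN; apply: lt_le_trans ee2.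
  exact: le_lt_trans (snd_norm_le _) xe.
have [c c0 hc] := flat_approximate_identity mul_alg I_ideal (Ic l) Xflat.
(* Dividing [b], of norm at most [c], by [2 * c / e] leaves norm at most [e / 2]; the 2 gives the
   strict inequality that [small] asks for. *)
have d0 : 0 < 2 * c / e by rewrite divr_gt0// mulr_gt0.
exists (2 * c / e) => // F /finite_seqP [s ->] sI.
have aI (i : 'I_(size s)) : subspace_set I (nth 0 s i) by apply: sI; rewrite /= mem_nth.
have [b [Ib bc ba]] := hc _ _ _ aI (divr_gt0 e0 (ltr0n _ 2)).
have [I0 ID] := subspaceP I.
have Z0 k x : subspace_set I x -> subspace_set I (k *: x).
  by move=> Ix; rewrite -[_ *: _]addr0; exact: ID.
have e2e : e / 2 < e by rewrite ltr_pdivrMr// ltr_pMr// ltr1n.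
exists b; split.
  exists ((2 * c / e)^-1 *: b); last by rewrite scalerA mulfV ?scale1r// gt_eqF.
  apply: small; first exact: Z0.
  rewrite sigmaZ normrZ gtr0_norm ?invr_gt0// invf_div.
  apply: le_lt_trans e2e; apply: (@le_trans _ _ (e / (2 * c) * c)).
    by rewrite ler_wpM2l// divr_ge0 ?mulr_ge0 ?ltW.
  by rewrite invfM mulrA divfK// gt_eqF.
move=> a /= as_; have ai : (index a s < size s)%N by rewrite index_mem.
have := ba (Ordinal ai); rewrite /= nth_index// => h.
apply: small.
  have -> : a - unit_mul mul a b = (-1) *: unit_mul mul a b + a by rewrite scaleN1r addrC.
  by apply: ID; [exact: I_ideal.2|exact: sI].
have -> : a - unit_mul mul a b = (-1) *: unit_mul mul a b + a by rewrite scaleN1r addrC.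
by rewrite sigma_linear scaleN1r addrC; exact: le_lt_trans h e2e.
Qed.

Theorem corollary9p2 (R : realType) (A : tvsType R[i]) (mul : A -> A -> A)
  (I : linear_subspace (A * R[i]^o)%type)
  (hA : frechet_arens_michael mul)
  (hI_closed : closed (subspace_set I))
  (hI_ideal : left_ideal (unit_mul mul) (subspace_set I))
  (hI_compl : exists D : arens_michael_decomposition mul, forall l : nat,
     weakly_complemented
       (closure (unit_map (am_map D l) @` subspace_set I))) :
  [<-> right_locally_bounded_approximate_identity (unit_mul mul)
         (subspace_set I);
       strictly_flat mul (quot_act mul (I := I));
       flat mul (quot_act mul (I := I))].
Proof.
have [D Ic] := hI_compl; tfae.
- exact: lbai_strictly_flat.
- move=> [hX hflat]; split=> // Y1 Y2 Y3 r1 r2 r3 f g h1 h2 h3 hf hg fg _.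
  exact: hflat.
- by have [_ mul_alg _ _] := hA; exact: flat_lbai.
Qed.
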